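(* Suppose that $q$ is not a root of unity. Then: 1. The set $\mathcal B=\{f_{\varepsilon_1}^{m_1}\cdots f_{\varepsilon_n}^{m_n}1_\lambda\}_{m_1,\dots,m_n\in\mathbb Z_+}\subset M_\lambda$ is an orthogonal (non-normalized) basis of $M_\lambda$ with respect to the Shapovalov form. 2. The $U_q(\mathfrak g)$-modules $M_\lambda$ and $N_\lambda$ are irreducible. 3. The tensor $$\mathcal F=\sum_{m_1,\ldots,m_n=0}^{\infty}(-\theta)^{\sum_{i=1}^{n}m_i}\,\frac{\prod_{i=1}^{n}q^{-\frac{m_i^2}{2}+2m_i(i-1)}}{\prod_{i=1}^n[m_i]_{q}!}\;\tilde e_{\varepsilon_1}^{m_1}\cdots\tilde e_{\varepsilon_n}^{m_n}\otimes f_{\varepsilon_1}^{m_1}\cdots f_{\varepsilon_n}^{m_n}$$ is a lift of the inverse invariant form $\mathbb C\to N_\lambda\otimes M_\lambda$ to $U_q(\mathfrak g_+)\otimes U_q(\mathfrak g_-)$ (completed tensor products), $1\mapsto\mathcal F$.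
   Context: Notation. $n\geqslant2$, $\mathfrak g=\mathfrak{so}(2n+1)$; $\mathfrak h\subset\mathfrak g$ a Cartan subalgebra; $(\cdot,\cdot)$ the form on $\mathfrak h^*$ induced by an invariant form on $\mathfrak g$, normalized so that short roots have length $1$. $\varepsilon_1,\dots,\varepsilon_n$ is the orthonormal basis of $\mathfrak h^*$ of positive short roots; simple roots $\Pi=\{\alpha_1,\dots,\alpha_n\}$, $\alpha_1=\varepsilon_1$, $\alpha_i=\varepsilon_i-\varepsilon_{i-1}$ for $i\ge2$. For $\mu\in\mathfrak h^*$, $h_\mu\in\mathfrak h$ is defined by $\nu(h_\mu)=(\nu,\mu)$ for all $\nu\in\mathfrak h^*$. Fix $\hbar\in\mathbb C$, $q=e^\hbar$; $q^z=e^{\hbar z}$, $\bar q=q^{-1}$, $[z]_q=\frac{q^z-q^{-z}}{q-q^{-1}}$, $[m]_q!=\prod_{l=1}^m[l]_q$, $[x,y]_a=xy-a\,yx$, $\theta=q^{1/2}-q^{-1/2}$. $U_q(\mathfrak g)$ is the $\mathbb C$-algebra generated by commuting invertible $q^{\pm h_\alpha}$ and $e_{\pm\alpha}$, $\alpha\in\Pi$, with $q^{h_\alpha}e_{\pm\beta}q^{-h_\alpha}=q^{\pm(\alpha,\beta)}e_{\pm\beta}$, $[e_\alpha,e_{-\beta}]=\delta_{\alpha,\beta}[h_\alpha]_q$, $[e_{\pm\alpha},[e_{\pm\alpha},e_{\pm\beta}]_q]_{\bar q}=0$ if $2(\alpha,\beta)/(\alpha,\alpha)=-1$, $[e_{\pm\alpha_1},e_{\pm\delta}]=0$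 where $e_{\pm\delta}=[e_{\pm\alpha_1},[e_{\pm\alpha_1},e_{\pm\alpha_2}]_q]_{\bar q}$ ($\delta=2\alpha_1+\alpha_2$), and $[e_{\pm\alpha},e_{\pm\beta}]=0$ if $(\alpha,\beta)=0$. Put $f_\alpha=e_{-\alpha}$, $f_\delta=e_{-\delta}$. $U_q(\mathfrak g_\pm)$ is generated by the $e_{\pm\alpha}$, $\alpha\in\Pi$; $U_q(\mathfrak h)$ by the $q^{\pm h_\alpha}$; $U_q(\mathfrak l)$ by $U_q(\mathfrak h)$ and $e_{\pm\alpha_i}$, $i\ge2$; $U_q(\mathfrak p_\pm)$ by $U_q(\mathfrak l)$ and $U_q(\mathfrak g_\pm)$. Comultiplication: $\Delta(e_\alpha)=e_\alpha\otimes q^{h_\alpha}+1\otimes e_\alpha$, $\Delta(f_\alpha)=f_\alpha\otimes1+q^{-h_\alpha}\otimes f_\alpha$, $\Delta(q^{h_\alpha})=q^{h_\alpha}\otimes q^{h_\alpha}$; $\gamma$ is the antipode, $\gamma^{-1}(e_\alpha)=-q^{-h_\alpha}e_\alpha$. Root vectors: $f_{\varepsilon_1}=f_{\alpha_1}$, $f_{\varepsilon_{i}}=[f_{\varepsilon_{i-1}},f_{\alpha_i}]_{\bar q}$; $\tilde e_{\varepsilon_1}=e_{\alpha_1}$, $\tilde e_{\varepsilon_{i}}=[e_{\alpha_{i}},\tilde e_{\varepsilon_{i-1}}]_{\bar q}$. Modules: $\lambda\in\mathfrak h^*$ satisfies $q^{2(\lambda,\varepsilon_i)}=-q^{-1}$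 for $i=1,\dots,n$ and $(\alpha_i,\lambda)=0$ for $i>1$. $\mathbb C_{\pm\lambda}$ is the one-dimensional representation of $U_q(\mathfrak p_\pm)$ with $q^{h_\alpha}\mapsto q^{\pm(\lambda,\alpha)}$ and all $e_{\pm\beta}$ in $U_q(\mathfrak p_\pm)$ acting by zero. Put $\hat M_\lambda=U_q(\mathfrak g)\otimes_{U_q(\mathfrak p_+)}\mathbb C_\lambda$, $\hat N_\lambda=U_q(\mathfrak g)\otimes_{U_q(\mathfrak p_-)}\mathbb C_{-\lambda}$, with generators $1_\lambda$, $1^*_\lambda$. The vector $f_\delta1_\lambda$ (resp. $e_\delta1_\lambda^*$) is killed by all $e_\alpha$ (resp. $e_{-\alpha}$), $\alpha\in\Pi$. $M_\lambda=\hat M_\lambda/U_q(\mathfrak g)f_\delta1_\lambda$ and $N_\lambda=\hat N_\lambda/U_q(\mathfrak g)e_\delta1^*_\lambda$; the images of the generators are again denoted $1_\lambda$, $1_\lambda^*$. Forms: $x\mapsto\langle x\rangle$, $U_q(\mathfrak g)\to\mathbb C$, is the projection to $U_q(\mathfrak h)$ along $\sum_{\alpha\in\Pi}f_\alpha U_q(\mathfrak g)+\sum_{\alpha\in\Pi}U_q(\mathfrak g)e_\alpha$ followed by evaluation at $\lambda$, $q^{h_\mu}\mapsto q^{(\lambda,\mu)}$. The invariant form $M_\lambda\otimes N_\lambda\to\mathbb C$ is the unique $U_q(\mathfrak g)$-invariant bilinear form with $(1_\lambda,1_\lambda^* )=1$; it is given by $(x1_\lambda,y1_\lambda^* )=\langle\gamma^{-1}(y)x\rangle$.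 The Shapovalov form on $M_\lambda$ is $x1_\lambda\otimes y1_\lambda\mapsto\langle\omega(x)y\rangle$, where $\omega$ is the anti-algebra involution with $\omega(e_\alpha)=f_\alpha$, $\omega(f_\alpha)=e_\alpha$, $\omega(q^{h_\alpha})=q^{h_\alpha}$. The inverse invariant form is the element $\sum_i n_i\otimes v_i$ of the completed tensor product $N_\lambda\otimes M_\lambda$ with $\sum_i(v,n_i)v_i=v$ for all $v\in M_\lambda$ and $\sum_i (v_i,u)\,n_i=u$ for all $u\in N_\lambda$; an element $\sum a_i\otimes b_i$ of the completed $U_q(\mathfrak g_+)\otimes U_q(\mathfrak g_-)$ is a lift of it if $\sum a_i1^*_\lambda\otimes b_i1_\lambda$ equals it. *)

(* Defs.v *)
From HB Require Import structures.
From mathcomp Require Import all_boot all_order all_algebra.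
From mathcomp Require Import complex.
From mathcomp Require Import boolp classical_sets cardinality fsbigop.
From mathcomp Require Import reals topology sequences exp trigo.

Set Implicit Arguments.
Unset Strict Implicit.
Unset Printing Implicit Defensive.

Import Order.TTheory GRing.Theory Num.Theory.
Local Open Scope ring_scope.
Local Open Scope classical_set_scope.
Local Open Scope quotient_scope.
Local Open Scope complex_scope.

Definition span_submod (A : pzRingType) (V : lmodType A) (S : set V) : set V :=
  [set v | forall W : {pred V},
     submod_closed W -> (forall s, S s -> s \in W) -> v \in W].

Definition gen_subalg (F : pzRingType) (A : lalgType F) (S : set A) : set A :=
  [set a | forall B : {pred A},
     subalg_closed B -> (forall s, S s -> s \in B) -> a \in B].

Definition irreducible_module (A : pzRingType) (V : lmodType A) : Prop :=
  (exists v : V, v != 0) /\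
  (forall W : {pred V}, submod_closed W ->
     (forall v, v \in W -> v = 0) \/ (forall v, v \in W)).

Section QuotientModule.
Context (A : pzRingType) (V : lmodType A) (S : set V).
Implicit Types u v w : V.

Lemma span_submod0 : span_submod S 0.
Proof. by move=> W [W0 _] _. Qed.

Lemma span_submodZD a u v :
  span_submod S u -> span_submod S v -> span_submod S (a *: u + v).
Proof.
by move=> Su Sv W Wc SW; case: (Wc) => _; apply; [exact: Su|exact: Sv].
Qed.

Lemma span_submodD u v :
  span_submod S u -> span_submod S v -> span_submod S (u + v).
Proof. by rewrite -{2}(scale1r u); exact: span_submodZD. Qed.

Lemma span_submodZ a u : span_submod S u -> span_submod S (a *: u).
Proof.
by move=> Su; rewrite -(addr0 (a *: u)); apply: span_submodZD => //;
  exact: span_submod0.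
Qed.

Lemma span_submodN u : span_submod S u -> span_submod S (- u).
Proof. by rewrite -scaleN1r; exact: span_submodZ. Qed.

Definition qmod_rel u v : bool := `[< span_submod S (u - v) >].

Lemma qmod_rel_refl : reflexive qmod_rel.
Proof. by move=> u; apply/asboolP; rewrite subrr; exact: span_submod0. Qed.

Lemma qmod_rel_sym : symmetric qmod_rel.
Proof.
by move=> u v; apply/asboolP/asboolP => /span_submodN; rewrite opprB.
Qed.

Lemma qmod_rel_trans : transitive qmod_rel.
Proof.
move=> v u w /asboolP uv /asboolP vw; apply/asboolP.
by rewrite -(subrKA v); exact: span_submodD.
Qed.

Canonical qmod_equiv :=
  EquivRel qmod_rel qmod_rel_refl qmod_rel_sym qmod_rel_trans.

(** [qmod S] is the quotient of [V] by the submodule spanned by [S]. *)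
Definition qmod : Type := {eq_quot qmod_equiv}.

HB.instance Definition _ := Choice.on qmod.
HB.instance Definition _ := EqQuotient.on qmod.

Lemma qmodP u v : reflect (span_submod S (u - v)) (\pi_qmod u == \pi_qmod v).
Proof. by apply: (iffP idP); rewrite eqmodE => /asboolP. Qed.

Lemma qmod_repr u : span_submod S (repr (\pi_qmod u) - u).
Proof. by apply/qmodP; rewrite reprK. Qed.

Definition qmod_zero : qmod := \pi_qmod 0.
Definition qmod_opp (x : qmod) : qmod := \pi_qmod (- repr x).
Definition qmod_add (x y : qmod) : qmod := \pi_qmod (repr x + repr y).
Definition qmod_scale (a : A) (x : qmod) : qmod := \pi_qmod (a *: repr x).

Lemma qmod_piN u : qmod_opp (\pi u) = \pi_qmod (- u).
Proof.
by apply/eqP/qmodP; rewrite -opprD; apply/span_submodN/qmod_repr.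
Qed.

Lemma qmod_piD u v : qmod_add (\pi u) (\pi v) = \pi_qmod (u + v).
Proof.
by apply/eqP/qmodP; rewrite opprD addrACA; apply: span_submodD;
  exact: qmod_repr.
Qed.

Lemma qmod_piZ a u : qmod_scale a (\pi u) = \pi_qmod (a *: u).
Proof. by apply/eqP/qmodP; rewrite -scalerBr; apply/span_submodZ/qmod_repr. Qed.

Lemma qmod_addA : associative qmod_add.
Proof.
by elim/quotW=> x; elim/quotW=> y; elim/quotW=> z; rewrite !qmod_piD addrA.
Qed.
Lemma qmod_addC : commutative qmod_add.
Proof. by elim/quotW=> x; elim/quotW=> y; rewrite !qmod_piD addrC. Qed.
Lemma qmod_add0 : left_id qmod_zero qmod_add.
Proof. by elim/quotW=> x; rewrite qmod_piD add0r. Qed.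
Lemma qmod_addN : left_inverse qmod_zero qmod_opp qmod_add.
Proof. by elim/quotW=> x; rewrite qmod_piN qmod_piD addNr. Qed.

HB.instance Definition _ :=
  GRing.isZmodule.Build qmod qmod_addA qmod_addC qmod_add0 qmod_addN.

Lemma qmod_scaleA a b x :
  qmod_scale a (qmod_scale b x) = qmod_scale (a * b) x.
Proof. by elim/quotW: x => x; rewrite !qmod_piZ scalerA. Qed.
Lemma qmod_scale1 : left_id 1 qmod_scale.
Proof. by elim/quotW=> x; rewrite qmod_piZ scale1r. Qed.
Lemma qmod_scaleDr : right_distributive qmod_scale qmod_add.
Proof.
move=> a; elim/quotW=> x; elim/quotW=> y.
by rewrite !(qmod_piZ, qmod_piD) scalerDr.
Qed.
Lemma qmod_scaleDl x a b :
  qmod_scale (a + b) x = qmod_add (qmod_scale a x) (qmod_scale b x).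
Proof. by elim/quotW: x => x; rewrite !qmod_piZ qmod_piD scalerDl. Qed.

HB.instance Definition _ := GRing.Zmodule_isLmodule.Build A qmod
  qmod_scaleA qmod_scale1 qmod_scaleDr qmod_scaleDl.

End QuotientModule.

Inductive aterm (F G : Type) : Type :=
| TGen of G
| TConst of F
| TAdd of aterm F G & aterm F G
| TMul of aterm F G & aterm F G.

Arguments TGen {F G} _.
Arguments TConst {F G} _.

Section PresentedAlgebra.
Context (F : comNzRingType) (G : Type).
Context (rel : aterm F G -> aterm F G -> Prop).
Notation term := (aterm F G).

(** The least congruence containing [rel] and the axioms of unital associative
    [F]-algebras. *)
Inductive aeq : term -> term -> Prop :=
| aeq_rel a b : rel a b -> aeq a b
| aeq_refl a : aeq a a
| aeq_sym a b : aeq a b -> aeq b a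
| aeq_trans b a c : aeq a b -> aeq b c -> aeq a c
| aeq_add a b a' b' : aeq a a' -> aeq b b' -> aeq (TAdd a b) (TAdd a' b')
| aeq_mul a b a' b' : aeq a a' -> aeq b b' -> aeq (TMul a b) (TMul a' b')
| aeq_addA a b c : aeq (TAdd a (TAdd b c)) (TAdd (TAdd a b) c)
| aeq_addC a b : aeq (TAdd a b) (TAdd b a)
| aeq_add0 a : aeq (TAdd (TConst 0) a) a
| aeq_mulA a b c : aeq (TMul a (TMul b c)) (TMul (TMul a b) c)
| aeq_mul1l a : aeq (TMul (TConst 1) a) a
| aeq_mul0l a : aeq (TMul (TConst 0) a) (TConst 0)
| aeq_mulDl a b c : aeq (TMul (TAdd a b) c) (TAdd (TMul a c) (TMul b c))
| aeq_mulDr a b c : aeq (TMul a (TAdd b c)) (TAdd (TMul a b) (TMul a c))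
| aeq_constD x y : aeq (TConst (x + y)) (TAdd (TConst x) (TConst y))
| aeq_constM x y : aeq (TConst (x * y)) (TMul (TConst x) (TConst y))
| aeq_constC x a : aeq (TMul (TConst x) a) (TMul a (TConst x)).

HB.instance Definition _ := gen_eqMixin term.
HB.instance Definition _ := gen_choiceMixin term.

Definition palg_rel (a b : term) : bool := `[< aeq a b >].

Lemma palg_rel_refl : reflexive palg_rel.
Proof. by move=> a; apply/asboolP; exact: aeq_refl. Qed.
Lemma palg_rel_sym : symmetric palg_rel.
Proof. by move=> a b; apply/asboolP/asboolP; exact: aeq_sym. Qed.
Lemma palg_rel_trans : transitive palg_rel.
Proof.
by move=> b a c /asboolP ab /asboolP bc; apply/asboolP; exact: aeq_trans bc.
Qed.

Canonical palg_equiv :=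
  EquivRel palg_rel palg_rel_refl palg_rel_sym palg_rel_trans.

Definition palg : Type := {eq_quot palg_equiv}.

HB.instance Definition _ := Choice.on palg.
HB.instance Definition _ := EqQuotient.on palg.

Lemma palgP a b : reflect (aeq a b) (\pi_palg a == \pi_palg b).
Proof. by apply: (iffP idP); rewrite eqmodE => /asboolP. Qed.

Lemma palg_eq a b : aeq a b -> \pi_palg a = \pi_palg b.
Proof. by move=> ab; apply/eqP/palgP. Qed.

Lemma palg_repr a : aeq (repr (\pi_palg a)) a.
Proof. by apply/palgP; rewrite reprK. Qed.

Definition palg_const (x : F) : palg := \pi_palg (TConst x).
Definition palg_add (x y : palg) : palg := \pi_palg (TAdd (repr x) (repr y)).
Definition palg_mul (x y : palg) : palg := \pi_palg (TMul (repr x) (repr y)).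
Definition palg_opp (x : palg) : palg := palg_mul (palg_const (-1)) x.
Definition palg_scale (a : F) (x : palg) : palg := palg_mul (palg_const a) x.

Lemma palg_piD a b : palg_add (\pi a) (\pi b) = \pi_palg (TAdd a b).
Proof. by apply: palg_eq; apply: aeq_add; exact: palg_repr. Qed.
Lemma palg_piM a b : palg_mul (\pi a) (\pi b) = \pi_palg (TMul a b).
Proof. by apply: palg_eq; apply: aeq_mul; exact: palg_repr. Qed.

Lemma palg_addA : associative palg_add.
Proof.
elim/quotW=> x; elim/quotW=> y; elim/quotW=> z.
by rewrite !palg_piD; apply: palg_eq; exact: aeq_addA.
Qed.
Lemma palg_addC : commutative palg_add.
Proof.
elim/quotW=> x; elim/quotW=> y.
by rewrite !palg_piD; apply: palg_eq; exact: aeq_addC.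
Qed.
Lemma palg_add0 : left_id (palg_const 0) palg_add.
Proof. by elim/quotW=> x; rewrite palg_piD; apply: palg_eq; exact: aeq_add0. Qed.
Lemma palg_mul1 : left_id (palg_const 1) palg_mul.
Proof.
by elim/quotW=> x; rewrite palg_piM; apply: palg_eq; exact: aeq_mul1l.
Qed.
Lemma palg_mulC1 x a : palg_mul (palg_const a) x = palg_mul x (palg_const a).
Proof.
by elim/quotW: x => x; rewrite !palg_piM; apply: palg_eq; exact: aeq_constC.
Qed.
Lemma palg_mulr1 : right_id (palg_const 1) palg_mul.
Proof. by move=> x; rewrite -palg_mulC1 palg_mul1. Qed.
Lemma palg_mulA : associative palg_mul.
Proof.
elim/quotW=> x; elim/quotW=> y; elim/quotW=> z.
by rewrite !palg_piM; apply: palg_eq; exact: aeq_mulA.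
Qed.
Lemma palg_mulDl : left_distributive palg_mul palg_add.
Proof.
elim/quotW=> x; elim/quotW=> y; elim/quotW=> z.
by rewrite !(palg_piM, palg_piD); apply: palg_eq; exact: aeq_mulDl.
Qed.
Lemma palg_mulDr : right_distributive palg_mul palg_add.
Proof.
elim/quotW=> x; elim/quotW=> y; elim/quotW=> z.
by rewrite !(palg_piM, palg_piD); apply: palg_eq; exact: aeq_mulDr.
Qed.
Lemma palg_constD a b :
  palg_const (a + b) = palg_add (palg_const a) (palg_const b).
Proof. by rewrite palg_piD; apply: palg_eq; exact: aeq_constD. Qed.
Lemma palg_constM a b :
  palg_const (a * b) = palg_mul (palg_const a) (palg_const b).
Proof. by rewrite palg_piM; apply: palg_eq; exact: aeq_constM. Qed.
Lemma palg_addN : left_inverse (palg_const 0) palg_opp palg_add.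
Proof.
elim/quotW=> x; rewrite /palg_opp -[X in palg_add _ X]palg_mul1 -palg_mulDl.
by rewrite -palg_constD addNr palg_piM; apply: palg_eq; exact: aeq_mul0l.
Qed.

HB.instance Definition _ :=
  GRing.isZmodule.Build palg palg_addA palg_addC palg_add0 palg_addN.
HB.instance Definition _ := GRing.Zmodule_isPzRing.Build palg
  palg_mulA palg_mul1 palg_mulr1 palg_mulDl palg_mulDr.

Lemma palg_scaleA a b x :
  palg_scale a (palg_scale b x) = palg_scale (a * b) x.
Proof. by rewrite /palg_scale palg_constM palg_mulA. Qed.
Lemma palg_scale1 : left_id 1 palg_scale.
Proof. exact: palg_mul1. Qed.
Lemma palg_scaleDr : right_distributive palg_scale palg_add.
Proof. by move=> a x y; exact: palg_mulDr. Qed.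
Lemma palg_scaleDl x : {morph palg_scale^~ x : a b / a + b}.
Proof. by move=> a b; rewrite /palg_scale palg_constD; exact: palg_mulDl. Qed.

HB.instance Definition _ := GRing.Zmodule_isLmodule.Build F palg
  palg_scaleA palg_scale1 palg_scaleDr palg_scaleDl.

Lemma palg_scaleAl (a : F) (x y : palg) : a *: (x * y) = (a *: x) * y.
Proof. exact: palg_mulA. Qed.
Lemma palg_scaleAr (a : F) (x y : palg) : a *: (x * y) = x * (a *: y).
Proof.
change (palg_mul (palg_const a) (palg_mul x y)
        = palg_mul x (palg_mul (palg_const a) y)).
by rewrite palg_mulA palg_mulC1 -palg_mulA.
Qed.

End PresentedAlgebra.

Section QNumbers.
Context (R : realType).
Implicit Types z : R[i].

Definition cexp z : R[i] :=
  let: a +i* b := z in (expR a * cos b) +i* (expR a * sin b).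

Context (hbar : R[i]).

Definition qpow z : R[i] := cexp (hbar * z).
Definition qint z : R[i] := (qpow z - qpow (- z)) / (qpow 1 - qpow (- 1)).
Definition qfact (m : nat) : R[i] := \prod_(1 <= l < m.+1) qint l%:R.
Definition theta : R[i] := qpow (1 / 2) - qpow (- (1 / 2)).

End QNumbers.

(** Weights are written in the basis eps_1, ..., eps_n of h^*; all indices
    start at 0 here, so that [eps i] is eps_(i+1) and [alpha i] is alpha_(i+1). *)
Section Weights.
Context (R : realType) (n : nat).
Notation weight := 'rV[R[i]]_n.

Definition wform (mu nu : weight) : R[i] := \sum_(i < n) mu 0 i * nu 0 i.
Definition eps (i : 'I_n) : weight := delta_mx 0 i.
Definition alpha (i : 'I_n) : weight :=
  \row_(j < n) ((j == i)%:R - (j.+1 == i :> nat)%:R).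

End Weights.

(** The sign of a boolean: [true] stands for +, [false] for -. *)
Definition sg (F : pzRingType) (s : bool) : F := if s then 1 else -1.

(** [GE s i] is e_(+-alpha_i) and [GK s i] is q^(+-h_alpha_i). *)
Inductive Uq_gen (n : nat) : Type :=
| GE of bool & 'I_n
| GK of bool & 'I_n.

Section QuantumGroup.
Context (R : realType) (n : nat) (hbar : R[i]).
Notation C := R[i].
Notation q := (qpow hbar 1).
Notation term := (aterm C (Uq_gen n)).
Notation X s i := (TGen (GE s i) : term).
Notation K s i := (TGen (GK s i) : term).

Definition tbr (a : C) (x y : term) : term :=
  TAdd (TMul x y) (TMul (TConst (- a)) (TMul y x)).

Inductive Uq_rel : term -> term -> Prop :=
| Uq_KK s i : Uq_rel (TMul (K s i) (K (~~ s) i)) (TConst 1)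
| Uq_Kcomm s t i j : Uq_rel (TMul (K s i) (K t j)) (TMul (K t j) (K s i))
| Uq_KX s i j :
    Uq_rel (TMul (TMul (K true i) (X s j)) (K false i))
           (TMul (TConst (qpow hbar (sg C s * wform (alpha R i) (alpha R j))))
                 (X s j))
| Uq_EF i j :
    Uq_rel (tbr 1 (X true i) (X false j))
           (if i == j then
              TMul (TConst ((q - q^-1)^-1))
                   (TAdd (K true i) (TMul (TConst (-1)) (K false i)))
            else TConst 0)
| Uq_serre s i j :
    2 * wform (alpha R i) (alpha R j) / wform (alpha R i) (alpha R i) = -1 ->
    Uq_rel (tbr q^-1 (X s i) (tbr q (X s i) (X s j))) (TConst 0)
| Uq_serre_delta s (i j : 'I_n) : i = 0%N :> nat -> j = 1%N :> nat ->
    Uq_rel (tbr 1 (X s i) (tbr q^-1 (X s i) (tbr q (X s i) (X s j)))) (TConst 0)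
| Uq_orth s i j : wform (alpha R i) (alpha R j) = 0 ->
    Uq_rel (tbr 1 (X s i) (X s j)) (TConst 0).

Definition Uq : Type := palg Uq_rel.

HB.instance Definition _ := GRing.PzRing.on Uq.
HB.instance Definition _ := GRing.Lmodule.on Uq.

(** The counit; it shows 1 <> 0 in [Uq]. *)
Fixpoint tcounit (a : term) : C :=
  match a with
  | TGen (GE _ _) => 0
  | TGen (GK _ _) => 1
  | TConst c => c
  | TAdd a b => tcounit a + tcounit b
  | TMul a b => tcounit a * tcounit b
  end.

Lemma tcounit_aeq a b : aeq Uq_rel a b -> tcounit a = tcounit b.
Proof.
elim=> //=; try by move=> *; congruence.
- move=> {}a {}b []; move=> * /=;
    rewrite ?(mulr0, mul0r, mulr1, mul1r, addr0, subrr) //.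
  by case: ifP => //= _; rewrite mulr1 subrr mulr0.
- by move=> *; exact: addrA.
- by move=> *; exact: addrC.
- by move=> *; exact: add0r.
- by move=> *; exact: mulrA.
- by move=> *; exact: mul1r.
- by move=> *; exact: mul0r.
- by move=> *; exact: mulrDl.
- by move=> *; exact: mulrDr.
- by move=> *; exact: mulrC.
Qed.

Lemma Uq_one_neq0 : (1 : Uq) != 0.
Proof.
by apply/negP => /palgP /tcounit_aeq /= /eqP; rewrite oner_eq0.
Qed.

HB.instance Definition _ := GRing.PzSemiRing_isNonZero.Build Uq Uq_one_neq0.
HB.instance Definition _ :=
  GRing.Lmodule_isLalgebra.Build C Uq (@palg_scaleAl _ _ Uq_rel).
HB.instance Definition _ :=
  GRing.Lalgebra_isAlgebra.Build C Uq (@palg_scaleAr _ _ Uq_rel).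

Definition Ue (s : bool) (i : 'I_n) : Uq := \pi_(palg Uq_rel) (X s i).
Definition Uk (s : bool) (i : 'I_n) : Uq := \pi_(palg Uq_rel) (K s i).

(** [simple_vec s k] is [Ue s k], with the index in [nat] (and 0 if [k >= n]). *)
Definition simple_vec (s : bool) (k : nat) : Uq :=
  if insub k is Some i then Ue s i else 0.

Definition qbr (a : C) (x y : Uq) : Uq := x * y - a *: (y * x).

Definition e_delta (s : bool) : Uq :=
  qbr q^-1 (simple_vec s 0) (qbr q (simple_vec s 0) (simple_vec s 1)).

Fixpoint f_eps (k : nat) : Uq :=
  if k is k'.+1 then qbr q^-1 (f_eps k') (simple_vec false k)
  else simple_vec false 0.

Fixpoint te_eps (k : nat) : Uq :=
  if k is k'.+1 then qbr q^-1 (simple_vec true k) (te_eps k')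
  else simple_vec true 0.

(** [Uq_half true] is U_q(g_+) and [Uq_half false] is U_q(g_-). *)
Definition Uq_half (s : bool) : set Uq :=
  gen_subalg [set x | exists i, x = Ue s i].

Definition Uq_weight (mu : 'rV[C]_n) : set Uq :=
  [set x | forall i,
     Uk true i * x * Uk false i = qpow hbar (wform (alpha R i) mu) *: x].

Definition anti_morphism (g : Uq -> Uq) : Prop :=
  [/\ linear g, g 1 = 1 & forall x y, g (x * y) = g y * g x].

(** The involution omega: an anti-morphism is determined by its values on
    the generators. *)
Definition omega : Uq -> Uq :=
  xget (fun x : Uq => x) [set g : Uq -> Uq | [/\ anti_morphism g,
                       forall s i, g (Ue s i) = Ue (~~ s) i
                     & forall s i, g (Uk s i) = Uk s i]].

(** The inverse of the antipode.  Its value on f_alpha comes from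
    Delta(f) = f (x) 1 + q^(-h) (x) f: the identity
    sum gamma^-1(x_(2)) x_(1) = counit(x) gives f + gamma^-1(f) q^(-h) = 0. *)
Definition inv_antipode : Uq -> Uq :=
  xget (fun x : Uq => x) [set g : Uq -> Uq | [/\ anti_morphism g,
                       forall i, g (Ue true i) = - (Uk false i * Ue true i),
                       forall i, g (Ue false i) = - (Ue false i * Uk true i)
                     & forall s i, g (Uk s i) = Uk (~~ s) i]].

Section Modules.
Context (lam : 'rV[C]_n).

(** The graph of q^(h_mu) |-> q^(lambda, mu), U_q(h) -> C, as the subalgebra of
    U_q(g) x C generated by its values on generators. *)
Definition eval_lam : set (Uq * C^o) :=
  gen_subalg [set p | exists s i,
    p = (Uk s i, qpow hbar (sg C s * wform lam (alpha R i)))].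

Definition fU_plus_Ue : set Uq :=
  [set x | exists y z : 'I_n -> Uq,
     x = \sum_(i < n) Ue false i * y i + \sum_(i < n) z i * Ue true i].

(** <x>: the projection of x to U_q(h) along [fU_plus_Ue], evaluated at
    lambda. *)
Definition bracket (x : Uq) : C :=
  xget 0 [set c | exists2 h, eval_lam (h, c) & fU_plus_Ue (x - h)].

(** The graph of the representation C_(+-lambda) of U_q(p_+-): the subalgebra
    of U_q(g) x C generated by its values on the generators of U_q(p_+-). *)
Definition C_lam (s : bool) : set (Uq * C^o) :=
  gen_subalg [set p |
    [\/ exists t i,
          p = (Uk t i, qpow hbar (sg C s * (sg C t * wform lam (alpha R i)))),
        exists i, p = (Ue s i, 0)
      | exists2 i : 'I_n, (0 < i)%N & p = (Ue (~~ s) i, 0)]].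

(** [Mhat true] is U_q(g) (x)_U_q(p_+) C_lambda and [Mhat false] is
    U_q(g) (x)_U_q(p_-) C_(-lambda).  The tensor product over U_q(p) is the
    quotient of U_q(g) (x)_C C = U_q(g) by the span of the elements
    u a (x) 1 - u (x) a.1 with u in U_q(g) and a in U_q(p). *)
Definition Mhat (s : bool) : lmodType Uq :=
  qmod [set x : Uq^o | exists2 p, C_lam s p & x = p.1 - p.2%:A].

Definition vac_hat (s : bool) : Mhat s :=
  \pi_(qmod [set x : Uq^o | exists2 p, C_lam s p & x = p.1 - p.2%:A]) 1.

(** [Mlam true] is M_lambda and [Mlam false] is N_lambda. *)
Definition Mlam (s : bool) : lmodType Uq :=
  qmod [set e_delta (~~ s) *: vac_hat s].

Definition vac (s : bool) : Mlam s :=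
  \pi_(qmod [set e_delta (~~ s) *: vac_hat s]) (vac_hat s).

Notation M := (Mlam true).
Notation N := (Mlam false).

(** A preimage of v under x |-> x . vac; the values of the two forms below do
    not depend on which one is chosen. *)
Definition lift_vec (s : bool) (v : Mlam s) : Uq :=
  xget 0 [set x | v = x *: vac s].

Definition shapovalov (v w : M) : C :=
  bracket (omega (lift_vec v) * lift_vec w).

Definition invariant_form (v : M) (u : N) : C :=
  bracket (inv_antipode (lift_vec u) * lift_vec v).

Definition C_basis (I : choiceType) (b : I -> M) : Prop :=
  (forall (r : seq I) (c : I -> C), uniq r ->
     \sum_(i <- r) (c i)%:A *: b i = 0 -> forall i, i \in r -> c i = 0) /\
  (forall v, exists (r : seq I) (c : I -> C),
     v = \sum_(i <- r) (c i)%:A *: b i).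

Definition orthogonal_basis (I : choiceType) (b : I -> M) : Prop :=
  C_basis b /\ (forall i j, i != j -> shapovalov (b i) (b j) = 0).

(** A formal sum of the simple tensors (t i).1 (x) (t i).2 belongs to the
    completion of U_q(g_+) (x) U_q(g_-), the product of the spaces
    U_q(g_+)[mu] (x) U_q(g_-)[nu] over all pairs of weights. *)
Definition completed_tensor (I : choiceType) (t : I -> Uq * Uq) : Prop :=
  [/\ forall i, Uq_half true (t i).1 /\ Uq_half false (t i).2,
      forall i, (exists mu, Uq_weight mu (t i).1) /\
                (exists nu, Uq_weight nu (t i).2)
    & forall mu nu, finite_set [set i | [/\ Uq_weight mu (t i).1,
        Uq_weight nu (t i).2, (t i).1 != 0 & (t i).2 != 0]]].

(** The formal sum of the n_i (x) v_i, with (n_i, v_i) = t i, is the inverse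
    of the invariant form. *)
Definition inverse_invariant_form (I : choiceType) (t : I -> N * M) : Prop :=
  (forall v : M,
     finite_set [set i | (invariant_form v (t i).1)%:A *: (t i).2 != 0] /\
     \sum_(i \in setT) (invariant_form v (t i).1)%:A *: (t i).2 = v) /\
  (forall u : N,
     finite_set [set i | (invariant_form (t i).2 u)%:A *: (t i).1 != 0] /\
     \sum_(i \in setT) (invariant_form (t i).2 u)%:A *: (t i).1 = u).

Definition lift_of_inverse_form (I : choiceType) (t : I -> Uq * Uq) : Prop :=
  completed_tensor t /\
  inverse_invariant_form (fun i => ((t i).1 *: vac false, (t i).2 *: vac true)).

End Modules.

Definition f_mon (m : {ffun 'I_n -> nat}) : Uq := \prod_(i < n) f_eps i ^+ m i.
Definition te_mon (m : {ffun 'I_n -> nat}) : Uq :=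
  \prod_(i < n) te_eps i ^+ m i.

(** 0-based i: 2 m_i (i - 1) becomes 2 m_i i. *)
Definition F_coef (m : {ffun 'I_n -> nat}) : C :=
  (- theta hbar) ^+ (\sum_(i < n) m i) *
  ((\prod_(i < n) qpow hbar (- ((m i)%:R ^+ 2 / 2) + 2 * (m i)%:R * i%:R)) /
   (\prod_(i < n) qfact hbar (m i))).

Definition F_tensor (m : {ffun 'I_n -> nat}) : Uq * Uq :=
  (F_coef m *: te_mon m, f_mon m).

End QuantumGroup.

(* Main.v *)
Require Import Defs.
From mathcomp Require Import all_boot all_order all_algebra.
From mathcomp Require Import ring zify.
From mathcomp Require Import complex.
From mathcomp Require Import boolp classical_sets functions cardinality fsbigop.
From mathcomp Require Import reals exp trigo.
Set Implicit Arguments.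
Unset Strict Implicit.
Unset Printing Implicit Defensive.
Import Order.TTheory GRing.Theory Num.Theory.
Local Open Scope ring_scope.
Local Open Scope quotient_scope.
Local Open Scope complex_scope.

(** Both modules are identified with a Fock space of [n] q-oscillators, on
    which every assertion can be read off.

    The model.  On functions of an integer sequence [m] let [f_(alpha_1)] shift
    the first entry up, let [f_(alpha_k)] move a unit from entry [k-1] to entry
    [k], and let the [e_(alpha_k)] shift back, with q-integers as coefficients
    ([ladder]); [q^(h_alpha)] acts diagonally ([torus]).  The one condition that
    is not automatic is [[e_(alpha_1), f_(alpha_1)] = [h_(alpha_1)]_q]: it says
    that [t = q^(lambda, alpha_1)] satisfies [t^2 = - q^-1], which is the
    hypothesis on [lambda].  So [U_q(g)] acts ([tact_rel]); the delta function
    [ket 0] at the zero sequence satisfies the relations that define the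
    generator of [M_lambda], including [f_delta = 0], because [e_delta] and
    [f_delta] act by 0 on the whole model.  Hence [x 1_lambda = 0] implies
    [x ket 0 = 0] ([vac_annihilator]), which gives a map from [M_lambda] to the
    model ([wave]).  Exchanging the roles of the [e]'s and the [f]'s gives the
    same for [N_lambda]; a boolean [s] treats both modules at once.

    Basis.  In the model [f_(eps_k)] is a creation operator of mode [k], up to
    a nonzero factor ([root_opE]), so an ordered monomial in the [f_(eps_k)]
    sends [ket 0] to a nonzero multiple of the delta function at its exponents
    ([act_root_monomial]).  This gives linear independence.  For spanning, the
    q-commutators [[f_(eps_i), f_(eps_j)]_q], [i < j], which are root vectors
    for [eps_i + eps_j], kill the whole module: they kill the generator, since
    all of them come from [f_delta], and the vectors that they kill are closed
    under every [f_alpha] ([killed_r], [killed_r0]).  The delicate case is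
    [pairing_r0_12], where the relations close up to
    [(1 + q^2 + q^4) s = 0], and [q^6 <> 1] is used.  On the
    module the [f_(eps_k)] therefore q-commute, and every vector is a combination
    of ordered monomials ([monomials_span]).

    Irreducibility.  The opposite root vectors are annihilation operators with
    coefficients that do not vanish, as [q] is not a root of unity.  Take a
    monomial of maximal total degree in a nonzero vector: the corresponding
    lowering monomial sends this vector to a nonzero multiple of the generator
    ([Mlam_irreducible]).

    Forms.  By the triangular decomposition, [<x>] is the coefficient of
    [ket 0] in [x ket 0] ([bracketE]).  If [g] is [omega] or [gamma^-1], then
    the coefficient of [ket 0] in [g(y) ket p] is that of [ket p] in [y ket 0]
    times an explicit number depending on [p] ([adjoint]): it suffices to check
    this on generators.  So both forms are diagonal in the monomials, with known
    diagonal entries.  For the Shapovalov form this is orthogonality.  For the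
    invariant form the coefficients of [F] are the inverses of the diagonal
    entries ([F_coefE]), and [F] is the inverse form because each vector is the
    sum of its components along the monomials ([ket_expansion]). *)

(** * Identities in noncommutative polynomials *)
Section NonCommutativePolynomials.
Variables (F : fieldType) (A : algType F).

Inductive ncexp : Type :=
| NCvar of nat
| NCone
| NCzero
| NCadd of ncexp & ncexp
| NCopp of ncexp
| NCmul of ncexp & ncexp
| NCscale of F & ncexp.

Fixpoint nceval (env : seq A) (e : ncexp) : A :=
  match e with
  | NCvar i => nth 0 env i
  | NCone => 1
  | NCzero => 0
  | NCadd a b => nceval env a + nceval env b
  | NCopp a => - nceval env a
  | NCmul a b => nceval env a * nceval env b
  | NCscale c a => c *: nceval env a
  end.

(** [nccat] and [wcat] are concatenations under names of their own, so that the
    tactic [nc] can unfold exactly them and leave the coefficients alone. *)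
Fixpoint nccat (p r : seq (F * seq nat)) :=
  if p is t :: p' then t :: nccat p' r else r.

Fixpoint wcat (v w : seq nat) := if v is i :: v' then i :: wcat v' w else w.

Fixpoint ncmap (c : F) (v : seq nat) (p : seq (F * seq nat)) :=
  if p is (d, w) :: p' then (c * d, wcat v w) :: ncmap c v p' else [::].

Fixpoint ncmul (p r : seq (F * seq nat)) :=
  if p is (c, v) :: p' then nccat (ncmap c v r) (ncmul p' r) else [::].

Fixpoint ncnorm (e : ncexp) : seq (F * seq nat) :=
  match e with
  | NCvar i => [:: (1, [:: i])]
  | NCone => [:: (1, [::])]
  | NCzero => [::]
  | NCadd a b => nccat (ncnorm a) (ncnorm b)
  | NCopp a => ncmap (-1) [::] (ncnorm a)
  | NCmul a b => ncmul (ncnorm a) (ncnorm b)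
  | NCscale c a => ncmap c [::] (ncnorm a)
  end.

Definition weval (env : seq A) (w : seq nat) : A := \prod_(i <- w) nth 0 env i.

Definition ncsum (env : seq A) (p : seq (F * seq nat)) : A :=
  \sum_(t <- p) t.1 *: weval env t.2.

Lemma nccatE p r : nccat p r = p ++ r.
Proof. by elim: p => //= t p ->. Qed.

Lemma wcatE v w : wcat v w = v ++ w.
Proof. by elim: v => //= t p ->. Qed.

Lemma ncsum_map env c v p :
  ncsum env (ncmap c v p) = c *: (weval env v * ncsum env p).
Proof.
rewrite /ncsum mulr_sumr scaler_sumr.
elim: p => [|[d w] p IH] /=; rewrite ?big_nil // !big_cons IH /= wcatE.
congr (_ + _); rewrite /weval big_cat /=.
by rewrite -scalerA -scalerAr.
Qed.

Lemma ncsum_mul env p r : ncsum env (ncmul p r) = ncsum env p * ncsum env r.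
Proof.
elim: p => [|[c v] p IH] /=; first by rewrite /ncsum big_nil mul0r.
rewrite nccatE /ncsum big_cat big_cons /= mulrDl -/(ncsum env _).
by rewrite ncsum_map -/(ncsum env (ncmul p r)) IH -scalerAl.
Qed.

Lemma ncnormP env e : nceval env e = ncsum env (ncnorm e).
Proof.
elim: e => /=.
- by move=> i; rewrite /ncsum big_seq1 /= scale1r /weval big_seq1.
- by rewrite /ncsum big_seq1 /= scale1r /weval big_nil.
- by rewrite /ncsum big_nil.
- by move=> a -> b ->; rewrite nccatE /ncsum big_cat.
- by move=> a ->; rewrite ncsum_map scaleN1r /weval big_nil mul1r.
- by move=> a -> b ->; rewrite ncsum_mul.
- by move=> c a ->; rewrite ncsum_map /weval big_nil mul1r.
Qed.

Fixpoint neq_word (v w : seq nat) : bool :=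
  match v, w with
  | [::], [::] => true
  | i :: v', j :: w' => if eqn i j then neq_word v' w' else false
  | _, _ => false
  end.

Lemma neq_wordE v w : neq_word v w = (v == w).
Proof.
elim: v w => [|i v IH] [|j w] //=; rewrite IH -[eqn i j]/(i == j) eqseq_cons.
by case: eqP.
Qed.

Fixpoint word_coef (w : seq nat) (p : seq (F * seq nat)) : F :=
  if p is (c, v) :: p' then
    if neq_word v w then c + word_coef w p' else word_coef w p'
  else 0.

Fixpoint drop_word (w : seq nat) (p : seq (F * seq nat)) :=
  if p is (c, v) :: p' then
    if neq_word v w then drop_word w p' else (c, v) :: drop_word w p'
  else [::].

Fixpoint all_coefs0 (fuel : nat) (p : seq (F * seq nat)) : Prop :=
  match p with
  | [::] => True
  | (c, w) :: p' => if fuel is k.+1 then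
      c + word_coef w p' = 0 /\ all_coefs0 k (drop_word w p')
    else False
  end.

Lemma ncsum_drop env w p :
  ncsum env p = word_coef w p *: weval env w + ncsum env (drop_word w p).
Proof.
rewrite /ncsum; elim: p => [|[c v] p IH] /=.
  by rewrite !big_nil scale0r add0r.
rewrite big_cons IH neq_wordE; case: eqP => [->|_] /=.
  by rewrite addrA -scalerDl.
by rewrite big_cons addrCA.
Qed.

Lemma all_coefs0P env fuel p : all_coefs0 fuel p -> ncsum env p = 0.
Proof.
elim: fuel p => [|k IH] [|[c w] p] //=; try by rewrite /ncsum big_nil.
move=> [c0 /IH p0]; rewrite /ncsum big_cons /= -/(ncsum env p).
by rewrite (ncsum_drop env w p) p0 addr0 -scalerDl c0 scale0r.
Qed.

(** Identities between noncommutative polynomials are reduced to identities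
    between scalars, one for each word in the atoms. *)
Lemma nc_eq env a b :
  all_coefs0 (size (ncnorm (NCadd a (NCopp b)))) (ncnorm (NCadd a (NCopp b))) ->
  nceval env a = nceval env b.
Proof.
move=> /(all_coefs0P env); rewrite -ncnormP => /eqP /=.
by rewrite subr_eq0 => /eqP.
Qed.

End NonCommutativePolynomials.

Ltac nc_mem x env :=
  lazymatch env with
  | nil => constr:(false)
  | cons ?y ?e => lazymatch x with y => constr:(true) | _ => nc_mem x e end
  end.
Ltac nc_index x env :=
  lazymatch env with
  | cons ?y ?e =>
    lazymatch x with
    | y => constr:(0%N)
    | _ => let i := nc_index x e in constr:(S i)
    end
  end.
Ltac nc_atoms x env :=
  lazymatch x with
  | @GRing.add _ ?a ?b => let e := nc_atoms a env in nc_atoms b e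
  | @GRing.opp _ ?a => nc_atoms a env
  | @GRing.mul _ ?a ?b => let e := nc_atoms a env in nc_atoms b e
  | @GRing.scale _ _ _ ?a => nc_atoms a env
  | @GRing.one _ => env
  | @GRing.zero _ => env
  | _ => lazymatch nc_mem x env with
         | true => env
         | false => constr:(cons x env)
         end
  end.
Ltac nc_reify F x env :=
  lazymatch x with
  | @GRing.add _ ?a ?b =>
    let a' := nc_reify F a env in let b' := nc_reify F b env in
    constr:(@NCadd F a' b')
  | @GRing.opp _ ?a => let a' := nc_reify F a env in constr:(@NCopp F a')
  | @GRing.mul _ ?a ?b =>
    let a' := nc_reify F a env in let b' := nc_reify F b env in
    constr:(@NCmul F a' b')
  | @GRing.scale _ _ ?c ?a =>
    let a' := nc_reify F a env in constr:(@NCscale F c a')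
  | @GRing.one _ => constr:(@NCone F)
  | @GRing.zero _ => constr:(@NCzero F)
  | _ => let i := nc_index x env in constr:(@NCvar F i)
  end.
(** Leaves one equation between scalars for each word that occurs, to be closed
    by commutative means. *)
Ltac nc F A :=
  lazymatch goal with
  | |- ?x = ?y =>
    let e0 := nc_atoms x (@nil (GRing.Algebra.sort A)) in
    let env := nc_atoms y e0 in
    let x' := nc_reify F x env in
    let y' := nc_reify F y env in
    refine (@nc_eq F A env x' y' _);
    cbv [ncnorm nccat wcat ncmap ncmul size all_coefs0 word_coef drop_word
         neq_word eqn];
    repeat split
  end.

(** * Root vectors and ordered monomials *)
Section RootVectors.
Variables (F : fieldType) (A : algType F) (q : F).
Hypotheses (q0 : q != 0) (q2 : q * q + 1 != 0)
  (q4 : 1 + q ^+ 2 + q ^+ 4 != 0).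

Definition qcom (c : F) (x y : A) : A := x * y - c *: (y * x).
Definition serre (x y : A) : A :=
  x * x * y - (q + q^-1) *: (x * y * x) + y * x * x.

Ltac ncf := nc F A; (field; rewrite ?q0 ?q2 //).

Lemma qcom_qcom (x y : A) : qcom q^-1 x (qcom q x y) = serre x y.
Proof. by rewrite /qcom /serre; nc F A; field; rewrite ?q0 //. Qed.

(** As [a] commutes with [y], the Serre relation passes through [a]. *)
Lemma serre_qcom (a x y : A) (c : F) :
  qcom 1 y a = 0 -> serre y x = 0 -> serre y (qcom c a x) = 0.
Proof.
move=> ya0 s0; set e := qcom 1 y a in ya0; set s := serre y x in s0.
have -> : serre y (qcom c a x) = a * s - c *: (s * a)
    + (y * e * x + e * y * x - (q + q^-1) *: (e * x * y))
    - c *: ((q + q^-1) *: (y * x * e) - x * e * y - x * y * e).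
  by rewrite /e /s /serre /qcom; ncf.
by rewrite ya0 s0 !(mulr0, mul0r, scaler0, subr0, addr0).
Qed.

Lemma qcom_of_serre (x y : A) :
  serre y x = 0 -> qcom q (qcom q^-1 x y) y = 0.
Proof.
by move=> s0; rewrite -[RHS]s0 /serre /qcom; ncf.
Qed.

(** For a chain [x - y - z] of simple root vectors this is the relation by which
    [y] commutes with the root vector of the sum of the three roots.  It is a
    combination of the two Serre relations in [y] only after division by
    [q + q^-1]. *)
Lemma middle_commutes (x y z : A) :
  qcom 1 x z = 0 -> serre y x = 0 -> serre y z = 0 ->
  qcom 1 y (qcom q^-1 (qcom q^-1 x y) z) = 0.
Proof.
move=> xz0 sx0 sz0; set e := qcom 1 x z in xz0.
set sx := serre y x in sx0; set sz := serre y z in sz0.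
(* The last bracket collects the errors made by exchanging [x] and [z]. *)
have -> : qcom 1 y (qcom q^-1 (qcom q^-1 x y) z) =
   (q + q^-1)^-1 *: (x * sz - sx * z)
   + (q ^+ 2 * (q + q^-1))^-1 *: (z * sx - sz * x)
   + (q^-1 *: (y * e * y) - (q ^+ 2 * (q + q^-1))^-1 *: (y * y * e)
      - (q + q^-1)^-1 *: (e * y * y)).
  by rewrite /e /sx /sz /serre /qcom; ncf.
by rewrite xz0 sx0 sz0 !(mulr0, mul0r, scaler0, subr0, addr0).
Qed.

Variable r : nat -> A.
Hypotheses (r_far : forall i j, (i.+1 < j)%N -> qcom 1 (r i) (r j) = 0)
  (r_serre_dn : forall i, serre (r i.+1) (r i) = 0)
  (r_serre_up : forall i, serre (r i.+1) (r i.+2) = 0)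
  (r_serre_short : qcom 1 (r 0) (serre (r 0) (r 1)) = 0).

Fixpoint root_vec (k : nat) : A :=
  if k is k'.+1 then qcom q^-1 (root_vec k') (r k) else r 0.

Lemma rootS k : root_vec k.+1 = qcom q^-1 (root_vec k) (r k.+1).
Proof. by []. Qed.

Lemma qcom1P (x y : A) : qcom 1 x y = 0 <-> x * y = y * x.
Proof.
by rewrite /qcom scale1r; split=> [/eqP|->]; rewrite ?subrr // subr_eq0 => /eqP.
Qed.

Lemma qcom1_sym (x y : A) : qcom 1 x y = 0 -> qcom 1 y x = 0.
Proof. by move/qcom1P => h; apply/qcom1P. Qed.

Lemma commute_qcom (c : F) (x y z : A) :
  qcom 1 x y = 0 -> qcom 1 x z = 0 -> qcom 1 x (qcom c y z) = 0.
Proof.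
move=> xy xz; set e := qcom 1 x y in xy; set f := qcom 1 x z in xz.
have -> : qcom 1 x (qcom c y z) = e * z + y * f - c *: (f * y + z * e).
  by rewrite /e /f /qcom; ncf.
by rewrite xy xz !(mulr0, mul0r, scaler0, subr0, addr0).
Qed.

Lemma r_root_far i j : (i.+1 < j)%N -> qcom 1 (r j) (root_vec i) = 0.
Proof.
elim: i => [|i IH] ij /=; first exact/qcom1_sym/r_far.
by apply: commute_qcom; [apply: IH; lia | apply/qcom1_sym/r_far].
Qed.

Lemma serre_root k : serre (r k.+1) (root_vec k) = 0.
Proof.
case: k => [|k] /=; first exact: r_serre_dn.
by apply: serre_qcom (r_serre_dn k.+1); apply: r_root_far.
Qed.

Lemma root_r_same k : qcom q (root_vec k.+1) (r k.+1) = 0.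
Proof. exact/qcom_of_serre/serre_root. Qed.

Lemma r_root_below i j : (j.+1 < i)%N -> qcom 1 (r j.+1) (root_vec i) = 0.
Proof.
elim: i => [|i IH] // ji; rewrite [root_vec _]/=.
move: ji; rewrite ltnS leq_eqVlt => /orP[/eqP<-|ji].
  rewrite [root_vec _]/=; apply: middle_commutes (serre_root _) (r_serre_up _).
  by apply/qcom1_sym/r_root_far.
by apply: commute_qcom; [exact: IH | apply: r_far; lia].
Qed.

(** A root vector for [eps_i + eps_j], [i < j]. *)
Definition root_qcom i j : A := qcom q (root_vec i) (root_vec j).
Notation g := root_qcom.

Lemma qcomE c (x y : A) : qcom c x y = 0 -> x * y = c *: (y * x).
Proof. by move=> /eqP; rewrite subr_eq0 => /eqP. Qed.

Lemma root_r_dn k : root_vec k * r k.+1 = q^-1 *: (r k.+1 * root_vec k) + root_vec k.+1.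
Proof. by rewrite /= /qcom addrC subrK. Qed.

(** [q^((eps_i, alpha))] for the simple root [alpha] of [r k.+1]. *)
Definition root_r_coef i k : F := if k == i then q^-1 else if k.+1 == i then q else 1.

(** Adding the simple root of [r k.+1] to [eps_i] gives a root only if [k = i],
    and then it gives [eps_(k+1)]; hence there is at most one correction
    term. *)
Lemma root_r i k : root_vec i * r k.+1 =
  root_r_coef i k *: (r k.+1 * root_vec i) + (if k == i then root_vec k.+1 else 0).
Proof.
rewrite /root_r_coef; case: (eqVneq k i) => [<-|ki]; first exact: root_r_dn.
case: (eqVneq k.+1 i) => [<-|ki']; first by rewrite addr0; exact/qcomE/root_r_same.
rewrite addr0 scale1r; apply/esym/qcom1P.
have [|] := ltnP k.+1 i; first exact: r_root_below.
by move=> h; apply: r_root_far; lia.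
Qed.

(** The elements [g i j], [i < j], are stable under q-commutation with the
    [r k.+1], as [eps_i + eps_j] plus a simple root other than the short one
    is again of this shape, or no root at all. *)
Lemma pairing_r i j k : (i < j)%N -> exists a : F,
  g i j * r k.+1 = a *: (r k.+1 * g i j)
    + (if k == i then if j == k.+1 then 0 else g k.+1 j
       else if k == j then g i k.+1 else 0).
Proof.
move=> ij; exists (root_r_coef i k * root_r_coef j k).
have := root_r i k; have := root_r j k.
set a := root_r_coef i k; set b := root_r_coef j k.
set x' := (X in _ + X); set y' := (X in _ -> _ = _ + X -> _) => Hj Hi.
have -> : g i j * r k.+1 = (a * b) *: (r k.+1 * g i j)
   + (b *: (y' * root_vec j) + root_vec i * x' - q *: (a *: (x' * root_vec i) + root_vec j * y')).
  rewrite /g /qcom mulrBl -scalerAl -!mulrA Hi Hj !mulrDr -!scalerAr !mulrA Hi Hj.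
  by ncf.
congr (_ + _); rewrite /x' /y' /a /b /root_r_coef.
have [->|ki] := eqVneq k i.
  rewrite (ltn_eqF ij) eq_sym; have [->|ji] := eqVneq i.+1 j.
    by ncf.
  by rewrite /g /qcom; ncf.
have [kj|kj] := eqVneq k j; last by ncf.
by rewrite (_ : k.+1 == i = false) ?/g /qcom; [ncf | lia].
Qed.

Variable V : lmodType A.
Implicit Type v : V.

(** On the quotient of the parabolic Verma module all these root vectors act by
    zero.  The vectors with this property are shown to contain the generator
    and to be stable under all lowering operators; then the root vectors
    [root_vec] q-commute on the whole module. *)
Definition killed v := forall i j, (i < j)%N -> g i j *: v = 0.

Lemma scaler_algA (a : F) (x : A) v : (a *: x) *: v = a%:A *: (x *: v).
Proof. by rewrite scalerA mulr_algl. Qed.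

Lemma scale_exchange (a : F) (x y z : A) v :
  x * y = a *: (y * x) + z ->
  x *: (y *: v) = a%:A *: (y *: (x *: v)) + z *: v.
Proof. by move=> E; rewrite scalerA E scalerDl (scalerA y) (scalerA a%:A) mulr_algl. Qed.

Lemma killed_r v k : killed v -> killed (r k.+1 *: v).
Proof.
move=> Zv i j ij; have [a /scale_exchange->] := pairing_r k ij.
rewrite Zv // !scaler0 add0r.
case: eqVneq => [ki|_]; last first.
  by case: eqVneq => [kj|_]; rewrite ?scale0r ?Zv // kj ltnS ltnW.
case: eqVneq => [_|ne]; rewrite ?scale0r // Zv //.
by rewrite ltn_neqAle eq_sym ne ki.
Qed.

Lemma r0_comm k v : r k.+2 *: (r 0 *: v) = r 0 *: (r k.+2 *: v).
Proof. by rewrite !scalerA; congr (_ *: _); apply/esym/qcom1P/r_far. Qed.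

Lemma delta_root0 : g 0 1 = serre (r 0) (r 1).
Proof. by rewrite /g /qcom /= /serre /qcom; ncf. Qed.

Lemma delta_r0 v : g 0 1 *: (r 0 *: v) = r 0 *: (g 0 1 *: v).
Proof.
rewrite !scalerA; congr (_ *: _); apply/esym/qcom1P.
by rewrite delta_root0.
Qed.

(** Two ways of obtaining the vector of a higher root from that of a lower one;
    they drive the inductions on [i] and [j] below. *)
Lemma pairing_r_dn i j v : (i < j)%N -> exists a : F,
  g i j.+1 *: v = g i j *: (r j.+1 *: v) - a%:A *: (r j.+1 *: (g i j *: v)).
Proof.
move=> ij; have [a] := pairing_r j ij; rewrite eqxx gtn_eqF // => E.
by exists a; rewrite (scale_exchange v E) addrAC subrr add0r.
Qed.

Lemma pairing_r_up i j v : (i.+1 < j)%N -> exists a : F,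
  g i.+1 j *: v = g i j *: (r i.+1 *: v) - a%:A *: (r i.+1 *: (g i j *: v)).
Proof.
move=> ij; have [a] := pairing_r i (ltnW ij); rewrite eqxx gtn_eqF // => E.
by exists a; rewrite (scale_exchange v E) addrAC subrr add0r.
Qed.

Lemma pairing_r0_0 j v : killed v -> g 0 j.+1 *: (r 0 *: v) = 0.
Proof.
elim: j v => [|j IH] v Zv; first by rewrite delta_r0 Zv // scaler0.
have [//|a ->] := @pairing_r_dn 0 j.+1 (r 0 *: v).
by rewrite r0_comm !IH ?scaler0 ?subrr //; apply: killed_r.
Qed.

Lemma scaler_comm_alg (c : F) (x : A) v : x *: (c%:A *: v) = c%:A *: (x *: v).
Proof. by rewrite !scalerA mulr_algr mulr_algl. Qed.

Lemma scale_algM (a : F) (x y : A) v :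
  (a *: (x * y)) *: v = a%:A *: (x *: (y *: v)).
Proof. by rewrite scaler_algA scalerA. Qed.

Lemma qcom_scale (c : F) (x y : A) v :
  qcom c x y *: v = x *: (y *: v) - c%:A *: (y *: (x *: v)).
Proof. by rewrite scalerBl scaler_algA !scalerA. Qed.

Lemma scale_alg_combine (c d : F) v : c%:A *: (d%:A *: v) = (c * d)%:A *: v.
Proof. by rewrite scalerA mulr_algl scalerA. Qed.

Lemma scale_alg_eq0 (c : F) v : c != 0 -> c%:A *: v = 0 -> v = 0.
Proof.
move=> c0 /(congr1 (fun u => (c^-1)%:A *: u)).
by rewrite scale_alg_combine mulVf // scaler0 !scale1r.
Qed.

(** The one case of [killed_r0] that induction does not reach.  With
    [s = g 1 2 r_0 v] and [w = g 0 2 F_1 v], the relations give [w = - q^-1 s]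
    and [g 0 1 F_2 v = - q^-1 w].  Moving [g 0 1] across [F_2] by definition of
    [g], without any relation, expresses [g 0 1 F_2 v] through [s] and [w] once
    more, and the three equations leave [(q^-2 + 1 + q^2) s = 0]. *)
Lemma pairing_r0_12 v : killed v -> g 1 2 *: (r 0 *: v) = 0.
Proof.
move=> Zv; set s := g 1 2 *: (r 0 *: v); set w := g 0 2 *: (root_vec 1 *: v).
have Zr0 j : g 0 j.+1 *: (r 0 *: v) = 0 by exact: pairing_r0_0.
have sE : s = g 0 2 *: (r 1 *: (r 0 *: v)).
  by have [//|a] := @pairing_r_up 0 2 (r 0 *: v); rewrite Zr0 !scaler0 subr0.
have wE : w = - (q^-1%:A *: s).
  rewrite /w (rootS 0) qcom_scale scalerBr (pairing_r0_0 1 (killed_r 0 Zv)).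
  by rewrite scaler_comm_alg -sE sub0r.
have D1 (u : V) : g 0 1 *: u = 0 -> g 0 1 *: (root_vec 1 *: u) = 0.
  move=> u0; have [//|a E] := @pairing_r 0 1 0.
  rewrite (rootS 0) qcom_scale scalerBr scaler_comm_alg delta_r0.
  rewrite /= in E.
  by rewrite !(scale_exchange _ E) !(delta_r0, u0, scaler0, scale0r, addr0, subr0).
(* Write [root_vec 2] as a q-commutator; only the term where [r 2] is
   applied last contributes, through [pairing_r] at [i = 0], [j = 1]. *)
have Dh : g 0 1 *: (root_vec 2 *: v) = - (q^-1%:A *: w).
  rewrite (rootS 1) qcom_scale scalerBr scaler_comm_alg.
  rewrite D1 ?sub0r; last exact: (killed_r 1 Zv).
  have [//|a E] := @pairing_r 0 1 1.
  by rewrite (scale_exchange _ E) D1 ?scaler0 ?add0r //; exact: Zv.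
(* A tautology in the free algebra on [F_0], [F_1], [F_2]. *)
have /(congr1 (fun x => x *: v)) : g 0 1 * root_vec 2 =
    q ^+ 2 *: (root_vec 2 * g 0 1) + r 0 * g 1 2 - q *: (root_vec 1 * g 0 2)
    + q *: (g 0 2 * root_vec 1) - q ^+ 2 *: (g 1 2 * r 0).
  by rewrite /g [root_vec 0]/=; move: (r 0) (root_vec 1) (root_vec 2) => x y z; rewrite /qcom; ncf.
rewrite !(scalerDl, scaleNr) !scale_algM -!(scalerA (r 0)) -!(scalerA (g 0 1)).
rewrite Dh !Zv // -/s -/w !scaler0.
rewrite !(add0r, oppr0) wE !scalerN opprK !scale_alg_combine => E.
(* By [wE] and [Dh] the identity reads [q^-2 s = - s - q^2 s]. *)
apply: (@scale_alg_eq0 (q^-1 / q + q / q + q ^+ 2)); last first.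
  by rewrite !scalerDl E -opprD -addrA addNr.
have -> : q^-1 / q + q / q + q ^+ 2 = q ^- 2 * (1 + q ^+ 2 + q ^+ 4).
  by field; rewrite q0.
by rewrite mulf_neq0 ?invr_eq0 ?expf_neq0.
Qed.

(** Induction on the two indices: [g i j] is a q-commutator of a smaller one
    with some [r k.+2], and these commute with [r 0].  The base cases are
    [delta_r0], which is the higher Serre relation for the short root, and
    [pairing_r0_12]. *)
Lemma killed_r0 v : killed v -> killed (r 0 *: v).
Proof.
move=> Zv i j; elim: i j v Zv => [|i IHi] [|j] // v Zv ij.
  exact: pairing_r0_0.
have [//|a E] := @pairing_r_up i j.+1 (r 0 *: v).
case: i => [|i] in ij IHi E *; last first.
  rewrite E r0_comm !IHi ?scaler0 ?subrr //; try exact: killed_r; lia.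
elim: j v Zv ij {IHi E a} => [|j IHj] v Zv ij //.
case: j => [|j] in ij IHj *; first exact: pairing_r0_12.
have [//|a ->] := @pairing_r_dn 1 j.+2 (r 0 *: v).
by rewrite r0_comm !IHj ?scaler0 ?subrr //; exact: killed_r.
Qed.

(** The span over the scalars of the words in the [X i] applied to [vac]. *)
Inductive reach (X : nat -> A) (vac : V) : V -> Prop :=
| reach_vac : reach X vac vac
| reach_add u v : reach X vac u -> reach X vac v -> reach X vac (u + v)
| reach_scale (c : F) v : reach X vac v -> reach X vac (c%:A *: v)
| reach_op i v : reach X vac v -> reach X vac (X i *: v).

Lemma reach0 X vac : reach X vac 0.
Proof. by rewrite -(scale0r vac) -[0 : A](scale0r 1); do 2 constructor. Qed.

Lemma reach_sub X vac u v : reach X vac u -> reach X vac v -> reach X vac (u - v).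
Proof.
move=> Xu Xv; apply: reach_add => //; rewrite -scaleN1r -[-1 : A]scaleN1r.
exact: reach_scale.
Qed.

Lemma killed_root k v : killed v -> killed (root_vec k *: v).
Proof.
elim: k v => [|k IH] v Zv; first exact: killed_r0.
rewrite rootS qcom_scale => i j ij.
rewrite scalerBr scaler_comm_alg (IH _ (killed_r _ Zv)) //.
by rewrite (killed_r _ (IH _ Zv)) // scaler0 subrr.
Qed.

Lemma root_exchange i j v : killed v -> (i < j)%N ->
  root_vec j *: (root_vec i *: v) = q^-1%:A *: (root_vec i *: (root_vec j *: v)).
Proof.
move=> Zv ij; have /eqP := Zv i j ij; rewrite /g qcom_scale subr_eq0 => /eqP->.
by rewrite scale_alg_combine mulVf // !scale1r.
Qed.

Lemma killed_exp i k v : killed v -> killed (root_vec i ^+ k *: v).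
Proof.
move=> Zv; elim: k => [|k IH]; first by rewrite expr0 scale1r.
by rewrite exprS -(@scalerA A V); apply: killed_root.
Qed.

Lemma root_exchange_exp i j k v : killed v -> (i < j)%N ->
  root_vec j *: (root_vec i ^+ k *: v) =
  (q^-1 ^+ k)%:A *: (root_vec i ^+ k *: (root_vec j *: v)).
Proof.
move=> Zv ij; elim: k => [|k IH]; first by rewrite !expr0 !scale1r.
rewrite !exprS -!(scalerA (root_vec i)) root_exchange //; last exact: killed_exp.
by rewrite IH scaler_comm_alg scale_alg_combine.
Qed.

Lemma root_exchange_prod m b j v : killed v -> (b <= j)%N -> exists c : F,
  root_vec j *: ((\prod_(0 <= i < b) root_vec i ^+ m i) *: v) =
  c%:A *: ((\prod_(0 <= i < b) root_vec i ^+ m i) *: (root_vec j *: v)).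
Proof.
elim: b v => [|b IH] v Zv bj; first by exists 1; rewrite !big_geq // !scale1r.
have [c E] := IH (root_vec b ^+ m b *: v) (killed_exp _ _ Zv) (ltnW bj).
exists (c * q^-1 ^+ m b); rewrite !big_nat_recr //= -!(@scalerA A V) E.
by rewrite (root_exchange_exp _ Zv bj) scaler_comm_alg scale_alg_combine.
Qed.

Lemma root_prod m n j v : killed v -> (j < n)%N -> exists c : F,
  root_vec j *: ((\prod_(0 <= i < n) root_vec i ^+ m i) *: v) =
  c%:A *: ((\prod_(0 <= i < n) root_vec i ^+ (m i + (i == j))%N) *: v).
Proof.
move=> Zv jn.
have Zp : killed ((\prod_(j.+1 <= i < n) root_vec i ^+ m i) *: v).
  elim/big_rec: _ => [|i x _ Zx]; first by rewrite scale1r.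
  by rewrite -(@scalerA A V); exact: killed_exp.
have [c E] := root_exchange_prod m (killed_exp j (m j) Zp) (leqnn j).
have split (f : nat -> A) : \prod_(0 <= i < n) f i =
    (\prod_(0 <= i < j) f i) * (f j * \prod_(j.+1 <= i < n) f i).
  by rewrite (@big_cat_nat _ _ _ j) ?(ltnW jn) //= (big_ltn jn).
exists c; rewrite !split eqxx addn1 -!(@scalerA A V) E exprS -!(@scalerA A V).
congr (_ *: (_ *: (_ *: (_ *: (_ *: _))))).
  by apply: eq_big_nat => i /andP[_ ij]; rewrite (ltn_eqF ij) addn0.
by apply: eq_big_nat => i /andP[ij _]; rewrite (gtn_eqF ij) addn0.
Qed.

Variable (vac : V).
Hypotheses (r_vac : forall k, r k.+1 *: vac = 0)
  (short_vac : serre (r 0) (r 1) *: vac = 0).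

(** All [g i j] are obtained from [g 0 1], the root vector of [delta], by
    q-commutation with simple root vectors that kill [vac]. *)
Lemma killed_vac : killed vac.
Proof.
have Z0 j : g 0 j.+1 *: vac = 0.
  elim: j => [|j IH]; first by rewrite delta_root0.
  have [//|a ->] := @pairing_r_dn 0 j.+1 vac.
  by rewrite r_vac IH !scaler0 subrr.
elim=> [|i IH] [|j] // ij.
have [//|a ->] := @pairing_r_up i j.+1 vac.
by rewrite r_vac IH ?scaler0 ?subrr // ltnW.
Qed.

(** [r k.+1] moves to the right through any word in root vectors, changing it
    into other such words, until it kills [vac]; the order of the letters does
    not matter for this. *)
Lemma reach_root_r k v : reach root_vec vac v -> reach root_vec vac (r k *: v).
Proof.
case: k => [|k]; first exact: (@reach_op root_vec _ 0).
elim=> {v} [|u v _ IHu _ IHv|c v _ IH|i v Rv IH].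
- by rewrite r_vac; exact: reach0.
- by rewrite scalerDr; apply: reach_add.
- by rewrite scaler_comm_alg; apply: reach_scale.
have a0 : root_r_coef i k != 0.
  by rewrite /root_r_coef; do 2?case: ifP => _; rewrite ?invr_eq0 ?oner_eq0.
rewrite -[_ *: _]scale1r -[1 : A]scale1r -(mulVf a0) -scale_alg_combine.
apply: reach_scale; have /eqP := scale_exchange v (root_r i k).
rewrite -subr_eq => /eqP <-; apply: reach_sub.
  exact: reach_op.
by case: eqP => _; rewrite ?scale0r; [exact: reach_op | exact: reach0].
Qed.

Lemma reach_r_root v : reach r vac v -> reach root_vec vac v.
Proof.
elim=> [|u w _ Hu _ Hw|c w _ Hw|i w _ Hw]; first exact: reach_vac.
- exact: reach_add.
- exact: reach_scale.
- exact: reach_root_r.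
Qed.

Variable n : nat.
Hypothesis r_out : forall k, (n <= k)%N -> r k = 0.

Lemma root_out k : (n <= k)%N -> root_vec k = 0.
Proof.
by case: k => [|k] nk /=; rewrite /qcom r_out // mulr0 mul0r scaler0 subr0.
Qed.

Definition root_monomial (m : {ffun 'I_n -> nat}) : A :=
  \prod_(i < n) root_vec i ^+ m i.

(** A root vector is inserted at its place in an ordered monomial, as by
    [killed_vac] the root vectors q-commute on the vectors involved. *)
Lemma reach_root_monomials v : reach root_vec vac v ->
  exists l : seq (F * {ffun 'I_n -> nat}),
    v = \sum_(p <- l) p.1%:A *: (root_monomial p.2 *: vac).
Proof.
elim=> {v} [|u v _ [l1 ->] _ [l2 ->]|c v _ [l ->]|j v _ [l ->]].
- exists [:: (1, [ffun=> 0%N])]; rewrite big_seq1 /root_monomial big1 ?scale1r ?scale1r //.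
  by move=> i _; rewrite ffunE expr0.
- by exists (l1 ++ l2); rewrite big_cat.
- exists [seq (c * p.1, p.2) | p <- l]; rewrite big_map scaler_sumr.
  by apply: eq_bigr => p _; rewrite scale_alg_combine.
have [jn|jn] := leqP n j.
  by exists [::]; rewrite root_out // scale0r big_nil.
pose up (m : {ffun 'I_n -> nat}) : {ffun 'I_n -> nat} :=
  [ffun i => (m i + (i == j :> nat))%N].
have up_monomial m : exists c : F,
    root_vec j *: (root_monomial m *: vac) = c%:A *: (root_monomial (up m) *: vac).
  pose m' k := if insub k is Some i then m i else 0%N.
  have mE (x : 'I_n) : m' x = m x by rewrite /m' valK.
  have [c E] := root_prod m' killed_vac jn; exists c.
  rewrite !big_mkord in E; rewrite /root_monomial.
  under eq_bigr do rewrite -mE; rewrite E; congr (_ *: (_ *: _)).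
  by apply: eq_bigr => i _; rewrite ffunE mE.
rewrite scaler_sumr; elim: l => [|[c m] l [l' E]].
  by exists [::]; rewrite !big_nil.
have [d Ed] := up_monomial m; exists ((c * d, up m) :: l').
by rewrite !big_cons /= E scaler_comm_alg Ed scale_alg_combine.
Qed.

End RootVectors.

(** * The oscillator representation *)
Section Oscillator.
Variables (F : fieldType) (q t : F).
Hypotheses (q0 : q != 0) (q21 : q ^+ 2 - 1 != 0) (tq : t ^+ 2 = - q^-1).

(** Occupation numbers of the oscillators.  All integer sequences are allowed,
    not only the nonnegative ones with finite support: then every shift is
    invertible, and each relation becomes an identity between the coefficient
    functions, valid everywhere and without boundary cases.  The coefficients
    vanish where a step would leave the nonnegative range. *)
Definition lattice := nat -> int.
Definition unit_vec (k : nat) : lattice := fun j => (j == k)%:R.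
Definition root_step (k : nat) : lattice :=
  if k is k'.+1 then unit_vec k - unit_vec k' else unit_vec 0.
Definition qnum (z : int) : F := (q ^ z - q ^ (- z)) / (q - q^-1).
(** The normalization of the short ladder operators.  As [t^-1 = - q t], the
    commutator [kappa ([m+1]_q - [m]_q)] equals
    [t (q^(-m) + q^(m+1)) / (q - q^-1)], that is, [[h]_q] on the weight
    [t q^(-m)]. *)
Definition kappa : F := t / (1 - q^-1).
Definition lower_coef k (m : lattice) : F :=
  if k is _.+1 then qnum (m k + 1) else kappa * qnum (m 0%N + 1).
Definition lift_coef k (m : lattice) : F :=
  if k is k'.+1 then qnum (m k' + 1) else 1.
Definition torus_exponent k (m : lattice) : int := if k is k'.+1 then m k' - m k else - m 0%N.
Definition torus_coef k (m : lattice) : F := (if k is _.+1 then 1 else t) * q ^ torus_exponent k m.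

(** Arbitrary functions: every operator is a shift times a coefficient, so no
    condition on supports has to be carried along. *)
Definition waves := lattice -> F^o.

Definition ladder_coef (b : bool) := if b then lower_coef else lift_coef.
Definition ladder_step (b : bool) k : lattice := if b then root_step k else - root_step k.
(** A step pulls functions back, so it moves delta functions by the opposite of
    [ladder_step]: [ladder true] lowers and [ladder false] raises. *)
Definition ladder (b : bool) k (phi : waves) : waves :=
  fun m => ladder_coef b k m * phi (m + ladder_step b k).
Definition torus (b : bool) k (phi : waves) : waves :=
  fun m => (if b then torus_coef k m else (torus_coef k m)^-1) * phi m.

Lemma t_neq0 : t != 0.
Proof.
apply/eqP => t0; move: tq; rewrite t0 expr0n /= => /esym/eqP.
by rewrite oppr_eq0 invr_eq0 (negPf q0).
Qed.

Lemma qN z : q ^ (- z) = (q ^ z)^-1.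
Proof. by rewrite invr_expz. Qed.

Ltac eqnat :=
  repeat match goal with |- context [ @eq_op _ ?a ?b ] =>
    lazymatch type of a with nat =>
    first [ rewrite (_ : (a == b) = true); [|by apply/eqP; lia]
          | rewrite (_ : (a == b) = false); [|by apply/eqP; lia] ] end
  end.
Ltac lateval :=
  rewrite /ladder /torus /ladder_coef /ladder_step /torus_coef /lower_coef
    /lift_coef /torus_exponent /root_step /unit_vec /qnum ?fctE /=;
  eqnat; rewrite ?mulr1n ?mulr0n /=.
Ltac qsplit := rewrite ?(expfzDr _ _ q0, qN, expr0z, expr1z, oppr0, opprD, opprK).

Lemma torusK b k phi : torus b k (torus (~~ b) k phi) = phi.
Proof.
have k0 m : torus_coef k m != 0.
  by rewrite /torus_coef mulf_neq0 ?expfz_neq0 //; case: k; rewrite ?t_neq0 ?oner_eq0.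
apply/funext => m; rewrite /torus mulrA.
by case: b; rewrite /= ?mulfV ?mulVf ?mul1r.
Qed.

Lemma torusC b c i j phi : torus b i (torus c j phi) = torus c j (torus b i phi).
Proof. by apply/funext => m; rewrite /torus mulrCA. Qed.

Lemma ladder_far b c i j phi : (i.+1 < j)%N ->
  ladder b i (ladder c j phi) = ladder c j (ladder b i phi).
Proof.
move=> ij; apply/funext => m; rewrite /ladder mulrCA !mulrA [m + _ + _]addrAC.
congr (_ * _ * _).
  by case: b; case: c; case: i ij => [|i] ij; case: j ij => [|j] ij //;
    lateval; rewrite ?subr0 ?addr0 ?oppr0 ?addr0.
by case: b; case: c; case: i ij => [|i] ij; case: j ij => [|j] ij //;
    lateval; rewrite ?subr0 ?addr0 ?oppr0 ?addr0.
Qed.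

Lemma q2_neq0 : q * q - 1 != 0. Proof. by rewrite -expr2. Qed.

Lemma q1_neq0 : q - 1 != 0.
Proof.
by apply: contraNneq q21 => /eqP; rewrite subr_eq0 => /eqP->; rewrite expr1n subrr.
Qed.

(** In each of the Serre relations below the three words shift by the same
    vector, so that the value of the function factors out. *)
Definition serre_word (Y Z : waves -> waves) (phi : waves) : waves :=
  fun m => Y (Y (Z phi)) m - (q + q^-1) * Y (Z (Y phi)) m + Z (Y (Y phi)) m.

Ltac qfield :=
  lateval; qsplit;
  repeat match goal with |- context [q ^ ?z] =>
    lazymatch z with (_ + _) => fail | _ =>
    move: (q ^ z) (expfz_neq0 z q0) => ? ? end end;
  field; rewrite ?oner_neq0 ?q0 ?q2_neq0 ?q1_neq0 /=;
  repeat (apply/andP; split); rewrite ?oner_neq0 //.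

Lemma ladder_serre_down b k phi m : serre_word (ladder b k.+1) (ladder b k) phi m = 0.
Proof.
rewrite /serre_word /ladder; set y := ladder_step b k.+1; set z := ladder_step b k.
rewrite (_ : m + y + z + y = m + y + y + z); last by ring.
rewrite (_ : m + z + y + y = m + y + y + z); last by ring.
move: (phi _) => p; rewrite {}/y {}/z.
by case: b; case: k => [|k]; qfield.
Qed.

Lemma ladder_serre_up b k phi m : serre_word (ladder b k.+1) (ladder b k.+2) phi m = 0.
Proof.
rewrite /serre_word /ladder; set y := ladder_step b k.+1; set z := ladder_step b k.+2.
rewrite (_ : m + y + z + y = m + y + y + z); last by ring.
rewrite (_ : m + z + y + y = m + y + y + z); last by ring.
move: (phi _) => p; rewrite {}/y {}/z.
by case: b; qfield.
Qed.

(** Stronger than the relation of the quantum group: it is the vector of the root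
    [delta] itself that acts by zero, not only its commutator with the short
    simple root vector. *)
Lemma ladder_serre_short phi m b : serre_word (ladder b 0) (ladder b 1) phi m = 0.
Proof.
rewrite /serre_word /ladder; set y := ladder_step b 0; set z := ladder_step b 1.
rewrite (_ : m + y + z + y = m + y + y + z); last by ring.
rewrite (_ : m + z + y + y = m + y + y + z); last by ring.
move: (phi _) => p; rewrite {}/y {}/z /kappa.
by case: b; qfield.
Qed.

Definition cartan (b : bool) i j : int := torus_exponent i (ladder_step b j).

Lemma torus_ladder c b i j phi m :
  torus c i (ladder b j (torus (~~ c) i phi)) m =
  q ^ (if c then - cartan b i j else cartan b i j) * ladder b j phi m.
Proof.
rewrite /ladder /torus /cartan; move: (phi _) => p.
have kD u v : torus_coef i (u + v) = torus_coef i u * q ^ torus_exponent i v.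
  rewrite /torus_coef -mulrA -expfzDr //; congr (_ * q ^ _).
  by case: i => [|i] /=; rewrite !fctE; ring.
have k0 : torus_coef i m != 0.
  by rewrite /torus_coef mulf_neq0 ?expfz_neq0 //; case: (i); rewrite ?t_neq0 ?oner_eq0.
by case: c; rewrite /= kD ?qN; field; rewrite k0 ?expfz_neq0.
Qed.

(** Only the case [i = j = 0] uses [t^2 = - q^-1]. *)
Lemma ladder_commutator i j phi m :
  ladder true i (ladder false j phi) m - ladder false j (ladder true i phi) m =
  if i == j then (q - q^-1)^-1 * (torus true i phi m - torus false i phi m) else 0.
Proof.
case: (ltngtP i j) => [ij|ij|<-]; rewrite ?(ltn_eqF ij) ?(gtn_eqF ij) ?eqxx.
- move: ij; rewrite leq_eqVlt => /orP[/eqP<-|ij]; last by rewrite ladder_far ?subrr.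
  rewrite /ladder [m + ladder_step false _ + _]addrAC; move: (phi _) => p.
  by case: i => [|i]; rewrite /kappa; qfield.
- move: ij; rewrite leq_eqVlt => /orP[/eqP<-|ij]; last by rewrite -ladder_far ?subrr.
  rewrite /ladder [m + ladder_step false _ + _]addrAC; move: (phi _) => p.
  by case: j => [|j]; rewrite /kappa; qfield.
rewrite /ladder /torus [m + ladder_step false i + _]addrAC addrK; move: (phi _) => p.
case: i => [|i]; last by qfield.
have tV : t^-1 = - (q * t).
  by apply: (mulfI t_neq0); rewrite mulfV ?t_neq0 // mulrN mulrCA -expr2 tq mulrN opprK mulfV.
lateval; qsplit; move: (q ^ m 0%N) (expfz_neq0 (m 0%N) q0) => a a0.
rewrite invf_div /kappa tV; field.
by rewrite a0 q0 q1_neq0 q2_neq0.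
Qed.

Lemma ladder_linear b k (c : F) (phi psi : waves) :
  ladder b k (c *: phi + psi) = c *: ladder b k phi + ladder b k psi.
Proof. by apply/funext => m; rewrite /ladder mulrDr; congr (_ + _); exact: mulrCA. Qed.

Lemma torus_linear b k (c : F) (phi psi : waves) :
  torus b k (c *: phi + psi) = c *: torus b k phi + torus b k psi.
Proof. by apply/funext => m; rewrite /torus mulrDr; congr (_ + _); exact: mulrCA. Qed.

(** The delta function at [m].  Equality of sequences is not decidable, whence
    the classical test. *)
Definition ket (m : lattice) : waves := fun m' => `[< m' = m >]%:R.

Lemma ket_shift (m m' v : lattice) : ket m (m' + v) = ket (m - v) m'.
Proof.
rewrite /ket; congr (_%:R : F); congr nat_of_bool; apply/asboolP/asboolP.
  by move<-; rewrite addrK.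
by move->; rewrite subrK.
Qed.

Lemma ket_mul (f : lattice -> F) m m' : f m' * ket m m' = f m * ket m m'.
Proof. by rewrite /ket; case: asboolP => [->//|_]; rewrite !mulr0. Qed.

Lemma ladder_ket b k m :
  ladder b k (ket m) = ladder_coef b k (m - ladder_step b k) *: ket (m - ladder_step b k).
Proof.
by apply/funext => m'; rewrite /ladder fctE ket_shift (ket_mul (ladder_coef b k)).
Qed.

Lemma torus_ket b k m :
  torus b k (ket m) = (if b then torus_coef k m else (torus_coef k m)^-1) *: ket m.
Proof.
apply/funext => m'; rewrite /torus fctE; case: b; first by rewrite ket_mul.
by rewrite (ket_mul (fun m => (torus_coef k m)^-1)).
Qed.

Definition eps_step (b : bool) k : lattice := if b then unit_vec k else - unit_vec k.
Definition psum k (m : lattice) : int := \sum_(0 <= j < k) m j.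

Lemma psum_shift k (m v : lattice) :
  (forall j, (j < k)%N -> v j = 0) -> psum k (m + v) = psum k m.
Proof.
move=> v0; rewrite /psum; apply: eq_big_nat => j /andP[_ jk].
by rewrite fctE v0 ?addr0.
Qed.

Fixpoint root_op (b : bool) (k : nat) (phi : waves) : waves :=
  if k is k'.+1 then
    root_op b k' (ladder b k phi) - q^-1 *: ladder b k (root_op b k' phi)
  else ladder b 0 phi.

Fixpoint dual_root_op (k : nat) (phi : waves) : waves :=
  if k is k'.+1 then
    ladder false k (dual_root_op k' phi) - q^-1 *: dual_root_op k' (ladder false k phi)
  else ladder false 0 phi.

Definition root_op_coef (b : bool) k (m : lattice) : F :=
  if b then kappa * qnum (m k + 1) * q ^ psum k m
  else (-1) ^+ k * q ^ (- (psum k m + k%:Z)).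

(** The iterated q-commutator of ladder operators moves one unit into or out of
    mode [k]: the two orders of the product have the same shift, and their
    coefficients combine to a single q-integer. *)
Lemma root_opE b k phi m : root_op b k phi m = root_op_coef b k m * phi (m + eps_step b k).
Proof.
elim: k phi m => [|k IH] phi m /=.
  rewrite /ladder /root_op_coef; case: b => /=; rewrite /psum big_nil.
    by rewrite expr0z mulr1.
  by rewrite expr0 oppr0 expr0z !mul1r.
rewrite -[LHS]/(root_op b k (ladder b k.+1 phi) m - q^-1 * ladder b k.+1 (root_op b k phi) m).
rewrite {1}/ladder !IH {1}/ladder IH.
rewrite (_ : m + eps_step b k + ladder_step b k.+1 = m + eps_step b k.+1); last first.
  by rewrite /ladder_step /root_step /eps_step; case: (b); ring.
rewrite (_ : m + ladder_step b k.+1 + eps_step b k = m + eps_step b k.+1); last first.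
  by rewrite /ladder_step /root_step /eps_step; case: (b); ring.
move: (phi _) => p.
have ps : psum k (m + ladder_step b k.+1) = psum k m.
  apply: psum_shift => j jk; rewrite /ladder_step /root_step /unit_vec.
  by case: (b); rewrite !fctE; eqnat; rewrite ?subrr ?oppr0 ?addr0.
have pS : psum k.+1 m = psum k m + m k by rewrite /psum big_nat_recr.
rewrite /root_op_coef ps pS /eps_step; clear ps IH; case: b.
  by qfield.
by rewrite exprS intS; qfield.
Qed.

Lemma dual_root_opE k phi m : dual_root_op k phi m = q ^ psum k m * phi (m - unit_vec k).
Proof.
elim: k phi m => [|k IH] phi m /=.
  by rewrite /ladder /psum big_nil expr0z.
rewrite -[LHS]/(ladder false k.+1 (dual_root_op k phi) m
  - q^-1 * dual_root_op k (ladder false k.+1 phi) m).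
rewrite {1}/ladder !IH {1}/ladder.
rewrite (_ : m + ladder_step false k.+1 - unit_vec k = m - unit_vec k.+1); last first.
  by rewrite /ladder_step /root_step; ring.
rewrite (_ : m - unit_vec k + ladder_step false k.+1 = m - unit_vec k.+1); last first.
  by rewrite /ladder_step /root_step; ring.
move: (phi _) => p.
have ps : psum k (m + ladder_step false k.+1) = psum k m.
  apply: psum_shift => j jk; rewrite /ladder_step /root_step /unit_vec.
  by rewrite !fctE; eqnat; rewrite ?subrr ?oppr0 ?addr0.
have pS : psum k.+1 m = psum k m + m k by rewrite /psum big_nat_recr.
by rewrite ps pS; qfield.
Qed.
End Oscillator.

(** * Powers of q *)
Section QPow.
Context (R : realType) (hbar : R[i]).
Notation qpow := (qpow hbar).
Notation q := (qpow 1).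

Lemma cexpD (z w : R[i]) : cexp (z + w) = cexp z * cexp w.
Proof.
case: z w => [a b] [c d]; rewrite /cexp /= expRD cosD sinD.
by apply/eqP; rewrite eq_complex /=; apply/andP; split; apply/eqP; ring.
Qed.

Lemma cexp0 : cexp (0 : R[i]) = 1.
Proof. by rewrite /cexp /= expR0 cos0 sin0 mulr1 mulr0. Qed.

Lemma qpowD z w : qpow (z + w) = qpow z * qpow w.
Proof. by rewrite /Defs.qpow mulrDr cexpD. Qed.

Lemma qpow0 : qpow 0 = 1.
Proof. by rewrite /Defs.qpow mulr0 cexp0. Qed.

Lemma qpowN z : qpow (- z) = (qpow z)^-1.
Proof.
have E : qpow z * qpow (- z) = 1 by rewrite -qpowD subrr qpow0.
have z0 : qpow z != 0 by apply: contra_eq_neq E => ->; rewrite mul0r eq_sym oner_eq0.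
by apply: (mulfI z0); rewrite E mulfV.
Qed.

Lemma qpow_neq0 z : qpow z != 0.
Proof.
have E : qpow z * qpow (- z) = 1 by rewrite -qpowD subrr qpow0.
by apply: contra_eq_neq E => ->; rewrite mul0r eq_sym oner_eq0.
Qed.

Lemma qpowMn z (k : nat) : qpow (z *+ k) = qpow z ^+ k.
Proof.
elim: k => [|k IH]; first by rewrite mulr0n qpow0 expr0.
by rewrite mulrS qpowD IH exprS.
Qed.

Lemma qpow_mulz z (k : int) : qpow (z * k%:~R) = qpow z ^ k.
Proof.
case: k => k; first by rewrite -pmulrn mulr_natr qpowMn.
by rewrite NegzE mulrNz -pmulrn mulrN qpowN mulr_natr qpowMn exprnN.
Qed.

Lemma qpow_int (k : int) : qpow k%:~R = q ^ k.
Proof. by rewrite -qpow_mulz mul1r. Qed.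

End QPow.

(** * Pairings of simple roots *)
Section Weights.
Context (R : realType) (n : nat).
Notation weight := 'rV[R[i]]_n.
Implicit Types (i j : 'I_n) (mu : weight).

Lemma wformC (mu nu : weight) : wform mu nu = wform nu mu.
Proof. by apply: eq_bigr => i _; rewrite mulrC. Qed.

Lemma wform_eps mu i : wform mu (eps R i) = mu 0 i.
Proof.
rewrite /wform (bigD1 i) //= big1 ?addr0 => [|j ji]; rewrite /eps mxE ?eqxx ?mulr1 //.
by rewrite (negPf ji) mulr0.
Qed.

Definition coord mu k : R[i] := if insub k is Some i then mu 0 i else 0.

Lemma wform_alpha i mu : wform (alpha R i) mu =
  coord mu i - (if (i : nat) is k.+1 then coord mu k else 0).
Proof.
rewrite /wform; under eq_bigr do rewrite mxE mulrBl.
rewrite sumrB; congr (_ - _).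
  rewrite (bigD1 i) //= big1 ?addr0 => [|j ji]; rewrite ?eqxx ?mul1r ?/coord ?valK //.
  by rewrite (negPf ji) mul0r.
case: i => -[|k] kn /=.
  by rewrite big1 // => j _; rewrite mul0r.
rewrite /coord (insubT (fun k => (k < n)%N) (ltnW kn)) /=.
rewrite (bigD1 (Ordinal (ltnW kn))) //= eqxx mul1r big1 ?addr0 // => j.
by rewrite -val_eqE /= eqSS => /negPf->; rewrite mul0r.
Qed.

Lemma coord_alpha j k : (k < n)%N -> coord (alpha R j) k = (root_step j k)%:~R.
Proof.
move=> kn; rewrite /coord insubT /= mxE -val_eqE /= /root_step /unit_vec.
by case: (val j) => [|l] /=; rewrite ?fctE ?subr0 ?eqSS ?rmorphB /=; case: eqP; try case: eqP.
Qed.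

Lemma wform_alpha_int i j : wform (alpha R i) (alpha R j) = (- torus_exponent i (root_step j))%:~R.
Proof.
rewrite wform_alpha coord_alpha //; case: i => -[|k] kn /=.
  by rewrite subr0 opprK.
by rewrite coord_alpha ?(ltnW kn) // opprB rmorphB.
Qed.

Lemma cartanE i j : - torus_exponent i (root_step j) =
  if i == j :> nat then (if (i : nat) == 0%N then 1 else 2%:Z)
  else if (i == j.+1 :> nat) || (j == i.+1 :> nat) then -1 else 0.
Proof.
rewrite /torus_exponent /root_step /unit_vec.
case: i j => -[|k] kn [] [|l] ln //=; rewrite ?fctE /=;
  do ?case: eqP => //=; try lia.
Qed.
End Weights.

(** * Generators and relations of the quantum group *)
Section Generators.
Context (R : realType) (n : nat) (hbar : R[i]).
Notation C := R[i].
Notation q := (qpow hbar 1).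
Notation U := (Uq n hbar).
Notation rel := (@Uq_rel R n hbar).
Notation pi t := (\pi_(palg rel) t : U).
Notation e b i := (Ue hbar b i).
Notation k b i := (Uk hbar b i).

Lemma pi_add a b : pi (TAdd a b) = pi a + pi b.
Proof. exact/esym/palg_piD. Qed.

Lemma pi_mul a b : pi (TMul a b) = pi a * pi b.
Proof. exact/esym/palg_piM. Qed.

Lemma pi_const (c : C) : pi (TConst c) = c%:A.
Proof. by rewrite -[LHS](palg_mulr1 (palg_const rel c)). Qed.

Lemma pi_tbr (a : C) x y : pi (tbr a x y) = qbr a (pi x) (pi y).
Proof.
rewrite /tbr !(pi_add, pi_mul, pi_const) /qbr mulr_algl scaleNr.
by [].
Qed.

Lemma pi_rel a b : rel a b -> pi a = pi b.
Proof. by move=> ab; apply: palg_eq; exact: aeq_rel. Qed.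

(** Induction on words, multiplying by generators on the left. *)
Lemma Uq_left_ind (P : U -> Prop) :
  P 1 -> (forall x y, P x -> P y -> P (x + y)) ->
  (forall (c : C) x, P x -> P (c *: x)) ->
  (forall b (i : 'I_n) x, P x -> P (e b i * x)) ->
  (forall b (i : 'I_n) x, P x -> P (k b i * x)) -> forall x, P x.
Proof.
move=> P1 PD PZ Pe Pk x.
suff H a y : P y -> P (pi a * y).
  by elim/quotW: x => a; rewrite -[\pi _]mulr1; exact: H.
elim: a y => [[b i|b i]|c|a IHa b IHb|a IHa b IHb] y Py.
- exact: Pe.
- exact: Pk.
- by rewrite pi_const mulr_algl; exact: PZ.
- by rewrite pi_add mulrDl; apply: PD; [exact: IHa|exact: IHb].
- by rewrite pi_mul -mulrA; apply: IHa; exact: IHb.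
Qed.

Lemma UkK b (i : 'I_n) : k b i * k (~~ b) i = 1.
Proof.
by rewrite -pi_mul (pi_rel (Uq_KK hbar b i)) pi_const scale1r.
Qed.

Lemma UkC b c (i j : 'I_n) : k b i * k c j = k c j * k b i.
Proof. by rewrite -!pi_mul (pi_rel (Uq_Kcomm hbar b c i j)). Qed.

(** The relation is imposed for [k true] only; it is transferred to the
    inverse. *)
Lemma Uk_Ue c b (i j : 'I_n) : k c i * e b j =
  qpow hbar (sg C c * (sg C b * wform (alpha R i) (alpha R j))) *: (e b j * k c i).
Proof.
have KX : k true i * e b j =
  qpow hbar (sg C b * wform (alpha R i) (alpha R j)) *: (e b j * k true i).
  have := pi_rel (Uq_KX hbar b i j); rewrite !pi_mul pi_const mulr_algl => E.
  by rewrite scalerAl -E -!mulrA UkK mulr1.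
case: c; first by rewrite mul1r KX.
rewrite mulN1r qpowN; set c := qpow _ _ in KX *.
have E : e b j * k false i = c *: (k false i * e b j).
  rewrite -[e b j]mul1r -{1}(UkK false i) -[k false i * k _ i * _]mulrA KX.
  by rewrite -scalerAr -scalerAl mul1r -!mulrA UkK mulr1.
by rewrite E scalerA mulVf ?scale1r // qpow_neq0.
Qed.

Lemma Ue_commutator b (i j : 'I_n) : e b i * e (~~ b) j - e (~~ b) j * e b i =
  if i == j then (q - q^-1)^-1 *: (k b i - k (~~ b) i) else 0.
Proof.
have EF (i' j' : 'I_n) := pi_rel (Uq_EF hbar i' j').
case: b; first have := EF i j; last have := EF j i.
  rewrite pi_tbr /qbr scale1r => ->; case: eqP => _; last by rewrite pi_const scale0r.
  by rewrite pi_mul pi_add pi_mul !pi_const mulr_algl mulr_algl scaleN1r.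
rewrite pi_tbr /qbr scale1r => E; rewrite -opprB E eq_sym.
case: eqP => [->|_]; last by rewrite pi_const scale0r oppr0.
by rewrite pi_mul pi_add pi_mul !pi_const mulr_algl mulr_algl scaleN1r -scalerN opprB.
Qed.

Lemma qbr_serre (a : C) (x y : U) :
  a != 0 -> qbr a^-1 x (qbr a x y) = serre a x y.
Proof.
move=> a0. have := @qcom_qcom _ U a a0 x y. move=> <-. reflexivity.
Qed.

Hypothesis q0 : q != 0.

Lemma Ue_serre b (i j : 'I_n) : (0 < i)%N -> (i == j.+1 :> nat) || (j == i.+1 :> nat) ->
  serre q (e b i) (e b j) = 0.
Proof.
move=> i0 ij; rewrite -qbr_serre //.
have := @pi_rel _ _ (@Uq_serre R n hbar b i j _).
rewrite !pi_tbr pi_const scale0r; apply.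
rewrite !wform_alpha_int !cartanE eqxx ij.
have -> : (i == j :> nat) = false by lia.
have -> : (i == 0 :> nat) = false by lia.
rewrite rmorphN1 mulrN1 mulNr divff // pnatr_eq0 //.
Qed.

Lemma Ue_short b (i j : 'I_n) : i = 0%N :> nat -> j = 1%N :> nat ->
  qcom 1 (e b i) (serre q (e b i) (e b j)) = 0.
Proof.
move=> i0 j1; rewrite -qbr_serre //.
have := pi_rel (Uq_serre_delta hbar b i0 j1).
by rewrite !pi_tbr pi_const scale0r.
Qed.

Lemma Ue_far b (i j : 'I_n) : (i.+1 < j)%N -> qcom 1 (e b i) (e b j) = 0.
Proof.
move=> ij; have := @pi_rel _ _ (@Uq_orth R n hbar b i j _).
rewrite pi_tbr pi_const scale0r; apply.
rewrite wform_alpha_int cartanE.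
have -> : (i == j :> nat) = false by lia.
by have -> : (i == j.+1 :> nat) || (j == i.+1 :> nat) = false by lia.
Qed.

Notation sv b k := (simple_vec n hbar b k).

Lemma simple_vec_ord b (i : 'I_n) : sv b i = e b i.
Proof. by rewrite /simple_vec valK. Qed.

Lemma simple_vec_out b j : (n <= j)%N -> sv b j = 0.
Proof. by move=> nj; rewrite /simple_vec insubF // ltnNge nj. Qed.

Lemma serre0r (x : U) : serre q x 0 = 0.
Proof. by rewrite /serre !(mulr0, mul0r, scaler0, subr0, addr0). Qed.

Lemma serre0l (x : U) : serre q 0 x = 0.
Proof. by rewrite /serre !(mulr0, mul0r, scaler0, subr0, addr0). Qed.

Lemma qcom0r (x : U) : qcom 1 x 0 = 0.
Proof. by rewrite /qcom !(mulr0, mul0r, scaler0, subr0). Qed.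

Lemma simple_vec_far b i j : (i.+1 < j)%N -> qcom 1 (sv b i) (sv b j) = 0.
Proof.
move=> ij; have [jn|jn] := ltnP j n; last by rewrite (simple_vec_out _ jn) qcom0r.
have iN : (i < n)%N by lia.
rewrite (simple_vec_ord b (Ordinal jn)) (simple_vec_ord b (Ordinal iN)).
exact: Ue_far.
Qed.

Lemma simple_vec_serre b i j : (0 < i)%N -> (i == j.+1 :> nat) || (j == i.+1 :> nat) ->
  serre q (sv b i) (sv b j) = 0.
Proof.
move=> i0 ij.
have [iN|iN] := ltnP i n; last by rewrite (simple_vec_out _ iN) serre0l.
have [jn|jn] := ltnP j n; last by rewrite (simple_vec_out _ jn) serre0r.
rewrite (simple_vec_ord b (Ordinal jn)) (simple_vec_ord b (Ordinal iN)).
exact: Ue_serre.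
Qed.

Lemma simple_vec_short b : qcom 1 (sv b 0) (serre q (sv b 0) (sv b 1)) = 0.
Proof.
have [jn|jn] := ltnP 1 n; last first.
  by rewrite (simple_vec_out _ jn) serre0r qcom0r.
rewrite (simple_vec_ord b (Ordinal jn)) (simple_vec_ord b (Ordinal (ltnW jn))).
exact: Ue_short.
Qed.

Lemma e_deltaE b : e_delta n hbar b = serre q (sv b 0) (sv b 1).
Proof. exact: qbr_serre. Qed.

End Generators.

(** * The quantum group acts on waves *)
Section Action.
Context (R : realType) (n : nat) (hbar : R[i]) (t : R[i]).
Notation C := R[i].
Notation q := (qpow hbar 1).
Notation U := (Uq n hbar).
Notation rel := (@Uq_rel R n hbar).
Notation pi t := (\pi_(palg rel) t : U).
Notation e b i := (Ue hbar b i).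
Notation k b i := (Uk hbar b i).
Notation waves := (waves C).
Hypotheses (q21 : q ^+ 2 - 1 != 0) (tq : t ^+ 2 = - q^-1).
Let q0 : q != 0 := qpow_neq0 hbar 1.

Variable s : bool.

(** With [s = true] the [e_alpha] lower and the [f_alpha] raise, as in
    [M_lambda]; with [s = false] the roles are exchanged, as in
    [N_lambda]. *)
Fixpoint tact (a : aterm C (Uq_gen n)) (phi : waves) : waves :=
  match a with
  | TGen (GE b i) => ladder q t (b == s) i phi
  | TGen (GK b i) => torus q t (b == s) i phi
  | TConst c => c *: phi
  | TAdd a b => tact a phi + tact b phi
  | TMul a b => tact a (tact b phi)
  end.

Lemma tact_linear a (c : C) phi psi :
  tact a (c *: phi + psi) = c *: tact a phi + tact a psi.
Proof.
elim: a phi psi => [[b i|b i]|d|a IHa b IHb|a IHa b IHb] phi psi /=.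
- exact: ladder_linear.
- exact: torus_linear.
- by rewrite scalerDr !scalerA mulrC.
- by rewrite IHa IHb scalerDr addrACA.
- by rewrite IHb IHa.
Qed.

Lemma tactD a phi psi : tact a (phi + psi) = tact a phi + tact a psi.
Proof. by rewrite -[phi]scale1r tact_linear !scale1r. Qed.

Lemma tact0 a : tact a 0 = 0.
Proof.
have := tactD a 0 0; rewrite addr0 => /eqP.
by rewrite -subr_eq0 opprD addrA subrr sub0r oppr_eq0 => /eqP.
Qed.

Lemma tactZ a (c : C) phi : tact a (c *: phi) = c *: tact a phi.
Proof. by rewrite -[c *: phi]addr0 tact_linear tact0 addr0. Qed.

Lemma tact_tbr (a : C) x y phi :
  tact (tbr a x y) phi = tact x (tact y phi) - a *: tact y (tact x phi).
Proof. by rewrite /= scaleNr. Qed.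

Lemma tact_serre (a : C) x y phi : a != 0 ->
  tact (tbr a^-1 x (tbr a x y)) phi =
  serre_word a (tact x) (tact y) phi.
Proof.
move=> a0; rewrite !tact_tbr [tact x (_ - _)]tactD -scaleNr tactZ.
apply/funext => m; rewrite /serre_word !fctE /GRing.scale /=.
by field.
Qed.

(** The passage from [s = true] to [s = false] exchanges [e] with [f] and inverts
    the torus, which preserves the relations, so both cases follow from the
    same computations. *)
Lemma tact_rel a b phi : rel a b -> tact a phi = tact b phi.
Proof.
case=> {a b}.
- by move=> b i /=; rewrite scale1r (_ : (~~ b == s) = ~~ (b == s)) ?torusK //; case: b; case: s.
- by move=> b c i j /=; rewrite torusC.
- move=> b i j; apply/funext => m /=.
  rewrite (_ : (false == s) = ~~ (true == s)); last by case: s.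
  rewrite (torus_ladder q0 tq).
  rewrite wform_alpha_int /cartan fctE; congr (_ * _); rewrite -qpow_int; congr qpow.
  have exponentN v : torus_exponent i (- v) = - torus_exponent i v.
    by rewrite /torus_exponent; case: (val i) => [|l]; rewrite fctE // opprD opprK addrC.
  by case: b; case: s; rewrite /ladder_step /= ?exponentN ?mul1r ?mulN1r ?opprK ?mulrNz ?opprK.
- move=> i j; apply/funext => m; rewrite tact_tbr scale1r fctE /=.
  have sE : (false == s) = ~~ (true == s) by case: s.
  have -> : tact (if i == j then TMul (TConst (q - q^-1)^-1)
        (TAdd (TGen (GK true i)) (TMul (TConst (- 1)) (TGen (GK false i))))
      else TConst 0) phi m = if i == j then (q - q^-1)^-1 *
        (torus q t (true == s) i phi m - torus q t (false == s) i phi m) else 0.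
    by case: eqP => _ /=; rewrite !fctE ?scale0r // scaleN1r.
  rewrite sE; case: (true == s) => /=; first by rewrite (ladder_commutator q0 q21 tq) -val_eqE.
  rewrite -opprB (ladder_commutator q0 q21 tq) -val_eqE eq_sym.
  by case: eqP => [->|_]; rewrite ?oppr0 // -mulrN opprB.
- move=> b i j; rewrite !wform_alpha_int !cartanE eqxx => E.
  rewrite tact_serre //= scale0r; apply/funext => m.
  (* The Cartan integer is [-1] exactly for adjacent roots with [alpha_i] long;
     for [i = 0] and [j = 1] it is [-2]. *)
  have [i0 ij] : (0 < i)%N /\ ((i == j.+1 :> nat) || (j == i.+1 :> nat)).
    move: E; case: eqP => [->|_].
      case: ifP => _ /eqP; last rewrite -mulrA divff ?pnatr_eq0 // mulr1.
        by rewrite divr1 mulr1 -subr_eq0 opprK -(natrD _ 2 1) pnatr_eq0.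
      by rewrite -subr_eq0 opprK -(natrD _ 2 1) pnatr_eq0.
    case: ifP => [ij|_]; last by rewrite mulr0 mul0r => /eqP; rewrite eq_sym oppr_eq0 oner_eq0.
    case: posnP => [i0|i0] // ; rewrite divr1 rmorphN1 mulrN1 => /eqP.
    by rewrite -subr_eq0 opprK addrC subr_eq0 (eqr_nat C 1 2).
  case/orP: ij => /eqP ij.
    by rewrite ij ladder_serre_down.
  by move: i0 ij; case: (val i) => // l _ ->; rewrite ladder_serre_up.
- move=> b i j i0 j1; rewrite tact_tbr !tact_serre // /= scale0r i0 j1.
  have S0 psi : serre_word q (ladder q t (b == s) 0) (ladder q t (b == s) 1) psi = 0.
    by apply/funext => m; rewrite ladder_serre_short.
  have X0 : ladder q t (b == s) 0 0 = 0 by apply/funext => m; rewrite /ladder mulr0.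
  by rewrite !S0 X0 scaler0 subrr.
- move=> b i j; rewrite wform_alpha_int cartanE tact_tbr /= scale0r scale1r.
  case: eqP => [_|ij]; first by case: ifP => _ /eqP; rewrite ?oner_eq0 ?pnatr_eq0.
  case: ifP => [_ /eqP|/norP[ij1 ij2] _]; first by rewrite rmorphN1 oppr_eq0 oner_eq0.
  have [|] := ltnP i j => h; first by rewrite ladder_far ?subrr //; lia.
  by rewrite -ladder_far ?subrr //; lia.
Qed.

Lemma tact_aeq a b phi : aeq rel a b -> tact a phi = tact b phi.
Proof.
move=> ab; elim: ab phi => {a b} /=.
- by move=> a b ab phi; exact: tact_rel.
- by [].
- by move=> a b _ IH phi.
- by move=> b a c _ IH1 _ IH2 phi; rewrite IH1.
- by move=> a b a' b' _ IH1 _ IH2 phi; rewrite IH1 IH2.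
- by move=> a b a' b' _ IH1 _ IH2 phi; rewrite IH1 IH2.
- by move=> a b c phi; exact: addrA.
- by move=> a b phi; exact: addrC.
- by move=> a phi; rewrite scale0r add0r.
- by [].
- by move=> a phi; rewrite scale1r.
- by move=> a phi; rewrite !scale0r.
- by [].
- by move=> a b c phi; rewrite tactD.
- by move=> x y phi; rewrite scalerDl.
- by move=> x y phi; rewrite scalerA.
- by move=> x a phi; rewrite tactZ.
Qed.

Definition act (x : U) : waves -> waves := tact (repr x).

Lemma act_pi a phi : act (pi a) phi = tact a phi.
Proof. exact/tact_aeq/palg_repr. Qed.

Lemma pi_repr (x : U) : pi (repr x) = x.
Proof. exact: reprK. Qed.

Lemma act_add x y phi : act (x + y) phi = act x phi + act y phi.
Proof. by rewrite -{1}[x]pi_repr -{1}[y]pi_repr -(pi_add hbar (repr x)) act_pi. Qed.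

Lemma act_mul x y phi : act (x * y) phi = act x (act y phi).
Proof. by rewrite -{1}[x]pi_repr -{1}[y]pi_repr -(pi_mul hbar (repr x)) act_pi. Qed.

Lemma act_alg (c : C) phi : act c%:A phi = c *: phi.
Proof. by rewrite -pi_const act_pi. Qed.

Lemma act1 phi : act 1 phi = phi.
Proof. by rewrite -[1 : U]scale1r act_alg scale1r. Qed.

Lemma act0 phi : act 0 phi = 0.
Proof. by rewrite -(scale0r (1 : U)) act_alg scale0r. Qed.

Lemma act_scale (c : C) x phi : act (c *: x) phi = c *: act x phi.
Proof. by rewrite -mulr_algl act_mul act_alg. Qed.

Lemma act_sub x y phi : act (x - y) phi = act x phi - act y phi.
Proof. by rewrite act_add -scaleN1r act_scale scaleN1r. Qed.

Lemma act_linear x (c : C) phi psi :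
  act x (c *: phi + psi) = c *: act x phi + act x psi.
Proof. exact: tact_linear. Qed.

Lemma act_scalev x (c : C) phi : act x (c *: phi) = c *: act x phi.
Proof. exact: tactZ. Qed.

Lemma act_sum x (I : Type) (r : seq I) (c : I -> C) (phi : I -> waves) :
  act x (\sum_(i <- r) c i *: phi i) = \sum_(i <- r) c i *: act x (phi i).
Proof.
elim: r => [|i r IH]; first by rewrite !big_nil /act tact0.
by rewrite !big_cons act_linear IH.
Qed.

Lemma act_e b (i : 'I_n) phi : act (e b i) phi = ladder q t (b == s) i phi.
Proof. by rewrite act_pi. Qed.

Lemma act_k b (i : 'I_n) phi : act (k b i) phi = torus q t (b == s) i phi.
Proof. by rewrite act_pi. Qed.

End Action.

(** * Vacuum vectors *)
Section Generic.
Context (R : realType) (n : nat) (hbar : R[i]) (lam : 'rV[R[i]]_n).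
Notation C := R[i].
Notation q := (qpow hbar 1).
Notation U := (Uq n hbar).
Notation e b i := (Ue hbar b i).
Notation k b i := (Uk hbar b i).
Notation sv b k := (simple_vec n hbar b k).
Hypothesis hn : (2 <= n)%N.
Hypotheses
  (lam_eps : forall i : 'I_n,
     qpow hbar (2 * wform lam (eps R i)) = - (qpow hbar 1)^-1)
  (lam_alpha : forall i : 'I_n, (0 < i)%N -> wform (alpha R i) lam = 0)
  (q_not_root : forall k : nat, (0 < k)%N -> qpow hbar 1 ^+ k != 1).

(** [q^(lambda, alpha_1)], as [alpha_1 = eps_1]. *)
Definition vac_char : C := qpow hbar (coord lam 0).
Let q0 : q != 0 := qpow_neq0 hbar 1.

Lemma q2_neq1 : q ^+ 2 - 1 != 0.
Proof. by rewrite subr_eq0 q_not_root. Qed.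

Lemma q2_neqN1 : q * q + 1 != 0.
Proof.
apply: contraNneq (q_not_root (isT : (0 < 4)%N)) => /eqP.
rewrite addr_eq0 => /eqP E; rewrite -[4%N]/(2 * 2)%N exprM !expr2 E mulrNN mulr1 //.
Qed.

Lemma q4_q2_neq0 : 1 + q ^+ 2 + q ^+ 4 != 0.
Proof.
apply: contraNneq (q_not_root (isT : (0 < 6)%N)) => E.
rewrite -subr_eq0 (_ : q ^+ 6 - 1 = (q ^+ 2 - 1) * (1 + q ^+ 2 + q ^+ 4)).
  by rewrite E mulr0.
by ring.
Qed.

Lemma vac_charP : vac_char ^+ 2 = - q^-1.
Proof.
rewrite -qpowMn /vac_char; have n0 : (0 < n)%N by exact: ltnW.
by rewrite -(lam_eps (Ordinal n0)) wform_eps /coord insubT mulr_natl.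
Qed.

Let q21s : q ^+ 2 - 1 != 0 := q2_neq1.
Let tvacPs : vac_char ^+ 2 = - q^-1 := vac_charP.

Variable s : bool.
Notation act := (@act R n hbar vac_char s).
Notation act_e := (act_e q2_neq1 vac_charP).
Notation act_k := (act_k q2_neq1 vac_charP).
Notation ket0 := (ket C 0).

Lemma act_k_vac c (i : 'I_n) : act (k c i) ket0 =
  qpow hbar (sg C s * (sg C c * wform lam (alpha R i))) *: ket0.
Proof.
rewrite act_k torus_ket; congr (_ *: _).
have kE : torus_coef q vac_char i 0 = qpow hbar (wform lam (alpha R i)).
  rewrite /torus_coef wformC; have [i0|i0] := posnP i.
    rewrite wform_alpha /torus_exponent; case: i i0 => -[|i] Hi //= _.
    by rewrite oppr0 expr0z mulr1 subr0.
  rewrite lam_alpha // qpow0; case: (val i) i0 => // l _.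
  by rewrite /torus_exponent subrr expr0z mulr1.
by rewrite kE; case: c; case: s; rewrite /= ?mul1r ?mulN1r ?opprK ?qpowN.
Qed.

Lemma lower_ket0 i : ladder q vac_char true i ket0 = 0.
Proof.
have qn0 : qnum q 0 = 0 by rewrite /qnum oppr0 subrr mul0r.
rewrite ladder_ket sub0r [ladder_step _ _]/= /ladder_coef /lower_coef; case: i => [|i].
  rewrite (_ : (- root_step 0) 0%N + 1 = 0) ?qn0 ?mulr0 ?scale0r //.
rewrite (_ : (- root_step i.+1) i.+1 + 1 = 0) ?qn0 ?scale0r //.
by rewrite /root_step /unit_vec !fctE eqxx gtn_eqF.
Qed.

Lemma raise_ket0 i : ladder q vac_char false i.+1 ket0 = 0.
Proof.
have qn0 : qnum q 0 = 0 by rewrite /qnum oppr0 subrr mul0r.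
rewrite ladder_ket sub0r [ladder_step _ _]/= opprK /ladder_coef /lift_coef.
rewrite (_ : root_step i.+1 i + 1 = 0) ?qn0 ?scale0r //.
by rewrite /root_step /unit_vec !fctE eqxx ltn_eqF.
Qed.

(** The pairs [(x, c)] for which [x] acts on [ket 0] by [c] form a subalgebra,
    so the generators suffice. *)
Lemma C_lam_act p : C_lam lam s p -> act p.1 ket0 = (p.2 : C) *: ket0.
Proof.
pose B := [pred p : U * C^o | `[< act p.1 ket0 = (p.2 : C) *: ket0 >]].
move=> /(_ B) H; suff /asboolP : p \in B by [].
apply: H; first split.
- by apply/asboolP; rewrite act1 // -[LHS]scale1r.
- move=> a u v /asboolP Hu /asboolP Hv; apply/asboolP.
  rewrite -[LHS]/(act (a *: u.1 + v.1) ket0) act_add // act_scale // Hu Hv.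
  by rewrite scalerA -scalerDl.
- move=> u v /asboolP Hu /asboolP Hv; apply/asboolP.
  rewrite -[LHS]/(act (u.1 * v.1) ket0) act_mul // Hv act_scalev // Hu.
  by rewrite scalerA mulrC.
move=> x [[c [i ->]]|[i ->]|[i i0 ->]]; apply/asboolP => /=.
- exact: act_k_vac.
- by rewrite act_e eqxx lower_ket0 (scale0r ket0).
- rewrite act_e (_ : (~~ s == s) = false); last by case: s.
  by case: (val i) i0 => // l _; rewrite raise_ket0 (scale0r ket0).
Qed.

Lemma act_simple_vec b j phi : (j < n)%N ->
  act (sv b j) phi = ladder q vac_char (b == s) j phi.
Proof. by move=> jn; rewrite (simple_vec_ord hbar b (Ordinal jn)) act_e. Qed.

(** By [ladder_serre_short]; hence the model factors through the quotient by
    [f_delta 1_lambda]. *)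
Lemma act_e_delta b phi : act (e_delta n hbar b) phi = 0.
Proof.
rewrite e_deltaE // /serre; apply/funext => m.
rewrite !(act_add, act_sub, act_scale, act_mul) // !act_simple_vec ?(ltnW hn) //.
rewrite scaleN1r; exact: (@ladder_serre_short _ q vac_char q0 q2_neq1 phi m (b == s)).
Qed.

Lemma act_zero x : act x 0 = 0.
Proof. exact: tact0. Qed.

Lemma vac_hat_annihilator x : x *: vac_hat hbar lam s = 0 -> act x ket0 = 0.
Proof.
rewrite (_ : x *: vac_hat hbar lam s =
  \pi_(qmod [set x : U^o | exists2 p, C_lam lam s p & x = p.1 - p.2%:A]) x); last first.
  rewrite /vac_hat -[LHS]/(qmod_scale _ _) qmod_piZ.
  by congr (\pi _); exact: mulr1.
move=> /eqP /qmodP; rewrite subr0.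
pose B : {pred U^o} := [pred x : U^o | `[< act x ket0 = 0 >]].
move=> /(_ B) H; suff /asboolP : x \in B by [].
apply: H; first split.
- by apply/asboolP; exact: act0.
- move=> a u v /asboolP Hu /asboolP Hv; apply/asboolP.
  rewrite -[LHS]/(act (a * u + v) ket0) act_add // act_mul // Hu Hv.
  by rewrite act_zero addr0.
move=> y [p Cp ->]; apply/asboolP.
by rewrite -[LHS]/(act (p.1 - p.2%:A) ket0) act_sub // act_alg // (C_lam_act Cp) subrr.
Qed.

Lemma pi_vac (w : Mhat hbar lam s) x :
  w = x *: vac_hat hbar lam s ->
  \pi_(qmod [set e_delta n hbar (~~ s) *: vac_hat hbar lam s]) w =
  x *: vac hbar lam s.
Proof. by move->; rewrite -[RHS]/(qmod_scale _ _) qmod_piZ. Qed.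

Lemma vac_hat_cyclic (w : Mhat hbar lam s) : exists x, w = x *: vac_hat hbar lam s.
Proof.
exists (repr w); rewrite -[RHS]/(qmod_scale _ _) qmod_piZ -[LHS]reprK.
by congr (\pi _); exact/esym/mulr1.
Qed.

Lemma vac_cyclic (v : Mlam hbar lam s) : exists x, v = x *: vac hbar lam s.
Proof.
have [x /pi_vac E] := vac_hat_cyclic (repr v); exists x.
by rewrite -E reprK.
Qed.

(** The well-definedness of the map [x 1_lambda |-> x ket 0], first on
    the parabolic Verma module ([vac_hat_annihilator]), then on its
    quotient. *)
Lemma vac_annihilator x : x *: vac hbar lam s = 0 -> act x ket0 = 0.
Proof.
rewrite -(pi_vac (erefl (x *: vac_hat hbar lam s))) => /eqP /qmodP; rewrite subr0.
pose B : {pred Mhat hbar lam s} := [pred w | `[< forall y,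
  w = y *: vac_hat hbar lam s -> act y ket0 = 0 >]].
move=> /(_ B) H; suff /asboolP /(_ x erefl) : x *: vac_hat hbar lam s \in B by [].
apply: H; first split.
- by apply/asboolP => y /esym /vac_hat_annihilator.
- move=> a u v /asboolP Hu /asboolP Hv; apply/asboolP => y.
  have [[u' Eu] [v' Ev]] := (vac_hat_cyclic u, vac_hat_cyclic v).
  move=> /eqP; rewrite eq_sym -subr_eq0 Eu Ev scalerA -scalerDl -scalerBl.
  move=> /eqP/vac_hat_annihilator; rewrite act_sub // act_add // act_mul //.
  by rewrite (Hu _ Eu) (Hv _ Ev) act_zero addr0 subr0.
move=> w ->; apply/asboolP => y /eqP; rewrite eq_sym -subr_eq0 -scalerBl.
by move=> /eqP /vac_hat_annihilator; rewrite act_sub // act_e_delta subr0.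
Qed.

Lemma lift_vecP (v : Mlam hbar lam s) : lift_vec v *: vac hbar lam s = v.
Proof.
exact/esym/(xgetPex 0 (vac_cyclic v)).
Qed.

Lemma C_lam_vac p : C_lam lam s p -> p.1 *: vac hbar lam s = p.2%:A *: vac hbar lam s.
Proof.
move=> Cp; rewrite -!(pi_vac erefl); congr (\pi _).
rewrite /vac_hat -[LHS]/(qmod_scale _ _) -[RHS]/(qmod_scale _ _) !qmod_piZ.
apply/eqP/qmodP => W [W0 WZ] SW; apply: SW; exists p => //.
by congr (_ - _); exact: mulr1.
Qed.

Lemma Uk_vac c (i : 'I_n) : k c i *: vac hbar lam s =
  (qpow hbar (sg C s * (sg C c * wform lam (alpha R i))))%:A *: vac hbar lam s.
Proof. by apply: (C_lam_vac (p := (_, _))) => W _; apply; apply: Or31; exists c, i. Qed.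

Lemma Ue_vac (i : 'I_n) : e s i *: vac hbar lam s = 0.
Proof.
have := @C_lam_vac (e s i, 0); rewrite /= scale0r scale0r; apply.
by move=> W _; apply; apply: Or32; exists i.
Qed.

Lemma Ue_levi_vac (i : 'I_n) : (0 < i)%N -> e (~~ s) i *: vac hbar lam s = 0.
Proof.
move=> i0; have := @C_lam_vac (e (~~ s) i, 0); rewrite /= scale0r scale0r; apply.
by move=> W _; apply; apply: Or33; exists i.
Qed.

Lemma e_delta_vac : e_delta n hbar (~~ s) *: vac hbar lam s = 0.
Proof.
rewrite -(pi_vac erefl); apply/eqP/qmodP => W _; apply.
by rewrite /= subr0.
Qed.

Lemma simple_vec_vac j : sv (~~ s) j.+1 *: vac hbar lam s = 0.
Proof.
have [jn|jn] := ltnP j.+1 n; last by rewrite simple_vec_out ?scale0r.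
by rewrite (simple_vec_ord _ _ (Ordinal jn)) Ue_levi_vac.
Qed.

Notation V := (Mlam hbar lam s).
Notation Reach := (reach (F := C) (A := U) (V := V) (fun j => sv (~~ s) j) (vac hbar lam s)).

Lemma reach_Uk c (i : 'I_n) v : Reach v -> Reach (k c i *: v).
Proof.
elim=> [|u w _ Hu _ Hw|d w _ Hw|j w _ Hw].
- by rewrite Uk_vac; apply/reach_scale/reach_vac.
- by rewrite scalerDr; apply: reach_add.
- by rewrite scaler_comm_alg; apply: reach_scale.
have [jn|jn] := ltnP j n; last first.
  by rewrite simple_vec_out // scale0r scaler0; exact: reach0.
rewrite (simple_vec_ord _ _ (Ordinal jn)) scalerA Uk_Ue scale_algM.
apply: reach_scale; rewrite -(simple_vec_ord _ _ (Ordinal jn)).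
exact: reach_op.
Qed.

Lemma reach_Ue b (i : 'I_n) v : Reach v -> Reach (e b i *: v).
Proof.
have [->|bs] := eqVneq b (~~ s).
  by move=> Rv; rewrite -simple_vec_ord; apply: (reach_op i).
have {b bs}-> : b = s by move: bs; case: b; case: s.
elim=> [|u w _ Hu _ Hw|d w _ Hw|j w Rw Hw].
- by rewrite Ue_vac; exact: reach0.
- by rewrite scalerDr; apply: reach_add.
- by rewrite scaler_comm_alg; apply: reach_scale.
have [jn|jn] := ltnP j n; last first.
  by rewrite simple_vec_out // scale0r scaler0; exact: reach0.
rewrite (simple_vec_ord _ _ (Ordinal jn)) scalerA.
rewrite -[e s i * _](subrK (e (~~ s) (Ordinal jn) * e s i)) Ue_commutator scalerDl.
apply: reach_add; last first.
  rewrite -scalerA -(simple_vec_ord _ _ (Ordinal jn)); exact: reach_op.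
case: eqP => _; last by rewrite scale0r; exact: reach0.
rewrite scaler_algA scalerBl; apply/reach_scale/reach_sub; exact: reach_Uk.
Qed.

(** The words in the lowering generators applied to the vacuum span the module:
    this span is stable under the torus by [reach_Uk], and under the raising
    generators because these can be moved to the right onto the vacuum
    ([reach_Ue]). *)
Lemma reach_all v : Reach v.
Proof.
rewrite -(lift_vecP v); elim/Uq_left_ind: (lift_vec v) => [|x y Rx Ry|c x Rx|b i x|b i x].
- by rewrite scale1r; exact: reach_vac.
- by rewrite scalerDl; exact: reach_add.
- by rewrite scaler_algA; exact: reach_scale.
- by rewrite -scalerA; exact: reach_Ue.
- by rewrite -scalerA; exact: reach_Uk.
Qed.

Lemma monomials_span v : exists l : seq (C * {ffun 'I_n -> nat}),
  v = \sum_(p <- l) p.1%:A *: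
    (root_monomial q (fun j => sv (~~ s) j) p.2 *: vac hbar lam s).
Proof.
pose r j := sv (~~ s) j.
have far i j : (i.+1 < j)%N -> qcom 1 (r i) (r j) = 0 by exact: simple_vec_far.
have dn i : serre q (r i.+1) (r i) = 0 by apply: simple_vec_serre; rewrite ?eqxx.
have up i : serre q (r i.+1) (r i.+2) = 0 by apply: simple_vec_serre; rewrite ?eqxx ?orbT.
have short : qcom 1 (r 0) (serre q (r 0) (r 1)) = 0 by exact: simple_vec_short.
have E := e_delta_vac; rewrite e_deltaE // in E.
apply: (reach_root_monomials q0 q2_neqN1 q4_q2_neq0 far dn up short simple_vec_vac E).
  by move=> i; exact: simple_vec_out.
apply: (reach_r_root q0 q2_neqN1 q4_q2_neq0 far dn up simple_vec_vac).
exact: reach_all.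
Qed.

End Generic.

(** * Monomials in root vectors acting on kets *)
Section KetMonomials.
Context (R : realType) (n : nat) (hbar t : R[i]) (s : bool).
Notation C := R[i].
Notation q := (qpow hbar 1).
Notation U := (Uq n hbar).
Hypotheses (q21 : q ^+ 2 - 1 != 0) (tq : t ^+ 2 = - q^-1).
Let q0 : q != 0 := qpow_neq0 hbar 1.
Notation act := (@act R n hbar t s).
Notation ketC := (ket C).

Definition ext (m : {ffun 'I_n -> nat}) (k : nat) : nat :=
  if insub k is Some i then m i else 0%N.
Definition emb (m : {ffun 'I_n -> nat}) : lattice := fun k => (ext m k)%:Z.

Lemma ext_ord m (i : 'I_n) : ext m i = m i.
Proof. by rewrite /ext valK. Qed.

Lemma emb_inj : injective emb.
Proof.
move=> m m' E; apply/ffunP => i; have := congr1 (fun f : lattice => f i) E.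
by rewrite /emb !ext_ord => -[].
Qed.

Lemma prod_ext (A : pzRingType) (x : nat -> A) (m : {ffun 'I_n -> nat}) :
  \prod_(i < n) x i ^+ m i = \prod_(0 <= i < n) x i ^+ ext m i.
Proof. by rewrite big_mkord; apply: eq_bigr => i _; rewrite ext_ord. Qed.

(** The rightmost factors act first, so that the modes are filled from the last
    to the first.  When [x j] acts, the modes below [j] are still empty; this is
    why its coefficient is needed only for [psum j m = 0], where it is a
    constant. *)
Lemma act_raise_monomial (x : nat -> U) (c : nat -> C) :
  (forall j m, (j < n)%N -> psum j m = 0 ->
     act (x j) (ketC m) = c j *: ketC (m + unit_vec j)) ->
  forall m : {ffun 'I_n -> nat}, act (\prod_(i < n) x i ^+ m i) (ketC 0) =
    (\prod_(i < n) c i ^+ m i) *: ketC (emb m).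
Proof.
move=> xP m; rewrite !prod_ext.
pose tail a : lattice := fun k => if (a <= k)%N then (ext m k)%:Z else 0.
(* [tail a] has the modes from [a] on filled; induction on the number of
   these modes. *)
suff H d a : (a + d = n)%N -> act (\prod_(a <= i < n) x i ^+ ext m i) (ketC 0) =
    (\prod_(a <= i < n) c i ^+ ext m i) *: ketC (tail a) by exact: (H n 0%N).
elim: d a => [|d IH] a an.
  rewrite !big_geq -?an ?addn0 // act1 // scale1r; congr (ketC _).
  apply/funext => k; rewrite /tail; case: leqP => // ak.
  by rewrite /ext insubF // -an addn0 ltnNge ak.
have lan : (a < n)%N by lia.
rewrite !(big_ltn lan) act_mul // IH ?addSnnS // act_scalev //.
have tail_a k j : (j < a)%N -> (tail a.+1 + unit_vec a *+ k) j = 0.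
  move=> ja; rewrite fctE /tail ltnNge ltnW //= add0r.
  by rewrite natmulfctE /unit_vec (ltn_eqF ja) mul0rn.
have E k : act (x a ^+ k) (ketC (tail a.+1)) =
    (c a ^+ k) *: ketC (tail a.+1 + unit_vec a *+ k).
  elim: k => [|k IHk]; first by rewrite !expr0 act1 // mulr0n addr0 scale1r.
  rewrite !exprS act_mul // IHk act_scalev // xP //.
    by rewrite scalerA mulrC mulrSr addrA.
  by rewrite /psum big1_seq // => j; rewrite mem_index_iota => /andP[_ ja]; exact: tail_a.
rewrite E scalerA mulrC; congr (_ *: ketC _); apply/funext => k.
rewrite fctE natmulfctE /tail /unit_vec; have [ak|ak|<-] := ltngtP a k.
- by rewrite mul0rn addr0.
- by rewrite mul0rn addr0.
by rewrite add0r mulr1n natz.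
Qed.

(** The leftmost factors are evaluated first here, which shifts the argument
    upwards; it stays in the nonnegative range, where the coefficients do not
    vanish. *)
Lemma act_lower_monomial (y : nat -> U) (d : nat -> lattice -> C) :
  (forall j phi p, (j < n)%N -> act (y j) phi p = d j p * phi (p + unit_vec j)) ->
  (forall j (p : lattice), (forall k, 0 <= p k) -> d j p != 0) ->
  forall (m : {ffun 'I_n -> nat}) (p : lattice), (forall k, 0 <= p k) ->
  exists D : C, D != 0 /\ forall phi,
    act (\prod_(i < n) y i ^+ m i) phi p = D * phi (p + emb m).
Proof.
move=> yP d0 m p p0; rewrite prod_ext.
pose head b : lattice := fun k => if (k < b)%N then (ext m k)%:Z else 0.
suff H b : (b <= n)%N -> exists D : C, D != 0 /\ forall phi,
    act (\prod_(0 <= i < b) y i ^+ ext m i) phi p = D * phi (p + head b).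
  have [D [D0 H']] := H n (leqnn n); exists D; split=> // phi; rewrite H'.
  congr (_ * phi (_ + _)); apply/funext => k; rewrite /head /emb /ext.
  by case: ltnP => // nk; rewrite insubF // ltnNge nk.
elim: b => [|b IH] bn.
  exists 1; rewrite oner_neq0; split=> // phi; rewrite big_geq // act1 // mul1r.
  by congr (phi _); rewrite -[LHS]addr0; congr (_ + _); apply/funext.
have [D [D0 HD]] := IH (ltnW bn).
have E k (p' : lattice) : (forall k, 0 <= p' k) -> exists D' : C, D' != 0 /\ forall phi,
    act (y b ^+ k) phi p' = D' * phi (p' + unit_vec b *+ k).
  elim: k p' => [|k IHk] p' p'0.
    by exists 1; rewrite oner_neq0; split=> // phi; rewrite expr0 act1 // mul1r mulr0n addr0.
  have [|D' [D'0 H']] := IHk (p' + unit_vec b).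
    by move=> j; rewrite fctE addr_ge0 // /unit_vec ler0n.
  exists (d b p' * D'); split=> [|phi]; first by rewrite mulf_neq0 ?d0.
  by rewrite exprS act_mul // yP // H' mulrA mulrS addrA.
have [|D' [D'0 H']] := E (ext m b) (p + head b).
  by move=> j; rewrite fctE addr_ge0 // /head; case: ifP.
exists (D * D'); split=> [|phi]; first by rewrite mulf_neq0.
rewrite big_nat_recr //= act_mul // HD H' mulrA -addrA; congr (_ * phi (_ + _)).
apply/funext => k; rewrite fctE natmulfctE /head /unit_vec ltnS.
have [bk|bk|->] := ltngtP k b.
- by rewrite mul0rn addr0.
- by rewrite mul0rn addr0.
by rewrite add0r mulr1n natz.
Qed.
End KetMonomials.

(** * Basis and irreducibility *)
Lemma seq_max (T : eqType) (f : T -> nat) (r : seq T) : r != [::] ->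
  exists2 m, m \in r & forall m', m' \in r -> (f m' <= f m)%N.
Proof.
elim: r => // x r IH _; have [->|/IH[m mr mP]] := eqVneq r [::].
  by exists x; rewrite ?mem_head // => m'; rewrite inE => /eqP->.
have [xm|mx] := leqP (f x) (f m).
  exists m; rewrite ?inE ?mr ?orbT // => m'; rewrite inE => /orP[/eqP->//|].
  exact: mP.
exists x; rewrite ?mem_head // => m'; rewrite inE => /orP[/eqP->//|/mP h].
exact: leq_trans h (ltnW mx).
Qed.

Section Basis.
Context (R : realType) (n : nat) (hbar : R[i]) (lam : 'rV[R[i]]_n).
Notation C := R[i].
Notation q := (qpow hbar 1).
Notation U := (Uq n hbar).
Notation sv b k := (simple_vec n hbar b k).
Hypothesis hn : (2 <= n)%N.
Hypotheses
  (lam_eps : forall i : 'I_n,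
     qpow hbar (2 * wform lam (eps R i)) = - (qpow hbar 1)^-1)
  (lam_alpha : forall i : 'I_n, (0 < i)%N -> wform (alpha R i) lam = 0)
  (q_not_root : forall k : nat, (0 < k)%N -> qpow hbar 1 ^+ k != 1).
Let q0 : q != 0 := qpow_neq0 hbar 1.
Notation t := (vac_char hbar lam).
Let q21s : q ^+ 2 - 1 != 0 := q2_neq1 q_not_root.
Let tqs : t ^+ 2 = - q^-1 := vac_charP hn lam_eps.

Variable s : bool.
Notation act := (@act R n hbar t s).
Notation ket0 := (ket C 0).
Notation V := (Mlam hbar lam s).
Notation vac := (vac hbar lam s).
Notation rv b := (root_vec q (fun j => sv b j)).
Notation rmonomial b := (root_monomial (n := n) q (fun j => sv b j)).

Lemma act_vac_eq x y : x *: vac = y *: vac -> act x ket0 = act y ket0.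
Proof.
move=> /eqP; rewrite -subr_eq0 -scalerBl => /eqP /(vac_annihilator hn lam_eps lam_alpha q_not_root).
by rewrite act_sub // => /eqP; rewrite subr_eq0 => /eqP.
Qed.

(** The map from the module to the model; by [act_vac_eq] it does not depend on
    the preimage chosen by [lift_vec]. *)
Definition wave (v : V) : waves C := act (lift_vec v) ket0.

Lemma wave_vac x : wave (x *: vac) = act x ket0.
Proof. by apply: act_vac_eq; exact: lift_vecP. Qed.

Lemma wave_act x v : wave (x *: v) = act x (wave v).
Proof. by rewrite -{1}(lift_vecP v) scalerA wave_vac act_mul. Qed.

Lemma wave_add u v : wave (u + v) = wave u + wave v.
Proof.
by rewrite -{1}(lift_vecP u) -{1}(lift_vecP v) -scalerDl wave_vac act_add.
Qed.

Lemma wave_sum (I : Type) (r : seq I) (F : I -> V) :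
  wave (\sum_(i <- r) F i) = \sum_(i <- r) wave (F i).
Proof.
elim: r => [|i r IH]; last by rewrite !big_cons wave_add IH.
by rewrite !big_nil -(scale0r vac) wave_vac act0.
Qed.

Lemma wave_alg (c : C) v : wave (c%:A *: v) = c *: wave v.
Proof. by rewrite wave_act act_alg. Qed.

Lemma act_root_vec b j phi : (j < n)%N -> act (rv b j) phi = root_op q t (b == s) j phi.
Proof.
elim: j phi => [|j IH] phi jn; first by rewrite /= act_simple_vec.
rewrite rootS /qcom act_sub // act_scale // !act_mul // IH ?(ltnW jn) //.
by rewrite !act_simple_vec // IH ?(ltnW jn).
Qed.

Lemma root_op_ket b j m : root_op q t b j (ket C m) =
  root_op_coef q t b j (m - eps_step b j) *: ket C (m - eps_step b j).
Proof.
apply/funext => p; rewrite root_opE // ket_shift fctE.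
by rewrite (ket_mul (root_op_coef q t b j)).
Qed.

(** The value of [root_op_coef] with empty lower modes, for each factor. *)
Definition monomial_coef (m : {ffun 'I_n -> nat}) : C :=
  \prod_(i < n) ((- q^-1) ^+ i) ^+ m i.

Lemma monomial_coef_neq0 m : monomial_coef m != 0.
Proof.
apply/prodf_neq0 => i _; rewrite !expf_neq0 // oppr_eq0 invr_eq0 //.
Qed.

Lemma act_root_monomial m : act (rmonomial (~~ s) m) ket0 = monomial_coef m *: ket C (emb m).
Proof.
apply: (@act_raise_monomial _ _ _ _ _ _ _ _ (fun i => (- q^-1) ^+ i)) => // j p jn pj.
rewrite act_root_vec // (_ : (~~ s == s) = false) ?root_op_ket; last by case: s.
rewrite /eps_step opprK; congr (_ *: _).
rewrite /root_op_coef psum_shift ?pj ?add0r; last first.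
  by move=> k kj; rewrite /unit_vec ltn_eqF.
by rewrite qN ?q0 // -exprnP [RHS]exprNn exprVn.
Qed.

Definition basis_vec m : V := rmonomial (~~ s) m *: vac.

Lemma wave_basis_vec m : wave (basis_vec m) = monomial_coef m *: ket C (emb m).
Proof. by rewrite wave_vac act_root_monomial. Qed.

Lemma basis_vec_span v : exists (r : seq {ffun 'I_n -> nat}) (c : {ffun 'I_n -> nat} -> C),
  uniq r /\ v = \sum_(i <- r) (c i)%:A *: basis_vec i.
Proof.
have [l ->] := monomials_span q_not_root v.
exists (undup [seq p.2 | p <- l]), (fun m => \sum_(p <- l | p.2 == m) p.1).
split; first exact: undup_uniq.
rewrite -/basis_vec; under [RHS]eq_bigr => m _.
  rewrite scaler_suml scaler_suml.
  over.
rewrite (exchange_big_dep xpredT) //=; apply: eq_big_seq => p pl.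
rewrite (eq_bigl (pred1 p.2)) => [|m]; last by rewrite eq_sym.
by rewrite -big_filter filter_pred1_uniq ?undup_uniq ?big_seq1 // mem_undup map_f.
Qed.

Lemma wave_span (r : seq {ffun 'I_n -> nat}) (c : {ffun 'I_n -> nat} -> C) :
  wave (\sum_(i <- r) (c i)%:A *: basis_vec i) =
  \sum_(i <- r) (c i * monomial_coef i) *: ket C (emb i).
Proof.
rewrite wave_sum; apply: eq_bigr => i _.
by rewrite wave_alg wave_basis_vec scalerA.
Qed.

Lemma ket_emb (i j : {ffun 'I_n -> nat}) : ket C (emb i) (emb j) = (j == i)%:R.
Proof.
rewrite /ket; congr (_%:R : C); congr nat_of_bool.
by apply/asboolP/eqP => [/emb_inj|->].
Qed.

Lemma sum_ket_emb (r : seq {ffun 'I_n -> nat}) (a : {ffun 'I_n -> nat} -> C) j :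
  uniq r -> (\sum_(i <- r) a i *: ket C (emb i)) (emb j) =
  if j \in r then a j else 0.
Proof.
move=> ru; rewrite fct_sumE.
under eq_bigr => i _ do rewrite fctE ket_emb.
case: ifP => jr.
  rewrite (bigD1_seq j) //= eqxx big1 ?addr0 => [|i ij]; first exact: mulr1.
  by rewrite eq_sym (negPf ij) scaler0.
rewrite big1_seq // => i /andP[_ ir].
by case: eqP => [E|_]; [rewrite E ir in jr | rewrite scaler0].
Qed.

(** The images of the basis vectors under [wave] are nonzero multiples of
    distinct delta functions. *)
Lemma basis_vec_free (r : seq {ffun 'I_n -> nat}) (c : {ffun 'I_n -> nat} -> C) :
  uniq r -> \sum_(i <- r) (c i)%:A *: basis_vec i = 0 -> forall i, i \in r -> c i = 0.
Proof.
move=> ru /(congr1 wave); rewrite wave_span => E i ir.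
have := congr1 (fun f : waves C => f (emb i)) E.
rewrite sum_ket_emb // ir -(scale0r vac) wave_vac act0 // => /eqP.
by rewrite mulf_eq0 (negPf (monomial_coef_neq0 i)) orbF => /eqP.
Qed.

Lemma vac_neq0 : vac != 0.
Proof.
apply/eqP => v0; have := wave_vac 1.
rewrite scale1r v0 -(scale0r vac) wave_vac act1 // act0 //.
move=> /(congr1 (fun f : waves C => f 0)) /eqP.
by rewrite /ket; case: asboolP => // _; rewrite eq_sym oner_eq0.
Qed.

Lemma qnum_neq0 (z : int) : 0 < z -> qnum q z != 0.
Proof.
case: z => // -[|k] // _; rewrite /qnum mulf_neq0 ?invr_eq0 //.
  rewrite subr_eq0 qN -exprnP; apply/eqP => E.
  have /eqP[] := q_not_root (isT : (0 < k.+1 + k.+1)%N).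
  by rewrite exprD {1}E mulVf ?expf_neq0.
rewrite subr_eq0; apply/eqP => E; have /eqP[] := q_not_root (isT : (0 < 2)%N).
by rewrite expr2 {1}E mulVf.
Qed.

Lemma kappa_neq0 : kappa q t != 0.
Proof.
rewrite /kappa mulf_neq0 ?qpow_neq0 // invr_eq0 subr_eq0 eq_sym invr_eq1.
exact: (q_not_root (isT : (0 < 1)%N)).
Qed.

Lemma act_lower_root_monomial (m : {ffun 'I_n -> nat}) (p : lattice) : (forall k, 0 <= p k) ->
  exists D : C, D != 0 /\ forall phi,
    act (rmonomial s m) phi p = D * phi (p + emb m).
Proof.
move=> p0; apply: (@act_lower_monomial _ _ _ _ _ q21s tqs _ (root_op_coef q t true)) => //.
  by move=> j phi p' jn; rewrite act_root_vec // eqxx root_opE.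
move=> j p' p'0; rewrite /root_op_coef; apply: mulf_neq0; last by rewrite expfz_neq0.
apply: mulf_neq0; first exact: kappa_neq0.
by apply: qnum_neq0; rewrite ltr_wpDl.
Qed.

Lemma emb_ge0 (m : {ffun 'I_n -> nat}) k : 0 <= emb m k.
Proof. by []. Qed.

Lemma embD (m m' : {ffun 'I_n -> nat}) :
  emb m + emb m' = emb [ffun l => (m l + m' l)%N].
Proof.
apply/funext => l; rewrite fctE /emb /ext; case: insubP => [u _ _|//].
by rewrite ffunE PoszD.
Qed.

(** Let [v] be nonzero in the submodule, and [m] the exponent of a monomial of
    maximal degree in [v].  The value at [i] of the image of the lowering
    monomial is a nonzero multiple of the value of [v] at [i + m], which
    vanishes for [i <> 0] by maximality.  So the vacuum lies in the
    submodule. *)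
Lemma Mlam_irreducible : irreducible_module V.
Proof.
split; first by exists vac; exact: vac_neq0.
move=> P Pc; case: (pselect (exists v, v \in P /\ v != 0)); last first.
  move=> H; left=> v Pv; apply/eqP/negP => v0; apply: H; exists v; split=> //.
  exact/negP.
move=> [v [Pv v0]]; right.
have PZ x w : w \in P -> x *: w \in P.
  by case: Pc => P0 PD Pw; rewrite -[x *: w]addr0; apply: PD.
suff Pvac : vac \in P by move=> w; rewrite -(lift_vecP w); exact: PZ.
have [r [c [ru E]]] := basis_vec_span v.
have [m [mr cm mmax]] : exists m, [/\ m \in r, c m != 0 &
    forall m', m' \in r -> c m' != 0 -> (\sum_i m' i <= \sum_i m i)%N].
  have : [seq i <- r | c i != 0] != [::].
    apply: contra_neq v0 => r0; rewrite E big1_seq // => i /= ir.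
    suff -> : c i = 0 by rewrite scale0r scale0r.
    apply/eqP; apply: contraT => ci.
    by have := mem_filter (fun i => c i != 0) i r; rewrite r0 ci ir.
  move=> /(seq_max (fun m : {ffun 'I_n -> nat} => \sum_i m i)%N) [m].
  rewrite mem_filter => /andP[cm mr] mmax; exists m; split=> // m' m'r cm'.
  by apply: mmax; rewrite mem_filter cm'.
have [r' [c' [ru' E']]] := basis_vec_span (rmonomial s m *: v).
have w' i : (if i \in r' then c' i * monomial_coef i else 0) =
    act (rmonomial s m) (wave v) (emb i).
  by rewrite -wave_act E' wave_span sum_ket_emb.
have wv i : wave v (emb i) = if i \in r then c i * monomial_coef i else 0.
  by rewrite E wave_span sum_ket_emb.
pose z : {ffun 'I_n -> nat} := [ffun=> 0%N].
have bz : basis_vec z = vac.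
  rewrite /basis_vec /root_monomial big1 ?scale1r // => i _.
  by rewrite ffunE expr0.
have c'0 i : i \in r' -> i != z -> c' i = 0.
  move=> ir' iz; have := w' i; rewrite ir'.
  have [D [_ ->]] := act_lower_root_monomial m (emb_ge0 i).
  rewrite embD wv; set j := [ffun l => _].
  case: ifP => [jr|_]; last first.
    by rewrite mulr0 => /eqP; rewrite mulf_eq0 (negPf (monomial_coef_neq0 i)) orbF => /eqP.
  have [->|cj] := eqVneq (c j) 0.
    by rewrite mul0r mulr0 => /eqP; rewrite mulf_eq0 (negPf (monomial_coef_neq0 i)) orbF => /eqP.
  case/eqP: iz; apply/ffunP => l; rewrite ffunE; apply/eqP.
  have := mmax j jr cj; under eq_bigr do rewrite ffunE.
  rewrite big_split /= -{2}[(\sum_i m i)%N]add0n leq_add2r leqn0 sum_nat_eq0.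
  by move/forallP => /(_ l).
have wz : rmonomial s m *: v = (if z \in r' then c' z else 0)%:A *: vac.
  rewrite E'; case: ifP => zr.
    rewrite (bigD1_seq z) //= bz big1_seq ?addr0 // => i /andP[iz ir].
    by rewrite c'0 // scale0r scale0r.
  rewrite scale0r scale0r big1_seq // => i /andP[_ ir].
  by rewrite c'0 ?scale0r ?scale0r //; apply: contraFneq zr => <-.
have cz0 : (if z \in r' then c' z else 0) != 0.
  have := w' z; have [D [D0 ->]] := act_lower_root_monomial m (emb_ge0 z).
  rewrite embD (_ : [ffun l => _] = m); last by apply/ffunP => l; rewrite !ffunE.
  rewrite wv mr; case: ifP => _ Ez.
    apply/negP => /eqP c0; move: Ez; rewrite c0 mul0r => /esym/eqP.
    by rewrite !mulf_eq0 (negPf D0) (negPf cm) (negPf (monomial_coef_neq0 m)).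
  move: Ez => /esym/eqP.
  by rewrite !mulf_eq0 (negPf D0) (negPf cm) (negPf (monomial_coef_neq0 m)).
rewrite -[vac]scale1r -[1 : U]scale1r -(mulVf cz0) -scale_alg_combine -wz.
exact/PZ/PZ.
Qed.
End Basis.

(** * The involution and the inverse antipode *)
Section Twist.
Variables (F : fieldType) (A : algType F) (q : F).

Lemma twist_mul (b : F) (K L x y : A) :
  x * L = b *: (L * x) -> (K * x) * (L * y) = b *: ((K * L) * (x * y)).
Proof. by move=> E; rewrite mulrA -(mulrA K) E -scalerAr -scalerAl !mulrA. Qed.

Lemma twist_comm_mul (a b : F) (K x y : A) :
  x * K = a *: (K * x) -> y * K = b *: (K * y) ->
  (x * y) * K = (a * b) *: (K * (x * y)).
Proof.
by move=> Ex Ey; rewrite -(mulrA x) Ey -scalerAr (mulrA x) Ex -scalerAl scalerA mulrC (mulrA K).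
Qed.

Lemma twist_comm_mulr (a b : F) (K L x : A) :
  x * K = a *: (K * x) -> x * L = b *: (L * x) ->
  x * (K * L) = (a * b) *: ((K * L) * x).
Proof.
by move=> Ex Ey; rewrite (mulrA x) Ex -scalerAl -(mulrA K x) Ey -scalerAr scalerA (mulrA K).
Qed.

Variables (a b : F) (K L x y : A).
Hypotheses (KL : K * L = L * K) (xK : x * K = a *: (K * x))
  (xL : x * L = b *: (L * x)) (yK : y * K = b *: (K * y)).

(** The inverse antipode sends simple root vectors to [K x] with [K] in the
    torus.  In each word of the Serre relation the torus elements can be moved
    to the left, and the three words collect the same scalar. *)
Lemma serre_twist :
  serre q (K * x) (L * y) = (a * b * b) *: ((K * K * L) * serre q x y).
Proof.
rewrite /serre !(twist_mul _ _ xK, twist_mul _ _ xL, twist_mul _ _ yK).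
rewrite -!scalerAl (twist_mul _ _ (twist_comm_mul xL xL)) (twist_mul _ _ (twist_comm_mul xK yK))
  (twist_mul _ _ (twist_comm_mul yK xK)) !scalerA.
rewrite -KL -(mulrA K L K) -KL (mulrA K K).
move: (K * K * L) (x * x * y) (x * y * x) (y * x * x) => k u v w.
by nc F A; ring.
Qed.

Lemma serre_short_twist : qcom 1 x (serre q x y) = 0 ->
  qcom 1 (serre q (K * x) (L * y)) (K * x) = 0.
Proof.
move=> /qcom1P E; apply/qcom1P; rewrite serre_twist -scalerAl -scalerAr.
congr (_ *: _).
have sK : serre q x y * K = (a * a * b) *: (K * serre q x y).
  have xxK := twist_comm_mul xK xK.
  rewrite /serre mulrDl mulrBl -scalerAl (twist_comm_mul xxK yK)
    (twist_comm_mul (twist_comm_mul xK yK) xK) (twist_comm_mul (twist_comm_mul yK xK) xK).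
  by move: (x * x * y) (x * y * x) (y * x * x) => u v w; nc F A; ring.
rewrite (twist_mul _ _ sK) (twist_mul _ _ (twist_comm_mulr (twist_comm_mulr xK xK) xL)) E.
by congr (_ *: (_ * _)); rewrite -!mulrA KL.
Qed.

Lemma commute_twist : x * y = y * x -> (K * x) * (L * y) = (L * y) * (K * x).
Proof. by move=> E; rewrite (twist_mul _ _ xL) (twist_mul _ _ yK) E KL. Qed.

End Twist.

(** The Serre word is invariant under reversal of products. *)
Lemma anti_serre (F : fieldType) (A : algType F) (q : F) (x y : A) : q != 0 ->
  (y * x - q *: (x * y)) * x - q^-1 *: (x * (y * x - q *: (x * y))) = serre q x y.
Proof. by move=> q0; rewrite /serre; nc F A; field; rewrite ?q0. Qed.

Lemma serre_scale (F : fieldType) (A : algType F) (q c d : F) (x y : A) :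
  serre q (c *: x) (d *: y) = (c * c * d) *: serre q x y.
Proof. by rewrite /serre; nc F A; ring. Qed.

Lemma qcom_scale2 (F : fieldType) (A : algType F) (c d : F) (x y : A) :
  qcom 1 (c *: x) (d *: y) = (c * d) *: qcom 1 x y.
Proof. by rewrite /qcom; nc F A; ring. Qed.

Section AntiMorphisms.
Context (R : realType) (n : nat) (hbar : R[i]).
Notation C := R[i].
Notation q := (qpow hbar 1).
Notation U := (Uq n hbar).
Notation rel := (@Uq_rel R n hbar).
Notation pi t := (\pi_(palg rel) t : U).
Notation e b i := (Ue hbar b i).
Notation k b i := (Uk hbar b i).
Notation w i j := (wform (alpha R i) (alpha R j)).
Let q0 : q != 0 := qpow_neq0 hbar 1.

(** The images of the generators define a map on terms that reverses products;
    it descends to the quantum group if these images satisfy the opposite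
    relations. *)
Lemma anti_morphism_exists (x kk : bool -> 'I_n -> U) :
  (forall b i, kk (~~ b) i * kk b i = 1) ->
  (forall b c i j, kk b i * kk c j = kk c j * kk b i) ->
  (forall b i j, kk false i * (x b j * kk true i) =
     qpow hbar (sg C b * w i j) *: x b j) ->
  (forall i j, x false j * x true i - x true i * x false j =
     if i == j then (q - q^-1)^-1 *: (kk true i - kk false i) else 0) ->
  (forall b (i j : 'I_n), 2 * w i j / w i i = -1 -> serre q (x b i) (x b j) = 0) ->
  (forall b (i j : 'I_n), i = 0%N :> nat -> j = 1%N :> nat ->
     qcom 1 (serre q (x b i) (x b j)) (x b i) = 0) ->
  (forall b i j, w i j = 0 -> x b j * x b i = x b i * x b j) ->
  exists g : U -> U, [/\ anti_morphism g, forall b i, g (e b i) = x b i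
    & forall b i, g (k b i) = kk b i].
Proof.
move=> hKK hKC hKX hXX hS hD hO.
pose fix ev (a : aterm C (Uq_gen n)) : U :=
  match a with
  | TGen (GE b i) => x b i
  | TGen (GK b i) => kk b i
  | TConst c => c%:A
  | TAdd a b => ev a + ev b
  | TMul a b => ev b * ev a
  end.
have ev_tbr c a b : ev (tbr c a b) = ev b * ev a - c *: (ev a * ev b).
  by rewrite /= mulr_algr scaleNr.
have ev_rel a b : rel a b -> ev a = ev b.
  case=> {a b}.
  - by move=> b i /=; rewrite hKK scale1r.
  - by move=> b c i j /=; rewrite hKC.
  - by move=> b i j; rewrite /= hKX mulr_algr.
  - move=> i j; rewrite ev_tbr scale1r /= hXX.
    by case: eqP => _ /=; rewrite ?scale0r // !mulr_algr scaleN1r.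
  - move=> b i j ij; rewrite !ev_tbr /= scale0r -(hS b i j ij).
    exact: anti_serre.
  - move=> b i j i0 j1; rewrite !ev_tbr /= scale0r -(hD b i j i0 j1) /qcom.
    by rewrite anti_serre.
  - by move=> b i j ij; rewrite ev_tbr scale1r /= hO // subrr scale0r.
have ev_aeq a b : aeq rel a b -> ev a = ev b.
  elim=> {a b} /=; try by move=> *; congruence.
  - by move=> a b; exact: ev_rel.
  - by move=> a b c; rewrite addrA.
  - by move=> a b; rewrite addrC.
  - by move=> a; rewrite scale0r add0r.
  - by move=> a b c; rewrite mulrA.
  - by move=> a; rewrite scale1r mulr1.
  - by move=> a; rewrite scale0r mulr0.
  - by move=> a b c; rewrite mulrDr.
  - by move=> a b c; rewrite mulrDl.
  - by move=> y z; rewrite scalerDl.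
  - by move=> y z; rewrite mulr_algl scalerA mulrC.
  - by move=> y a; rewrite mulr_algl mulr_algr.
pose g (y : U) := ev (repr y).
have g_pi a : g (pi a) = ev a by exact/ev_aeq/palg_repr.
have gD y z : g (y + z) = g y + g z.
  by rewrite -{1}[y]pi_repr -{1}[z]pi_repr -(pi_add hbar (repr y)) g_pi.
have gM y z : g (y * z) = g z * g y.
  by rewrite -{1}[y]pi_repr -{1}[z]pi_repr -(pi_mul hbar (repr y)) g_pi.
have gC (c : C) : g c%:A = c%:A by have := g_pi (TConst c); rewrite pi_const.
exists g; split; last 2 first.
- by move=> b i; rewrite g_pi.
- by move=> b i; rewrite g_pi.
split=> //; last by rewrite -[1 : U]scale1r gC.
by move=> c y z; rewrite gD -mulr_algl gM gC mulr_algr.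
Qed.

Lemma Ue_serre_weights b (i j : 'I_n) : 2 * w i j / w i i = -1 ->
  serre q (e b i) (e b j) = 0.
Proof.
move=> ij; rewrite -qbr_serre //.
by have := pi_rel (Uq_serre hbar b ij); rewrite !pi_tbr pi_const scale0r.
Qed.

Lemma Ue_orth b (i j : 'I_n) : w i j = 0 -> e b i * e b j = e b j * e b i.
Proof.
move=> ij; apply/qcom1P; have := pi_rel (Uq_orth hbar b ij).
by rewrite pi_tbr pi_const scale0r.
Qed.

Lemma omega_exists : exists g : U -> U, [/\ anti_morphism g,
  forall b i, g (e b i) = e (~~ b) i & forall b i, g (k b i) = k b i].
Proof.
apply: (anti_morphism_exists (x := fun b i => e (~~ b) i)) => //=.
- by move=> b i; rewrite -{2}(negbK b) UkK.
- by move=> *; exact: UkC.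
- move=> b i j; rewrite mulrA Uk_Ue -scalerAl -mulrA UkK mulr1.
  by rewrite mulN1r; case: b; rewrite /= ?mulN1r ?mul1r ?opprK.
- by move=> i j; rewrite (Ue_commutator hbar true j i) eq_sym; case: eqP => [->|].
- by move=> b i j; exact: Ue_serre_weights.
- by move=> b i j i0 j1; apply: qcom1_sym; exact: Ue_short.
- by move=> b i j ij; rewrite (Ue_orth _ ij).
Qed.

(** For [f_alpha] the formula [- f_alpha q^(h_alpha)] is rewritten with the torus
    element on the left, as for [e_alpha]. *)
Definition sgn_antipode b (i : 'I_n) : C := if b then -1 else - qpow hbar (w i i).

Lemma Ue_Uk b c (i j : 'I_n) : e b j * k c i =
  qpow hbar (- (sg C c * (sg C b * w i j))) *: (k c i * e b j).
Proof.
by rewrite Uk_Ue scalerA -qpowD addNr qpow0 scale1r.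
Qed.

Lemma Ue_UkN b (i j : 'I_n) :
  e b i * k (~~ b) j = qpow hbar (w i j) *: (k (~~ b) j * e b i).
Proof.
rewrite Ue_Uk wformC; congr (qpow _ _ *: _).
by case: b; rewrite /= ?mulN1r ?mul1r ?mulN1r ?opprK.
Qed.

Lemma inv_antipode_exists : exists g : U -> U, [/\ anti_morphism g,
  forall b i, g (e b i) = sgn_antipode b i *: (k (~~ b) i * e b i)
  & forall b i, g (k b i) = k (~~ b) i].
Proof.
have kc (i j : 'I_n) b c : k b i * k c j = k c j * k b i by exact: UkC.
have ek b (i j : 'I_n) := Ue_UkN b i j.
have ek' b (i j : 'I_n) : e b j * k (~~ b) i = qpow hbar (w i j) *: (k (~~ b) i * e b j).
  by rewrite ek wformC.
apply: (anti_morphism_exists (x := fun b i => sgn_antipode b i *: (k (~~ b) i * e b i))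
   (kk := fun b i => k (~~ b) i)) => /=.
- by move=> b i; rewrite UkC UkK.
- by move=> *; exact: UkC.
- move=> b i j; rewrite -!scalerAl -!scalerAr; rewrite scalerA mulrC -scalerA; congr (_ *: _).
  rewrite -!mulrA Ue_Uk -!scalerAr !mulrA UkC -(mulrA (k (~~ b) j)) UkK mulr1.
  by rewrite mulN1r mulNr opprK.
- move=> i j.
  have -> : sgn_antipode true i *: (k (~~ true) i * e true i) = - (k false i * e true i).
    by rewrite scaleN1r.
  have -> : sgn_antipode false j *: (k (~~ false) j * e false j) = - (e false j * k true j).
    by rewrite /sgn_antipode (ek false) scaleNr.
  rewrite !mulrNN.
  have E1 : k false i * e false j = qpow hbar (w i j) *: (e false j * k false i).
    by rewrite Uk_Ue /= !mulN1r opprK.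
  have E2 : e true i * k true j = qpow hbar (- w i j) *: (k true j * e true i).
    by rewrite Ue_Uk /= !mul1r wformC.
  (* The torus factors can be distributed around the two root vectors, since the
     two powers of [q] that this produces cancel. *)
  have H : k false i * (e false j * e true i) * k true j =
      e false j * k true j * (k false i * e true i).
    rewrite (mulrA (k false i)) E1 -mulrA E2 -scalerAl -scalerAr scalerA -qpowD subrr.
    by rewrite qpow0 scale1r -!mulrA (mulrA (k false i)) kc -mulrA.
  have -> : k false i * e true i * (e false j * k true j) =
      e false j * k true j * (k false i * e true i)
      + k false i * (e true i * e false j - e false j * e true i) * k true j.
    rewrite mulrBr mulrBl -H !mulrA addrC subrK //.
  rewrite opprD addrA subrr add0r (Ue_commutator hbar true i j) /=.
  case: eqP => [->|_]; last by rewrite mulr0 mul0r oppr0.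
  rewrite -scalerAr -scalerAl -scalerN; congr (_ *: _).
  rewrite mulrBr mulrBl (UkK hbar false) mul1r -mulrA (UkK hbar false) mulr1.
  by rewrite opprB.
- move=> b i j ij.
  rewrite (@serre_scale _ U) (serre_twist _ (kc _ _ _ _) (ek _ _ _) (ek _ _ _) (ek' _ _ _)).
  by rewrite Ue_serre_weights // mulr0 !scaler0.
- move=> b i j i0 j1; rewrite (@serre_scale _ U) qcom_scale2.
  rewrite (serre_short_twist (kc _ _ _ _) (ek _ _ _) (ek _ _ _) (ek' _ _ _)) ?scaler0 //.
  exact: Ue_short.
move=> b i j ij; rewrite -!scalerAl -!scalerAr !scalerA mulrC; congr (_ *: _).
apply/esym/(commute_twist (kc _ _ _ _) (ek _ _ _) (ek' _ _ _)).
exact: Ue_orth.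
Qed.
End AntiMorphisms.

(** * Adjointness of the two oscillator modules *)
Section Adjoint.
Context (R : realType) (n : nat) (hbar : R[i]) (lam : 'rV[R[i]]_n).
Notation C := R[i].
Notation q := (qpow hbar 1).
Notation U := (Uq n hbar).
Notation e b i := (Ue hbar b i).
Notation k b i := (Uk hbar b i).
Hypothesis hn : (2 <= n)%N.
Hypotheses
  (lam_eps : forall i : 'I_n,
     qpow hbar (2 * wform lam (eps R i)) = - (qpow hbar 1)^-1)
  (lam_alpha : forall i : 'I_n, (0 < i)%N -> wform (alpha R i) lam = 0)
  (q_not_root : forall k : nat, (0 < k)%N -> qpow hbar 1 ^+ k != 1).
Let q0 : q != 0 := qpow_neq0 hbar 1.
Notation t := (vac_char hbar lam).
Let q21s : q ^+ 2 - 1 != 0 := q2_neq1 q_not_root.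
Let tqs : t ^+ 2 = - q^-1 := vac_charP hn lam_eps.
Notation act s := (@act R n hbar t s).
Notation ketC := (ket C).
Notation Xop := (ladder q t).
Notation qn := (qnum q).

(** The module generated by [ket 0] lies in the span of the delta functions at
    exponents of monomials. *)
Lemma act_ket0_neg s x (p : lattice) j : p j < 0 -> act s x (ketC 0) p = 0.
Proof.
move=> pj.
rewrite -(wave_vac hn lam_eps lam_alpha q_not_root).
have [r [c [ru ->]]] := basis_vec_span q_not_root (x *: vac hbar lam s).
rewrite (wave_span hn lam_eps lam_alpha q_not_root) fct_sumE big1 // => i _.
rewrite fctE /ket; case: asboolP => [E|_]; last exact: mulr0.
by move: pj; rewrite E ltNge emb_ge0.
Qed.

Definition nonneg_lattice (p : lattice) :=
  (forall j, 0 <= p j) /\ (forall j, (n <= j)%N -> p j = 0).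

Lemma nonneg_emb (m : {ffun 'I_n -> nat}) : nonneg_lattice (emb m).
Proof.
split=> j; first exact: emb_ge0.
by move=> nj; rewrite /emb /ext insubF // ltnNge nj.
Qed.

Variable r : nat -> nat -> C.

(** The ratio between the two matrix coefficients in [adjoint]: each unit in mode
    [j] contributes a factor, which depends on its height [l] in the mode. *)
Definition pweight (p : lattice) : C :=
  \prod_(j < n) \prod_(0 <= l < `|p j|%N) (r j l * qn (l%:Z + 1)).

Lemma pweight0 : pweight 0 = 1.
Proof. by rewrite /pweight big1 // => j _; rewrite big_geq. Qed.

Lemma pweight_unit (u : lattice) j : (j < n)%N -> 0 <= u j ->
  pweight (u + unit_vec j) = r j `|u j|%N * qn (u j + 1) * pweight u.
Proof.
move=> jn uj; rewrite /pweight (bigD1 (Ordinal jn)) //=.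
rewrite [in RHS](bigD1 (Ordinal jn)) //= fctE /unit_vec eqxx.
have -> : absz (u j + true%:R) = (absz (u j)).+1.
  by rewrite mulr1n; lia.
rewrite big_nat_recr //= gez0_abs // [_ * (r _ _ * _)]mulrC -!mulrA.
congr (_ * (_ * (_ * (_ * _)))); apply: eq_bigr => i ij.
by rewrite (_ : (i == j :> nat) = false) ?addr0 //; apply/negbTE.
Qed.

Variables (s : bool) (g : U -> U) (sigma : bool -> nat -> lattice -> C).
(* [g] sends a generator to a ladder operator in the opposite direction, with a
   diagonal factor [sigma]: this is 1 for the involution, and for the inverse
   antipode it comes from the torus element and the sign. *)
Hypotheses (g_anti : anti_morphism g)
  (gK : forall b (i : 'I_n), exists c,
     (forall phi, act true (g (k b i)) phi = torus q t c i phi) /\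
     (forall phi, act s (k b i) phi = torus q t c i phi))
  (gX : forall b (i : 'I_n), exists c,
     (forall p, act true (g (e b i)) (ketC p) =
        (sigma c i (p + ladder_step c i) * ladder_coef q t (~~ c) i (p + ladder_step c i))
          *: ketC (p + ladder_step c i)) /\
     (forall phi, act s (e b i) phi = Xop c i phi)).
Hypotheses
  (r0T : forall u, nonneg_lattice u -> kappa q t = sigma true 0 (u + unit_vec 0) * r 0 `|u 0%N|)
  (r0F : forall u, nonneg_lattice u -> r 0 `|u 0%N| = sigma false 0 u * kappa q t)
  (rT : forall i u, nonneg_lattice u -> (i.+1 < n)%N ->
     r i `|u i| = sigma true i.+1 (u + unit_vec i.+1) * r i.+1 `|u i.+1|)
  (rF : forall i u, nonneg_lattice u -> (i.+1 < n)%N ->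
     r i.+1 `|u i.+1| = sigma false i.+1 (u + unit_vec i) * r i `|u i|).

Lemma nonneg_add_unit u j : (j < n)%N -> nonneg_lattice u -> nonneg_lattice (u + unit_vec j).
Proof.
move=> jn [u0 un]; split=> l; rewrite fctE; first by rewrite addr_ge0 // /unit_vec ler0n.
move=> nl; rewrite un // /unit_vec (_ : (l == j) = false) //.
by apply/negbTE; rewrite neq_ltn (leq_trans jn nl) orbT.
Qed.

Lemma nonneg_sub_unit u j : nonneg_lattice u -> 0 < u j -> nonneg_lattice (u - unit_vec j).
Proof.
move=> [u0 un] uj; split=> l; rewrite !fctE /unit_vec.
  by case: eqP => [->|_] /=; [lia | rewrite subr0].
by move=> nl; rewrite un //; case: eqP => [E|_] //; move: uj; rewrite -E un.
Qed.

Lemma qn0 : qn 0 = 0.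
Proof. by rewrite /qnum oppr0 subrr mul0r. Qed.

(** Either the step leaves the nonnegative range, and both sides vanish, or it
    stays there, and the compatibility of [pweight] with [sigma] applies. *)
Lemma ladder_adjoint c (i : 'I_n) (psi : waves C) (p : lattice) : nonneg_lattice p ->
  (forall (v : lattice) j, v j < 0 -> psi v = 0) ->
  (sigma c i (p + ladder_step c i) * ladder_coef q t (~~ c) i (p + ladder_step c i) = 0
     /\ psi (p + ladder_step c i) = 0) \/
  (nonneg_lattice (p + ladder_step c i) /\
   pweight p * ladder_coef q t c i p =
   sigma c i (p + ladder_step c i) * ladder_coef q t (~~ c) i (p + ladder_step c i)
     * pweight (p + ladder_step c i)).
Proof.
move=> pn psi0; have [p0 _] := pn; have iN := ltn_ord i.
case: c; case: (val i) iN => [|j] jn; rewrite /ladder_step /ladder_coef /=.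
- right; split; first exact: nonneg_add_unit.
  by rewrite pweight_unit // (r0T pn) mulr1; ring.
- have [pj|pj] := eqVneq (p j) 0.
    left; split.
      by rewrite /lift_coef !fctE pj /unit_vec eqxx ltn_eqF // !add0r addNr qn0 mulr0.
    by apply: (psi0 _ j); rewrite !fctE pj /unit_vec eqxx ltn_eqF.
  right; have pj1 : 0 < p j by rewrite lt_def pj p0.
  have un := nonneg_sub_unit pn pj1; set u := p - unit_vec j in un.
  have -> : p + (unit_vec j.+1 - unit_vec j) = u + unit_vec j.+1 by rewrite /u; ring.
  have -> : p = u + unit_vec j by rewrite /u subrK.
  split; first exact: nonneg_add_unit.
  have [u0 _] := un.
  rewrite !pweight_unit ?(ltnW jn) // (rT un jn) /lift_coef !fctE /unit_vec.
  rewrite ?(ltn_eqF (ltnSn _)) ?(gtn_eqF (ltnSn _)) ?eqxx ?mulr1n ?mulr0n ?addr0; ring.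
- have [pj|pj] := eqVneq (p 0%N) 0.
    left; split.
      by rewrite /lower_coef !fctE pj /unit_vec eqxx add0r addNr qn0 !mulr0.
    by apply: (psi0 _ 0%N); rewrite !fctE pj /unit_vec eqxx.
  right; have pj1 : 0 < p 0%N by rewrite lt_def pj p0.
  have un := nonneg_sub_unit pn pj1; have [u0 _] := un.
  split=> //; rewrite -{1}(subrK (unit_vec 0) p) pweight_unit // (r0F un) /lower_coef; ring.
have [pj|pj] := eqVneq (p j.+1) 0.
  left; split.
    by rewrite /lower_coef !fctE pj /unit_vec eqxx gtn_eqF // subr0 add0r addNr qn0 mulr0.
  by apply: (psi0 _ j.+1); rewrite !fctE pj /unit_vec eqxx gtn_eqF.
right; have pj1 : 0 < p j.+1 by rewrite lt_def pj p0.
have un := nonneg_sub_unit pn pj1; set u := p - unit_vec j.+1 in un.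
have -> : p - (unit_vec j.+1 - unit_vec j) = u + unit_vec j by rewrite /u; ring.
have -> : p = u + unit_vec j.+1 by rewrite /u subrK.
split; first exact/nonneg_add_unit/un/ltnW.
have [u0 _] := un.
rewrite !pweight_unit ?(ltnW jn) // (rF un jn) /lower_coef !fctE /unit_vec.
rewrite ?(ltn_eqF (ltnSn _)) ?(gtn_eqF (ltnSn _)) ?eqxx ?mulr1n ?mulr0n ?addr0; ring.
Qed.

(** [g] turns the operator [y] into its transpose with respect to the diagonal
    pairing with weights [pweight]; being an anti-morphism, it need only do so
    on generators. *)
Lemma adjoint y p : nonneg_lattice p ->
  act true (g y) (ketC p) 0 = pweight p * act s y (ketC 0) p.
Proof.
have [gL g1 gM] := g_anti.
elim/Uq_left_ind: y p => [|x y IHx IHy|c x IHx|b i x IHx|b i x IHx] p pn.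
- rewrite g1 !act1 //; have [->|p0] := pselect (p = 0); first by rewrite pweight0 mul1r.
  rewrite /ket !asboolF ?mulr0 // => E; exact: p0.
- have -> : g (x + y) = g x + g y by rewrite -[x]scale1r gL !scale1r.
  by rewrite !act_add // !fctE IHx // IHy // mulrDr.
- have gZ : g (c *: x) = c *: g x.
    have g0 : g 0 = 0.
      have := gL 1 0 0; rewrite !scale1r addr0 => /eqP.
      by rewrite -subr_eq0 opprD addrA subrr sub0r oppr_eq0 => /eqP.
    by rewrite -[c *: x]addr0 gL g0 addr0.
  by rewrite gZ !act_scale // !fctE IHx // mulrCA.
- rewrite gM !act_mul //; have [c [gE sE]] := gX b i; rewrite gE sE act_scalev //.
  rewrite scalrfctE /ladder.
  have neg (v : lattice) j : v j < 0 -> act s x (ketC 0) v = 0 by exact: act_ket0_neg.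
  have [[-> ->]|[pn' E]] := ladder_adjoint c i pn neg; first by rewrite scale0r !mulr0.
  by rewrite IHx // mulrA E -mulrA.
rewrite gM !act_mul //; have [c [gE sE]] := gK b i; rewrite gE sE torus_ket act_scalev //.
by rewrite scalrfctE /torus IHx // mulrCA.
Qed.
End Adjoint.

Section Instances.
Context (R : realType) (n : nat) (hbar : R[i]) (lam : 'rV[R[i]]_n).
Notation C := R[i].
Notation q := (qpow hbar 1).
Notation U := (Uq n hbar).
Notation e b i := (Ue hbar b i).
Notation k b i := (Uk hbar b i).
Hypothesis hn : (2 <= n)%N.
Hypotheses
  (lam_eps : forall i : 'I_n,
     qpow hbar (2 * wform lam (eps R i)) = - (qpow hbar 1)^-1)
  (lam_alpha : forall i : 'I_n, (0 < i)%N -> wform (alpha R i) lam = 0)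
  (q_not_root : forall k : nat, (0 < k)%N -> qpow hbar 1 ^+ k != 1).
Let q0 : q != 0 := qpow_neq0 hbar 1.
Notation t := (vac_char hbar lam).
Let q21s : q ^+ 2 - 1 != 0 := q2_neq1 q_not_root.
Let tqs : t ^+ 2 = - q^-1 := vac_charP hn lam_eps.
Notation act s := (@act R n hbar t s).
Notation ketC := (ket C).

Lemma omegaP : [/\ anti_morphism (@omega R n hbar),
  forall b (i : 'I_n), omega (e b i) = e (~~ b) i &
  forall b (i : 'I_n), omega (k b i) = k b i].
Proof. exact: (xgetPex _ (omega_exists n hbar)). Qed.

Lemma inv_antipodeP : [/\ anti_morphism (@inv_antipode R n hbar),
  forall b (i : 'I_n), inv_antipode (e b i) = sgn_antipode hbar b i *: (k (~~ b) i * e b i)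
  & forall b (i : 'I_n), inv_antipode (k b i) = k (~~ b) i].
Proof.
have [g [g1 gE gK]] := inv_antipode_exists n hbar.
have sE (i : 'I_n) : sgn_antipode hbar false i *: (k true i * e false i) =
    - (e false i * k true i).
  by rewrite (Ue_UkN hbar false) /sgn_antipode scaleNr.
have ex : exists g : U -> U, [/\ anti_morphism g,
      forall i : 'I_n, g (e true i) = - (k false i * e true i),
      forall i : 'I_n, g (e false i) = - (e false i * k true i)
    & forall b (i : 'I_n), g (k b i) = k (~~ b) i].
  exists g; split=> // i; rewrite gE; last exact: sE.
have [h1 h2 h3 h4] : [/\ anti_morphism (@inv_antipode R n hbar),
    forall i : 'I_n, inv_antipode (e true i) = - (k false i * e true i),
    forall i : 'I_n, inv_antipode (e false i) = - (e false i * k true i)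
  & forall b (i : 'I_n), inv_antipode (k b i) = k (~~ b) i].
  exact: (xgetPex _ ex).
split; [exact: h1 | case=> i | exact: h4].
  by rewrite /sgn_antipode /= scaleN1r; exact: h2.
by rewrite sE; exact: h3.
Qed.

(** With the constant factor [kappa] per unit, the lowering and the raising
    operators are transposes of each other. *)
Definition shapovalov_weight (p : lattice) : C :=
  @pweight R n hbar (fun _ _ => kappa q t) p.

Lemma omega_adjoint y p : nonneg_lattice n p ->
  act true (omega y) (ketC p) 0 = shapovalov_weight p * act true y (ketC 0) p.
Proof.
have [g1 gE gK] := omegaP.
apply: (adjoint hn lam_eps lam_alpha q_not_root (sigma := fun _ _ _ => 1)) => //.
- move=> b i; exists b; split=> phi; rewrite ?gK act_k //; by case: b.
- move=> b i; exists b; split=> [p'|phi]; last by rewrite act_e //; case: b.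
  rewrite gE act_e // eqb_id ladder_ket mul1r.
  by case: b; rewrite /ladder_step ?opprK.
all: by move=> *; rewrite ?mul1r.
Qed.

(** The factors are forced by the conditions in [adjoint]: [q ^+ l] compensates
    the torus element in [gamma^-1(e)], each passage to the next mode costs
    [- q^-1], and [- (1 - q^-1)^-1] is [kappa] divided by [- t]. *)
Definition inv_weight (p : lattice) : C := @pweight R n hbar
  (fun j l => (- q^-1) ^+ j * - (1 - q^-1)^-1 * q ^+ l) p.

Lemma inv_antipode_adjoint y p : nonneg_lattice n p ->
  act true (inv_antipode y) (ketC p) 0 = inv_weight p * act false y (ketC 0) p.
Proof.
have [g1 gE gK] := inv_antipodeP.
have absq (u : lattice) j (u0 : forall l, 0 <= u l) : q ^+ `|u j|%N = q ^ u j.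
  by rewrite -{2}[u j]gez0_abs.
have q1 : q - 1 != 0 by rewrite subr_eq0 (q_not_root (isT : (0 < 1)%N)).
(* [gamma^-1(f) = - q^(alpha, alpha) q^h f] and [gamma^-1(e) = - q^(-h) e]. *)
pose sigma (c : bool) i (p : lattice) : C :=
  if c then - q ^+ (if i is _.+1 then 2 else 1) * torus_coef q t i p
  else - (torus_coef q t i p)^-1.
apply: (adjoint hn lam_eps lam_alpha q_not_root (sigma := sigma)) => //.
- move=> b i; exists (~~ b); split=> phi; rewrite ?gK act_k //; by case: b.
- move=> b i; exists (~~ b); split=> [p'|phi]; last by rewrite act_e //; case: b.
  rewrite gE act_scale // act_mul // act_e // eqb_id ladder_ket act_scalev //.
  rewrite act_k // eqb_id torus_ket.
  have -> : ladder_step (~~ b) i = - ladder_step b i by case: b; rewrite /ladder_step /= ?opprK.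
  rewrite negbK !scalerA; congr (_ *: _); rewrite -mulrA mulrCA mulrC; congr (_ * _).
  rewrite /sigma /sgn_antipode wform_alpha_int cartanE eqxx.
  case: b => /=; first by rewrite mulN1r.
  by congr (- _ * _); rewrite qpow_int; case: (nat_of_ord i).
- move=> u [u0 _]; rewrite (absq u _ u0) /sigma /torus_coef /torus_exponent.
  rewrite expr1 expr0 mul1r !fctE /unit_vec eqxx.
  rewrite qN expfzDr // expr1z /kappa; field.
  by rewrite q0 q1 expfz_neq0.
- move=> u [u0 _]; rewrite (absq u _ u0) /sigma /torus_coef /torus_exponent expr0 mul1r.
  rewrite qN /kappa; field.
  by rewrite q0 q1 expfz_neq0 // qpow_neq0.
- move=> i u [u0 _] iN; rewrite !(absq u _ u0) /sigma /torus_coef /torus_exponent.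
  rewrite !fctE /unit_vec eqxx ltn_eqF //.
  rewrite addr0 mul1r !expfzDr // qN expfzDr // expr1z (exprS (- q^-1)); field.
  by rewrite q0 q1 expfz_neq0.
- move=> i u [u0 _] iN; rewrite !(absq u _ u0) /sigma /torus_coef /torus_exponent.
  rewrite !fctE /unit_vec eqxx gtn_eqF //.
  rewrite addr0 mul1r !expfzDr // qN expr1z (exprS (- q^-1)); field.
  by rewrite q0 q1 !expfz_neq0.
Qed.
End Instances.

(** * Triangular decomposition *)
Section Bracket.
Context (R : realType) (n : nat) (hbar : R[i]) (lam : 'rV[R[i]]_n).
Notation C := R[i].
Notation q := (qpow hbar 1).
Notation U := (Uq n hbar).
Notation e b i := (Ue hbar b i).
Notation k b i := (Uk hbar b i).
Notation eval_lam := (@eval_lam R n hbar lam).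
Notation fUe := (@fU_plus_Ue R n hbar).

Lemma eval_lam_linear (a c d : C) (h h' : U) :
  eval_lam (h, c) -> eval_lam (h', d) -> eval_lam (a *: h + h', a * c + d).
Proof.
move=> H H' B Bc SB; have [_ BZ _] := Bc.
exact: (BZ a (h, c : C^o) (h', d : C^o) (H B Bc SB) (H' B Bc SB)).
Qed.

Lemma eval_lam_mul (c d : C) (h h' : U) :
  eval_lam (h, c) -> eval_lam (h', d) -> eval_lam (h * h', c * d).
Proof.
move=> H H' B Bc SB; have [_ _ BM] := Bc.
exact: (BM (h, c : C^o) (h', d : C^o) (H B Bc SB) (H' B Bc SB)).
Qed.

Lemma eval_lam1 : eval_lam (1, 1).
Proof. by move=> B [B1 _ _] _. Qed.

Lemma eval_lam0 : eval_lam (0, 0).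
Proof.
have := eval_lam_linear (-1) eval_lam1 eval_lam1.
by rewrite scaleN1r addNr mulN1r addNr.
Qed.

Lemma eval_lam_k b (i : 'I_n) :
  eval_lam (k b i, qpow hbar (sg C b * wform lam (alpha R i))).
Proof. by move=> B _; apply; exists b, i. Qed.

Lemma eval_lam_C_lam p : eval_lam p -> C_lam lam true p.
Proof.
move=> H B Bc SB; apply: H => // _ [b [i ->]]; apply: SB.
by apply: Or31; exists b, i; rewrite mul1r.
Qed.

(** The torus normalizes each line spanned by a simple root vector. *)
Lemma e_eval_lam j p : eval_lam p -> exists h', e true j * p.1 = h' * e true j.
Proof.
pose B := [pred p : U * C^o | `[< exists h', e true j * p.1 = h' * e true j >]].
move=> /(_ B) H; suff /asboolP : p \in B by [].
apply: H; first split.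
- by apply/asboolP; exists 1; rewrite mulr1 mul1r.
- move=> a u v /asboolP [h Eh] /asboolP [h' Eh']; apply/asboolP.
  exists (a *: h + h').
  by rewrite mulrDl -scalerAl -Eh -Eh' -[(a *: u + v).1]/(a *: u.1 + v.1) mulrDr -scalerAr.
- move=> u v /asboolP [h Eh] /asboolP [h' Eh']; apply/asboolP; exists (h * h').
  by rewrite -[(u * v).1]/(u.1 * v.1) mulrA Eh -!mulrA Eh'.
move=> _ [b [i ->]]; apply/asboolP => /=.
by rewrite Ue_Uk; eexists; exact: scalerAl.
Qed.

(** The least subspace that contains the torus and [sum_i U e_i] and is stable
    under left multiplication by the [f_i].  It is a left ideal containing 1
    ([tri_Ue], [tri_Uk]), hence everything: commuting [e_j] with the [f_i]
    on its right leaves only torus elements. *)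
Inductive triangular : U -> Prop :=
| tri_base h c (z : 'I_n -> U) : eval_lam (h, c) ->
    triangular (h + \sum_i z i * e true i)
| tri_add x y : triangular x -> triangular y -> triangular (x + y)
| tri_scale (c : C) x : triangular x -> triangular (c *: x)
| tri_f i x : triangular x -> triangular (e false i * x).

Lemma tri_Uk b (i : 'I_n) x : triangular x -> triangular (k b i * x).
Proof.
elim=> [h c z hc|y z _ Hy _ Hz|c y _ Hy|j y _ Hy].
- rewrite mulrDr mulr_sumr.
  under eq_bigr do rewrite mulrA.
  by apply: tri_base; apply: eval_lam_mul hc; exact: eval_lam_k.
- by rewrite mulrDr; exact: tri_add.
- by rewrite -scalerAr; exact: tri_scale.
by rewrite mulrA Uk_Ue -scalerAl -mulrA; apply/tri_scale/tri_f.
Qed.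

Lemma tri_sum_e (z : 'I_n -> U) : triangular (\sum_i z i * e true i).
Proof. by rewrite -[X in triangular X]add0r; exact/tri_base/eval_lam0. Qed.

Lemma tri_Ue b (j : 'I_n) x : triangular x -> triangular (e b j * x).
Proof.
case: b; last exact: tri_f.
elim=> [h c z hc|y z _ Hy _ Hz|c y _ Hy|i y Ty Hy].
- have [/= h' E] := e_eval_lam j hc.
  rewrite mulrDr E mulr_sumr.
  under eq_bigr do rewrite mulrA.
  apply: tri_add (tri_sum_e _).
  have -> : h' * e true j = \sum_i (if i == j then h' else 0) * e true i.
    rewrite (bigD1 j) //= eqxx big1 ?addr0 // => i /negPf->.
    by rewrite mul0r.
  exact: tri_sum_e.
- by rewrite mulrDr; exact: tri_add.
- by rewrite -scalerAr; exact: tri_scale.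
rewrite mulrA -[e true j * _](subrK (e false i * e true j)) (Ue_commutator hbar true) mulrDl.
apply: tri_add; last by rewrite -mulrA; exact: tri_f.
case: eqP => _; last by rewrite mul0r -[0](scale0r y); exact: tri_scale.
rewrite -scalerAl mulrBl; apply: tri_scale; rewrite -[- _]scaleN1r.
by apply: tri_add; last apply: tri_scale; exact: tri_Uk.
Qed.

Lemma triangular_all x : triangular x.
Proof.
elim/Uq_left_ind: x => [|x y|c x|b i x|b i x].
- have -> : (1 : U) = 1 + \sum_i 0 * e true i.
    by rewrite big1 ?addr0 // => i _; rewrite mul0r.
  exact: tri_base eval_lam1.
- exact: tri_add.
- exact: tri_scale.
- exact: tri_Ue.
- exact: tri_Uk.
Qed.

Lemma triangular_decomposition x : exists h c, eval_lam (h, c) /\ fUe (x - h).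
Proof.
elim: (triangular_all x) => {x} [h c z hc|x y _ [h [c [hc [y1 [z1 E1]]]]] _
  [h' [d [hd [y2 [z2 E2]]]]]|a x _ [h [c [hc [y1 [z1 E1]]]]]|j x _ _].
- exists h, c; split=> //; exists (fun=> 0), z.
  by rewrite addrC addKr [X in _ = X + _]big1 ?add0r // => i _; rewrite mulr0.
- exists (h + h'), (c + d); split.
    by have := eval_lam_linear 1 hc hd; rewrite scale1r mul1r.
  exists (fun i => y1 i + y2 i), (fun i => z1 i + z2 i).
  rewrite opprD addrACA E1 E2 addrACA.
  by congr (_ + _); rewrite -big_split; apply: eq_bigr => i _; rewrite ?mulrDr ?mulrDl.
- exists (a *: h), (a * c); split.
    by have := eval_lam_linear a hc eval_lam0; rewrite !addr0.
  exists (fun i => a *: y1 i), (fun i => a *: z1 i).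
  rewrite -scalerBr E1 scalerDr !scaler_sumr.
  by congr (_ + _); apply: eq_bigr => i _; [exact: scalerAr | exact: scalerAl].
exists 0, 0; split; first exact: eval_lam0.
exists (fun i => if i == j then x else 0), (fun=> 0).
rewrite subr0 (bigD1 j) //= eqxx big1 ?addr0 => [|i /negPf->]; last by rewrite mulr0.
by rewrite big1 ?addr0 // => i _; rewrite mul0r.
Qed.

Hypothesis hn : (2 <= n)%N.
Hypotheses
  (lam_eps : forall i : 'I_n,
     qpow hbar (2 * wform lam (eps R i)) = - (qpow hbar 1)^-1)
  (lam_alpha : forall i : 'I_n, (0 < i)%N -> wform (alpha R i) lam = 0)
  (q_not_root : forall k : nat, (0 < k)%N -> qpow hbar 1 ^+ k != 1).
Let q0 : q != 0 := qpow_neq0 hbar 1.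
Notation t := (vac_char hbar lam).
Let q21s : q ^+ 2 - 1 != 0 := q2_neq1 q_not_root.
Let tqs : t ^+ 2 = - q^-1 := vac_charP hn lam_eps.
Notation act := (@act R n hbar t true).
Notation ketC := (ket C).

Lemma act_fUe x : fUe x -> act x (ketC 0) 0 = 0.
Proof.
move=> [y [z ->]]; rewrite act_add // fctE.
have act_sumU (F : 'I_n -> U) : act (\sum_i F i) (ketC 0) 0 = \sum_i act (F i) (ketC 0) 0.
  elim/big_ind2: _ => [|a u b v Ea Eb|//]; first by rewrite act0.
  by rewrite act_add // fctE Ea Eb.
rewrite !act_sumU big1 => [|i _]; last first.
  rewrite act_mul // act_e //= /ladder.
  rewrite (@act_ket0_neg _ _ _ _ hn lam_eps lam_alpha q_not_root true _ _ i) ?mulr0 //.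
  rewrite /ladder_step /root_step fctE add0r; case: (val i) => [|j];
    rewrite !fctE /unit_vec eqxx //.
  by rewrite gtn_eqF.
rewrite big1 ?addr0 // => i _.
by rewrite act_mul // act_e //= lower_ket0 act_zero.
Qed.

(** [ket 0] is killed by the [e_i], no vector [f_i y ket 0] has a coefficient at
    the zero sequence, and the torus acts on [ket 0] by [lambda]; so only the
    torus part of [x] contributes.  In particular the value is the same for all decompositions
    of [x]. *)
Lemma bracketE x : bracket lam x = act x (ketC 0) 0.
Proof.
rewrite /bracket; have [h [c [hc fx]]] := triangular_decomposition x.
have H c' : (exists2 h, eval_lam (h, c') & fUe (x - h)) -> c' = act x (ketC 0) 0.
  move=> [h' hc' fx']; rewrite -[in RHS](subrK h' x) act_add // fctE (act_fUe fx') add0r.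
  have /= -> := C_lam_act hn lam_eps lam_alpha q_not_root (eval_lam_C_lam hc').
  by rewrite scalrfctE /ket asboolT // -[c' *: _]/(c' * _) mulr1.
apply: H; apply: (xgetPex 0 (P := [set c | exists2 h, eval_lam (h, c) & fUe (x - h)])).
by exists c, h.
Qed.
End Bracket.

(** * The forms and the inverse form *)
Section Final.
Context (R : realType) (n : nat) (hbar : R[i]) (lam : 'rV[R[i]]_n).
Notation C := R[i].
Notation q := (qpow hbar 1).
Notation U := (Uq n hbar).
Notation M := (Mlam hbar lam true).
Notation N := (Mlam hbar lam false).
Notation index := {ffun 'I_n -> nat}.
Hypothesis hn : (2 <= n)%N.
Hypotheses
  (lam_eps : forall i : 'I_n,
     qpow hbar (2 * wform lam (eps R i)) = - (qpow hbar 1)^-1)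
  (lam_alpha : forall i : 'I_n, (0 < i)%N -> wform (alpha R i) lam = 0)
  (q_not_root : forall k : nat, (0 < k)%N -> qpow hbar 1 ^+ k != 1).
Let q0 : q != 0 := qpow_neq0 hbar 1.
Notation t := (vac_char hbar lam).
Let q21s : q ^+ 2 - 1 != 0 := q2_neq1 q_not_root.
Let tqs : t ^+ 2 = - q^-1 := vac_charP hn lam_eps.
Notation act s := (@act R n hbar t s).
Notation ketC := (ket C).
Notation wvac := (wave_vac hn lam_eps lam_alpha q_not_root).
Notation wbvec := (wave_basis_vec hn lam_eps lam_alpha q_not_root).
Notation wspan := (wave_span hn lam_eps lam_alpha q_not_root).

Lemma f_monE (m : index) : f_mon hbar m *: vac hbar lam true = basis_vec hbar lam true m.
Proof.
by rewrite /basis_vec /f_mon /root_monomial; congr (_ *: _).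
Qed.

(** As the forms are diagonal in the model, they are determined by the values of
    one argument on the support of the other. *)
Lemma shapovalovE (v w : M) (r : seq index) (a : index -> C) :
  wave w = \sum_(i <- r) a i *: ketC (emb i) ->
  shapovalov v w =
  \sum_(i <- r) a i * (shapovalov_weight (n := n) hbar lam (emb i) * wave v (emb i)).
Proof.
move=> E; rewrite /shapovalov (bracketE hn lam_eps lam_alpha q_not_root) act_mul //.
rewrite -/(wave w) E act_sum // fct_sumE; apply: eq_bigr => i _.
by rewrite scalrfctE (omega_adjoint hn lam_eps lam_alpha q_not_root) //; exact: nonneg_emb.
Qed.

Lemma invariant_formE (v : M) (u : N) (r : seq index) (a : index -> C) :
  wave v = \sum_(i <- r) a i *: ketC (emb i) ->
  invariant_form v u =
  \sum_(i <- r) a i * (inv_weight n hbar (emb i) * wave u (emb i)).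
Proof.
move=> E; rewrite /invariant_form (bracketE hn lam_eps lam_alpha q_not_root) act_mul //.
rewrite -/(wave v) E act_sum // fct_sumE; apply: eq_bigr => i _.
by rewrite scalrfctE (inv_antipode_adjoint hn lam_eps lam_alpha q_not_root) //; exact: nonneg_emb.
Qed.

Lemma basis_orthogonal : orthogonal_basis (fun m : index => f_mon hbar m *: vac hbar lam true).
Proof.
rewrite (_ : (fun m : index => _) = basis_vec hbar lam true); last first.
  by apply/funext => m; exact: f_monE.
split; first split.
- by move=> r c ru E; exact: (basis_vec_free hn lam_eps lam_alpha q_not_root ru E).
- by move=> v; have [r [c [_ ->]]] := basis_vec_span q_not_root v; exists r, c.
move=> i j ij; rewrite (shapovalovE _ (r := [:: j]) (a := monomial_coef hbar)).
  rewrite big_seq1 wbvec scalrfctE ket_emb eq_sym (negPf ij).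
  by rewrite scaler0 !mulr0.
by rewrite big_seq1 wbvec.
Qed.

Lemma act_te_eps k phi : (k < n)%N -> act false (te_eps n hbar k) phi = dual_root_op q t k phi.
Proof.
elim: k phi => [|k IH] phi kn; first by rewrite /= act_simple_vec.
rewrite [te_eps _ _ _]/= /qbr act_sub // act_scale // !act_mul // IH ?(ltnW kn) //.
by rewrite !act_simple_vec // IH ?(ltnW kn).
Qed.

Lemma act_te_mon (m : index) : act false (te_mon hbar m) (ketC 0) = ketC (emb m).
Proof.
rewrite /te_mon (@act_raise_monomial _ _ _ _ _ q21s tqs _ (fun=> 1)) //.
  by rewrite big1 ?scale1r // => i _; rewrite expr1n.
move=> j p jn pj; rewrite act_te_eps // scale1r; apply/funext => p'.
rewrite dual_root_opE // ket_shift opprK.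
rewrite -[LHS]/((fun p => q ^ psum j p) p' * ketC (p + unit_vec j) p').
rewrite (ket_mul (fun p => q ^ psum j p)) psum_shift ?pj ?expr0z ?mul1r //.
by move=> l lj; rewrite /unit_vec ltn_eqF.
Qed.

Lemma wave_te (m : index) : wave (te_mon hbar m *: vac hbar lam false) = ketC (emb m).
Proof. by rewrite wvac act_te_mon. Qed.

(** The monomials span, and their images are independent. *)
Lemma wave_inj s (u v : Mlam hbar lam s) : wave u = wave v -> u = v.
Proof.
suff H w : wave (w : Mlam hbar lam s) = 0 -> w = 0.
  move=> E; apply/eqP; rewrite -subr_eq0; apply/eqP/H.
  have -> : u - v = u + (-1)%:A *: v.
    by rewrite scaleN1r.
  rewrite (wave_add hn lam_eps lam_alpha q_not_root).
  by rewrite (wave_alg hn lam_eps lam_alpha q_not_root) E scaleN1r subrr.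
have [r [c [ru ->]]] := basis_vec_span q_not_root w; rewrite wspan => E.
rewrite big1_seq // => i /andP[_ ir].
have := congr1 (fun f : waves C => f (emb i)) E; rewrite sum_ket_emb // ir => /eqP.
by rewrite mulf_eq0 (negPf (monomial_coef_neq0 _ i)) orbF => /eqP->; rewrite !scale0r.
Qed.

Lemma fsum_seq (V : zmodType) (I : choiceType) (G : I -> V) (r : seq I) : uniq r ->
  (forall i, i \notin r -> G i = 0) ->
  finite_set [set i | G i != 0] /\ \sum_(i \in setT) G i = \sum_(i <- r) G i.
Proof.
move=> ru Gr; split.
  apply: sub_finite_set (finite_seq r) => i /= Gi; apply: contraT => ir.
  by rewrite Gr ?eqxx in Gi.
rewrite (fsbigE r) //; last by move=> i _; exact: Gr.
by apply: eq_bigl => i; rewrite in_setT.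
Qed.

(** If the [d m] correspond to multiples of delta functions, a vector is the sum
    of its components along them; the sum is finite, since a vector has finite
    support. *)
Lemma ket_expansion s (d : index -> Mlam hbar lam s) (x c : index -> C)
    (v : Mlam hbar lam s) :
  (forall m, wave (d m) = x m *: ketC (emb m)) ->
  (forall m, c m * x m = wave v (emb m)) -> (forall m, x m != 0) ->
  finite_set [set m | (c m)%:A *: d m != 0] /\
  \sum_(m \in setT) (c m)%:A *: d m = v.
Proof.
move=> dE cE x0; have [r [a [ru E]]] := basis_vec_span q_not_root v.
have vE m : wave v (emb m) = if m \in r then a m * monomial_coef hbar m else 0.
  by rewrite E wspan sum_ket_emb.
have [|fin ->] := fsum_seq (G := fun m => (c m)%:A *: d m) ru.
  move=> m mr; suff -> : c m = 0 by rewrite !scale0r.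
  by have /eqP := cE m; rewrite vE (negPf mr) mulf_eq0 (negPf (x0 m)) orbF => /eqP.
split=> //; apply: wave_inj.
rewrite (wave_sum hn lam_eps lam_alpha q_not_root) [in RHS]E wspan.
apply: eq_big_seq => m mr.
rewrite (wave_alg hn lam_eps lam_alpha q_not_root) dE scalerA cE vE mr //.
Qed.

(** The product in parentheses is the value of the invariant form on the two
    monomials with exponent [m].  It factors over the modes. *)
Lemma F_coefE (m : index) :
  F_coef hbar m * (monomial_coef hbar m * inv_weight n hbar (emb m)) = 1.
Proof.
(* Everything is a rational function of [u = q^(1/2)]. *)
pose u := qpow hbar (1 / 2).
have u2 : u ^+ 2 = q by rewrite /u -qpowMn -(mulr_natr (1 / 2)) mulfVK ?pnatr_eq0.
have u0 : u != 0 := qpow_neq0 hbar _.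
have thetaE : theta hbar = u - u^-1 by rewrite /theta qpowN.
have q1 : q - 1 != 0 by rewrite subr_eq0 (q_not_root (isT : (0 < 1)%N)).
have qintE l : qint hbar l%:R = qnum q l.
  by rewrite /qint /qnum !qpowN -qpow_int qN -qpow_int.
have qint_neq0 l : qint hbar l.+1%:R != 0.
  by rewrite qintE (qnum_neq0 q_not_root).
have qfact_neq0 l : qfact hbar l != 0.
  rewrite /qfact big_add1 /=; apply: (big_ind (fun x => x != 0)) => //.
    exact: oner_neq0.
  by move=> x y; exact: mulf_neq0.
(* One mode, by induction on its occupation number [l]: the step from [l] to
   [l + 1] rests on [theta q^(-1/2) = 1 - q^-1]. *)
have key j l : (- theta hbar) ^+ l *
     (qpow hbar (- (l%:R ^+ 2 / 2) + 2 * l%:R * j%:R) / qfact hbar l) *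
     (((- q^-1) ^+ j) ^+ l *
      \prod_(0 <= i < l) ((- q^-1) ^+ j * - (1 - q^-1)^-1 * q ^+ i * qnum q (i%:Z + 1))) = 1.
  elim: l => [|l IH].
    rewrite /qfact !big_geq // !expr0 !mulr1 !mul1r expr0n mul0r mulr0 mul0r oppr0 addr0.
    by rewrite qpow0 divr1.
  rewrite big_nat_recr //= /qfact big_nat_recr //= -/(qfact hbar l).
  have -> : qpow hbar (- (l.+1%:R ^+ 2 / 2) + 2 * l.+1%:R * j%:R) =
      qpow hbar (- (l%:R ^+ 2 / 2) + 2 * l%:R * j%:R) * (u^-1 * q ^- l * q ^+ (2 * j)).
    rewrite /u -qpowN -[q ^+ l]qpowMn -[q ^+ (2 * j)]qpowMn -qpowN -!qpowD.
    congr (qpow hbar _); rewrite -(mulr_natr 1 l) -(mulr_natr 1 (2 * j)) natrM -natr1.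
    by field.
  rewrite -[RHS]IH.
  have -> : l%:Z + 1 = l.+1 :> int by rewrite intS addrC.
  have := qint_neq0 l; rewrite qintE.
  move: (qnum q l.+1) (qfact hbar l) (qfact_neq0 l) (qpow hbar (- _ + _)) => x y y0 z x0.
  move: (\prod_(0 <= i < l) _) => w; rewrite thetaE !exprS.
  rewrite (mulnC 2 j) exprM -u2.
  have uu1 : u * u - 1 != 0 by rewrite -expr2 u2.
  have P0 : (- u ^- 2) ^+ j != 0 by rewrite expf_neq0 // oppr_eq0 invr_eq0 expf_neq0.
  have -> : (u ^+ 2 ^+ j) ^+ 2 = ((- u ^- 2) ^+ j * (- u ^- 2) ^+ j)^-1.
    by rewrite -exprMn mulrNN -invfM -expr2 exprVn invrK -!exprM (mulnC j).
  have E0 : u ^+ 2 ^+ l != 0 by rewrite !expf_neq0.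
  move: ((- (u - u^-1)) ^+ l) ((- u ^- 2) ^+ j ^+ l) ((- u ^- 2) ^+ j) P0 (u ^+ 2 ^+ l) E0.
  move=> a d p p0 b b0; field.
  by rewrite x0 y0 p0 b0 u0 uu1.
rewrite /F_coef /monomial_coef /inv_weight /pweight -prodrXr -!big_split /= -prodfV -!big_split /=.
rewrite big1 // => i _; rewrite -[RHS](key i (m i)).
by rewrite ext_ord.
Qed.

Lemma gen_subalg_closed (S : set U) : subalg_closed [pred x | `[< gen_subalg S x >]].
Proof.
split.
- by apply/asboolP => B [B1 _ _] _.
- move=> a u v /asboolP Hu /asboolP Hv; apply/asboolP => B Bc SB.
  by have [_ BZ _] := Bc; apply: BZ; [exact: Hu | exact: Hv].
- move=> u v /asboolP Hu /asboolP Hv; apply/asboolP => B Bc SB.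
  by have [_ _ BM] := Bc; apply: BM; [exact: Hu | exact: Hv].
Qed.

Lemma half1 b : Uq_half b (1 : U).
Proof. by have [/asboolP] := gen_subalg_closed [set x : U | exists i, x = Ue hbar b i]. Qed.

Lemma half_lin b (a : C) (x y : U) :
  Uq_half b x -> Uq_half b y -> Uq_half b (a *: x + y).
Proof.
have [_ H _] := gen_subalg_closed [set x : U | exists i, x = Ue hbar b i].
by move=> hx hy; have /asboolP := H a x y (asboolT hx) (asboolT hy).
Qed.

Lemma half_mul b (x y : U) : Uq_half b x -> Uq_half b y -> Uq_half b (x * y).
Proof.
have [_ _ H] := gen_subalg_closed [set x : U | exists i, x = Ue hbar b i].
by move=> hx hy; have /asboolP := H x y (asboolT hx) (asboolT hy).
Qed.

Lemma half0 b : Uq_half b (0 : U).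
Proof.
have := half_lin (-1) (@half1 b) (@half1 b).
by rewrite scaleN1r addNr.
Qed.

Lemma half_scale b (a : C) (x : U) : Uq_half b x -> Uq_half b (a *: x).
Proof. by move=> hx; rewrite -[_ *: _]addr0; apply/half_lin/half0. Qed.

Lemma half_qbr b (a : C) (x y : U) : Uq_half b x -> Uq_half b y -> Uq_half b (qbr a x y).
Proof.
move=> hx hy; rewrite /qbr addrC -scaleNr.
by apply: half_lin; exact: half_mul.
Qed.

Lemma half_simple b k : Uq_half b (simple_vec n hbar b k).
Proof.
rewrite /simple_vec; case: insub => [i|]; last exact: half0.
by move=> B _; apply; exists i.
Qed.

Lemma half_prod b (x : nat -> U) (m : index) : (forall k, Uq_half b (x k)) ->
  Uq_half b (\prod_(i < n) x i ^+ m i).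
Proof.
move=> hx; elim/big_ind: _ => [|y z hy hz|i _]; first exact: half1.
  exact: half_mul.
elim: (m i) => [|l IH]; first by rewrite expr0; exact: half1.
by rewrite exprS; exact: half_mul.
Qed.

Lemma half_f k : Uq_half false (f_eps n hbar k).
Proof. by elim: k => [|k IH] /=; [|apply: half_qbr => //]; exact: half_simple. Qed.

Lemma half_te k : Uq_half true (te_eps n hbar k).
Proof. by elim: k => [|k IH] /=; [|apply: half_qbr => //]; exact: half_simple. Qed.

Lemma wformD (mu nu nu' : 'rV[C]_n) : wform mu (nu + nu') = wform mu nu + wform mu nu'.
Proof. by rewrite -big_split; apply: eq_bigr => i _; rewrite mxE mulrDr. Qed.

Lemma weight1 : @Uq_weight R n hbar 0 1.
Proof.
move=> i; rewrite mulr1 UkK /wform big1 ?qpow0 ?scale1r // => j _.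
by rewrite !mxE mulr0.
Qed.

Lemma weight_mul (mu nu : 'rV[C]_n) (x y : U) :
  Uq_weight mu x -> Uq_weight nu y -> Uq_weight (mu + nu) (x * y).
Proof.
move=> hx hy i; rewrite wformD qpowD.
have -> : Uk hbar true i * (x * y) * Uk hbar false i =
   (Uk hbar true i * x * Uk hbar false i) * (Uk hbar true i * y * Uk hbar false i).
  by rewrite !mulrA -[_ * Uk _ false i * Uk _ true i]mulrA (UkK hbar false) mulr1.
by rewrite hx hy -scalerAl -scalerAr scalerA.
Qed.

Lemma weight_lin (mu : 'rV[C]_n) (a : C) (x y : U) :
  Uq_weight mu x -> Uq_weight mu y -> Uq_weight mu (a *: x + y).
Proof.
move=> hx hy i; rewrite mulrDr mulrDl -scalerAr -scalerAl hx hy.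
by rewrite scalerDr !scalerA mulrC.
Qed.

Lemma weight0 (mu : 'rV[C]_n) : Uq_weight mu (0 : U).
Proof. by move=> i; rewrite mulr0 mul0r scaler0. Qed.

Lemma weight_scale (mu : 'rV[C]_n) (a : C) (x : U) : Uq_weight mu x -> Uq_weight mu (a *: x).
Proof. by move=> hx; rewrite -[_ *: _]addr0; apply/weight_lin/weight0. Qed.

Lemma weight_qbr (mu nu : 'rV[C]_n) (a : C) (x y : U) :
  Uq_weight mu x -> Uq_weight nu y -> Uq_weight (mu + nu) (qbr a x y).
Proof.
move=> hx hy; rewrite /qbr (addrC (x * y)) -scaleNr; apply: weight_lin; last exact: weight_mul.
by rewrite addrC; exact: weight_mul.
Qed.

(** The weight [+-eps_k], and zero when [k] is out of range. *)
Definition eps_row (b : bool) (k : nat) : 'rV[C]_n := \row_j (sg C b * (j == k :> nat)%:R).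

Lemma weight_simple b k : Uq_weight
  (if k is l.+1 then eps_row b k - eps_row b l else eps_row b 0) (simple_vec n hbar b k).
Proof.
rewrite /simple_vec; case: insubP => [i kn ik|_]; last exact: weight0.
move=> j; rewrite Uk_Ue mul1r -scalerAl -mulrA UkK mulr1; congr (qpow hbar _ *: _).
rewrite /wform mulr_sumr; apply: eq_bigr => l _; rewrite mulrCA; congr (_ * _).
rewrite !mxE -val_eqE /= (_ : (i : nat) = k) //; case: k {kn ik} => [|k]; rewrite !mxE.
  by rewrite subr0.
by rewrite mulrBr eqSS.
Qed.

Lemma weight_f k : Uq_weight (eps_row false k) (f_eps n hbar k).
Proof.
elim: k => [|k IH] /=; first exact: (weight_simple false 0).
have -> : eps_row false k.+1 = eps_row false k + (eps_row false k.+1 - eps_row false k).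
  by rewrite addrC subrK.
exact: weight_qbr IH (weight_simple false k.+1).
Qed.

Lemma weight_te k : Uq_weight (eps_row true k) (te_eps n hbar k).
Proof.
elim: k => [|k IH] /=; first exact: (weight_simple true 0).
rewrite -(subrK (eps_row true k) (eps_row true k.+1)).
exact: weight_qbr (weight_simple true k.+1) IH.
Qed.

Lemma weight_prod (w : nat -> 'rV[C]_n) (x : nat -> U) (m : index) :
  (forall k, Uq_weight (w k) (x k)) ->
  Uq_weight (\sum_(i < n) w i *+ m i) (\prod_(i < n) x i ^+ m i).
Proof.
move=> hx; elim/big_ind2: _ => [|y1 y2 z1 z2|i _]; first exact: weight1.
  exact: weight_mul.
elim: (m i) => [|l IH]; first by rewrite expr0 mulr0n; exact: weight1.
by rewrite exprS mulrS; exact: weight_mul.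
Qed.

Lemma coord_weight_f (m : index) k :
  coord (\sum_(i < n) eps_row false i *+ m i) k = - (ext m k)%:R.
Proof.
rewrite /coord /ext; case: insubP => [i _ ik|_]; last by rewrite oppr0.
rewrite summxE (bigD1 i) //= big1 ?addr0 => [|j ji].
  by rewrite mulmxnE mxE eqxx mulN1r mulNrn.
by rewrite mulmxnE mxE eq_sym val_eqE (negPf ji) mulr0 mul0rn.
Qed.

(** As [q] is not a root of unity, the torus separates the weights
    [- sum_k m_k eps_k], so at most one nonzero monomial has a given
    weight. *)
Lemma weight_f_inj (m m' : index) (nu : 'rV[C]_n) :
  f_mon hbar m != 0 -> f_mon hbar m' != 0 ->
  Uq_weight nu (f_mon hbar m) -> Uq_weight nu (f_mon hbar m') -> m = m'.
Proof.
move=> m0 m'0 hm hm'.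
(* [nu] itself is determined only up to the kernel of [q^(alpha_i, -)], so the
   torus eigenvalues are compared instead. *)
have same : forall i : 'I_n,
    qpow hbar (wform (alpha R i) (\sum_(j < n) eps_row false j *+ m j)) =
    qpow hbar (wform (alpha R i) (\sum_(j < n) eps_row false j *+ m' j)).
  have H (p : index) (i : 'I_n) : f_mon hbar p != 0 -> Uq_weight nu (f_mon hbar p) ->
      qpow hbar (wform (alpha R i) (\sum_(j < n) eps_row false j *+ p j)) =
      qpow hbar (wform (alpha R i) nu).
    move=> p0 hp; have := weight_prod p weight_f i; rewrite -/(f_mon hbar p) hp.
    move=> /eqP; rewrite -subr_eq0 -scalerBl => /eqP E.
    apply/eqP; rewrite eq_sym -subr_eq0; apply: contraNT p0 => c0.
    by rewrite -[f_mon _ _]scale1r -(mulVf c0) -scalerA E scaler0.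
  by move=> i; rewrite !H.
have extE k : (k < n)%N -> ext m k = ext m' k.
  have qinj (a b : int) : q ^ a = q ^ b -> a = b.
    move=> E; apply/eqP; rewrite -subr_eq0; apply/negP => /negP ab.
    have E1 : q ^ (a - b) = 1 by rewrite expfzDr // qN E mulfV // expfz_neq0.
    case: (a - b) ab E1 => [[|l]|l] // _.
      by rewrite -exprnP => /eqP; apply/negP/q_not_root.
    by rewrite NegzE qN -exprnP => /eqP; rewrite invr_eq1; apply/negP/q_not_root.
  have qpowNn (a : nat) : qpow hbar (- a%:R) = q ^ (- a%:Z).
    by rewrite qpowN qN -qpow_int.
(* The simple root [alpha_k] compares the exponents [k] and [k-1]. *)
  elim: k => [|k IH] kn; have := same (Ordinal kn); rewrite !wform_alpha /= !coord_weight_f.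
    by rewrite !subr0 !qpowNn => /qinj /oppr_inj [].
  rewrite IH ?(ltnW kn) // !qpowD => /(mulIf (qpow_neq0 _ _)).
  by rewrite !qpowNn => /qinj /oppr_inj [].
by apply/ffunP => i; rewrite -!ext_ord extE.
Qed.

Lemma F_tensor_completed : completed_tensor (F_tensor (n := n) hbar).
Proof.
split.
- move=> m; split; last by apply: half_prod; exact: half_f.
  by apply/half_scale/half_prod; exact: half_te.
- move=> m; split; last by eexists; apply: weight_prod; exact: weight_f.
  by eexists; apply/weight_scale/weight_prod; exact: weight_te.
move=> mu nu; have [[m [_ hm _ m0]]|H] := pselect (exists m : index,
    [/\ Uq_weight mu (F_tensor hbar m).1, Uq_weight nu (F_tensor hbar m).2,
        (F_tensor hbar m).1 != 0 & (F_tensor hbar m).2 != 0]).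
  apply: sub_finite_set (finite_set1 m) => m' /= [_ hm' _ m'0].
  exact: weight_f_inj m'0 m0 hm' hm.
by apply: sub_finite_set (finite_set0 _) => m' /= h; apply: H; exists m'.
Qed.

Lemma wave_F (m : index) :
  wave ((F_coef hbar m *: te_mon hbar m) *: vac hbar lam false) =
  F_coef hbar m *: ketC (emb m).
Proof. by rewrite scaler_algA (wave_alg hn lam_eps lam_alpha q_not_root) wave_te. Qed.

Lemma invariant_form_ket (v : M) (u : N) (m : index) (x : C) :
  wave u = x *: ketC (emb m) ->
  invariant_form v u = wave v (emb m) * (inv_weight n hbar (emb m) * x).
Proof.
move=> uE; have [r [c [ru E]]] := basis_vec_span q_not_root v.
have vE : wave v = \sum_(i <- r) (c i * monomial_coef hbar i) *: ketC (emb i) by rewrite E wspan.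
rewrite (invariant_formE u vE) vE sum_ket_emb // uE.
have termE i : (x *: ketC (emb m)) (emb i) = x * (i == m)%:R.
  by rewrite scalrfctE ket_emb.
case: ifP => mr.
  rewrite (bigD1_seq m) //= termE eqxx mulr1 big1 ?addr0 // => i im.
  by rewrite termE (negPf im) !mulr0.
rewrite mul0r big1_seq // => i /andP[_ ir]; rewrite termE.
by case: eqP ir => [->|_ _]; rewrite ?mr // !mulr0.
Qed.

Lemma F_coef_neq0 (m : index) : F_coef hbar m != 0.
Proof.
by have := F_coefE m; apply: contra_eq_neq => ->; rewrite mul0r eq_sym oner_eq0.
Qed.

(** Both halves say that a vector is the sum of its components along the
    monomials: pairing it with the dual monomial and multiplying by the
    coefficient of [F] extracts the component. *)
Lemma F_tensor_inverse_form : inverse_invariant_form (fun m : index =>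
  ((F_tensor hbar m).1 *: vac hbar lam false, (F_tensor hbar m).2 *: vac hbar lam true)).
Proof.
split=> [v|u].
- apply: (@ket_expansion true (fun m => f_mon hbar m *: vac hbar lam true) (monomial_coef hbar)
    (fun m => invariant_form v ((F_coef hbar m *: te_mon hbar m) *: vac hbar lam false)) v).
  + by move=> m; rewrite f_monE wbvec.
  + move=> m; rewrite (invariant_form_ket v (wave_F m)) -[RHS]mulr1 -(F_coefE m).
    by ring.
  + exact: monomial_coef_neq0.
apply: (@ket_expansion false
    (fun m => (F_coef hbar m *: te_mon hbar m) *: vac hbar lam false) (F_coef hbar)
    (fun m => invariant_form (f_mon hbar m *: vac hbar lam true) u) u).
+ exact: wave_F.
+ move=> m; rewrite (@invariant_formE _ u [:: m] (monomial_coef hbar)); last first.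
    by rewrite big_seq1 f_monE wbvec.
  by rewrite big_seq1 -[RHS]mulr1 -(F_coefE m); ring.
+ exact: F_coef_neq0.
Qed.

End Final.

Theorem proposition4p2 (R : realType) (n : nat) (hn : (2 <= n)%N)
  (hbar : R[i]) (lam : 'rV[R[i]]_n)
  (lam_eps : forall i : 'I_n,
     qpow hbar (2 * wform lam (eps R i)) = - (qpow hbar 1)^-1)
  (lam_alpha : forall i : 'I_n, (0 < i)%N -> wform (alpha R i) lam = 0)
  (q_not_root : forall k : nat, (0 < k)%N -> qpow hbar 1 ^+ k != 1) :
  [/\ orthogonal_basis (fun m : {ffun 'I_n -> nat} =>
        f_mon hbar m *: vac hbar lam true),
      irreducible_module (Mlam hbar lam true) /\
      irreducible_module (Mlam hbar lam false)
    & lift_of_inverse_form lam (F_tensor (n := n) hbar)].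
Proof.
split; first exact: basis_orthogonal.
  by split; exact: Mlam_irreducible.
by split; [exact: F_tensor_completed | exact: F_tensor_inverse_form].
Qed.
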